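(* Let $n\ge 2$, let $c,\lambda\in\mathbb{R}$, and let $\phi:(M^{n+1}(c),g)\to(N^n,h)$ be a Riemannian submersion from an $(n+1)$-dimensional Riemannian manifold of constant sectional curvature $c$ to an $n$-dimensional Riemannian manifold. Assume that one of the following holds: (1) $c\ge 0$; (2) $c<0$ and $\lambda\neq 2(n-1)c$. Then $\phi$ is $\lambda$-biharmonic if and only if $\phi$ is harmonic.
   Context: For a smooth map $\phi:(M,g)\to(N,h)$, the tension field is $\tau(\phi)=\operatorname{tr}_g(\nabla d\phi)=\sum_i\{\nabla^\phi_{e_i}d\phi(e_i)-d\phi(\nabla^M_{e_i}e_i)\}$, and the bitension field is $$\tau_2(\phi)=\sum_i\Big\{\big(\nabla^{\phi}_{e_i}\nabla^{\phi}_{e_i}-\nabla^{\phi}_{\nabla^M_{e_i}e_i}\big)\tau(\phi)-R^N\bigl(d\phi(e_i),\tau(\phi)\bigr)d\phi(e_i)\Big\},$$ where $\{e_i\}$ is a local orthonormal frame of $M$, $\nabla^\phi$ is the induced connection on $\phi^{-1}TN$, and $R^N(X,Y)Z=\nabla^N_X\nabla^N_YZ-\nabla^N_Y\nabla^N_XZ-\nabla^N_{[X,Y]}Z$. The map $\phi$ is harmonic if $\tau(\phi)=0$ identically. For $\lambda\in\mathbb{R}$, a Riemannian submersion $\phi$ is $\lambda$-biharmonic if it is a critical point of $E_{2,\lambda}(\phi)=\frac12\int_M|\tau(\phi)|^2d\mu_g+\frac{\lambda}{2}\int_M|d\phi|^2d\mu_g$, i.e. if it satisfies the Euler--Lagrange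 equation $\tau_{2,\lambda}(\phi):=\tau_2(\phi)-\lambda\tau(\phi)=0$. No completeness or compactness is assumed. *)

(* Defs.v *)
From HB Require Import structures.
From mathcomp Require Import all_boot all_order all_algebra.
From mathcomp Require Import all_classical all_reals all_analysis.

Set Implicit Arguments.
Unset Strict Implicit.
Unset Printing Implicit Defensive.

Import Order.TTheory GRing.Theory Num.Theory.
Import numFieldNormedType.Exports.

Local Open Scope classical_set_scope.
Local Open Scope ring_scope.

Section Smoothness.
Context {R : realType} {m : nat} {W : normedModType R}.

Fixpoint C_on (k : nat) (U : set 'rV[R]_m) (f : 'rV[R]_m -> W) : Prop :=
  match k with
  | 0 => forall p, U p -> {for p, continuous f}
  | k'.+1 => (forall p, U p -> differentiable f p) /\
             (forall v, C_on k' U (fun p => 'D_v f p))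
  end.

Definition smooth_on U f := forall k, C_on k U f.

End Smoothness.

(* Riemannian geometry in coordinates.  Tangent vectors are row vectors of
   components, vector fields are functions 'rV_n -> 'rV_n, and a metric is the
   matrix-valued function g = (g_ij). *)
Section Coordinates.
Context {R : realType}.

Definition inner {n} (G : 'M[R]_n) (u v : 'rV[R]_n) : R :=
  (u *m G *m v^T) ord0 ord0.

Definition partial {n} (i : 'I_n) (f : 'rV[R]_n -> R) (p : 'rV[R]_n) : R :=
  'D_(delta_mx ord0 i) f p.

(* Gamma^k_ij of the Levi-Civita connection *)
Definition christoffel {n} (g : 'rV[R]_n -> 'M[R]_n) (p : 'rV[R]_n)
    (k i j : 'I_n) : R :=
  2^-1 * \sum_(l < n) invmx (g p) k l *
    (partial i (fun q => g q j l) p + partial j (fun q => g q i l) p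
     - partial l (fun q => g q i j) p).

Definition Gamma {n} (g : 'rV[R]_n -> 'M[R]_n) (p u v : 'rV[R]_n) : 'rV[R]_n :=
  \row_k \sum_(i < n) \sum_(j < n)
    christoffel g p k i j * u ord0 i * v ord0 j.

(* Levi-Civita connection nabla_X Y *)
Definition nabla {n} (g : 'rV[R]_n -> 'M[R]_n) (X Y : 'rV[R]_n -> 'rV[R]_n)
    (p : 'rV[R]_n) : 'rV[R]_n :=
  'D_(X p) Y p + Gamma g p (X p) (Y p).

Definition bracket {n} (X Y : 'rV[R]_n -> 'rV[R]_n) (p : 'rV[R]_n) : 'rV[R]_n :=
  'D_(X p) Y p - 'D_(Y p) X p.

Definition curvature {n} (g : 'rV[R]_n -> 'M[R]_n)
    (X Y Z : 'rV[R]_n -> 'rV[R]_n) (p : 'rV[R]_n) : 'rV[R]_n :=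
  nabla g X (nabla g Y Z) p - nabla g Y (nabla g X Z) p
  - nabla g (bracket X Y) Z p.

(* The curvature is tensorial, so its value on tangent vectors at p is obtained
   from any extensions of them; we take those with constant components. *)
Definition curvature_at {n} (g : 'rV[R]_n -> 'M[R]_n) (p u v w : 'rV[R]_n) :
    'rV[R]_n :=
  curvature g (fun=> u) (fun=> v) (fun=> w) p.

Definition sectional {n} (g : 'rV[R]_n -> 'M[R]_n) (p u v : 'rV[R]_n) : R :=
  inner (g p) (curvature_at g p u v v) u /
  (inner (g p) u u * inner (g p) v v - inner (g p) u v ^+ 2).

(* dF(X), a vector field along F *)
Definition push {m n} (F : 'rV[R]_m -> 'rV[R]_n) (X : 'rV[R]_m -> 'rV[R]_m)
    (p : 'rV[R]_m) : 'rV[R]_n := 'D_(X p) F p.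

(* nabla^F_X V on F^{-1}TN, for V a vector field along F *)
Definition nabla_along {m n} (h : 'rV[R]_n -> 'M[R]_n)
    (F : 'rV[R]_m -> 'rV[R]_n) (X : 'rV[R]_m -> 'rV[R]_m)
    (V : 'rV[R]_m -> 'rV[R]_n) (p : 'rV[R]_m) : 'rV[R]_n :=
  'D_(X p) V p + Gamma h (F p) (push F X p) (V p).

Definition orthonormal_frame {m} (g : 'rV[R]_m -> 'M[R]_m) (O : set 'rV[R]_m)
    (e : 'I_m -> 'rV[R]_m -> 'rV[R]_m) : Prop :=
  (forall i, smooth_on O (e i)) /\
  (forall p, O p -> forall i j, inner (g p) (e i p) (e j p) = (i == j)%:R).

Definition tension {m n} (g : 'rV[R]_m -> 'M[R]_m) (h : 'rV[R]_n -> 'M[R]_n)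
    (F : 'rV[R]_m -> 'rV[R]_n) (e : 'I_m -> 'rV[R]_m -> 'rV[R]_m)
    (p : 'rV[R]_m) : 'rV[R]_n :=
  \sum_(i < m) (nabla_along h F (e i) (push F (e i)) p
                - push F (nabla g (e i) (e i)) p).

Definition bitension {m n} (g : 'rV[R]_m -> 'M[R]_m) (h : 'rV[R]_n -> 'M[R]_n)
    (F : 'rV[R]_m -> 'rV[R]_n) (e : 'I_m -> 'rV[R]_m -> 'rV[R]_m)
    (p : 'rV[R]_m) : 'rV[R]_n :=
  let tau := tension g h F e in
  \sum_(i < m) (nabla_along h F (e i) (nabla_along h F (e i) tau) p
                - nabla_along h F (nabla g (e i) (e i)) tau p
                - curvature_at h (F p) (push F (e i) p) (tau p)
                    (push F (e i) p)).

Definition lambda_bitension {m n} (lambda : R) (g : 'rV[R]_m -> 'M[R]_m)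
    (h : 'rV[R]_n -> 'M[R]_n) (F : 'rV[R]_m -> 'rV[R]_n)
    (e : 'I_m -> 'rV[R]_m -> 'rV[R]_m) (p : 'rV[R]_m) : 'rV[R]_n :=
  bitension g h F e p - lambda *: tension g h F e p.

End Coordinates.

(* [coordV] is the inverse of [coord] on [coord @` dom]; both are irrelevant
   outside their domains. *)
Record chart (R : realType) (n : nat) (M : topologicalType) := Chart {
  dom : set M;
  coord : M -> 'rV[R]_n;
  coordV : 'rV[R]_n -> M }.

Record is_chart (R : realType) (n : nat) (M : topologicalType)
    (x : chart R n M) : Prop := IsChart {
  open_dom : open (dom x);
  open_image : open (coord x @` dom x);
  coordK : forall p, dom x p -> coordV x (coord x p) = p;
  coord_continuous : forall p, dom x p -> {for p, continuous (coord x)};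
  coordV_continuous :
    forall q, (coord x @` dom x) q -> {for q, continuous (coordV x)} }.

(* The coordinate expression of f in the charts x and y, and its domain. *)
Definition local_rep (R : realType) (m n : nat) (M N : topologicalType)
    (f : M -> N) (x : chart R m M) (y : chart R n N) : 'rV[R]_m -> 'rV[R]_n :=
  coord y \o f \o coordV x.

Definition local_dom (R : realType) (m n : nat) (M N : topologicalType)
    (f : M -> N) (x : chart R m M) (y : chart R n N) : set 'rV[R]_m :=
  coord x @` (dom x `&` f @^-1` dom y).

Record smooth_manifold (R : realType) (n : nat) := SmoothManifold {
  space :> topologicalType;
  space_hausdorff : hausdorff_space space;
  space_second_countable : @second_countable space;
  atlas : set (chart R n space);
  atlas_chart : forall x, atlas x -> is_chart x;
  atlas_cover : forall p : space, exists2 x, atlas x & dom x p;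
  atlas_compatible : forall x y, atlas x -> atlas y ->
    smooth_on (local_dom id x y) (local_rep id x y) }.

(* In a chart x the metric is the matrix function [metric x] on the image of x.
   Row vectors of components transform by u |-> u *m 'J, whence the form of
   the change-of-chart rule. *)
Record riemannian_manifold (R : realType) (n : nat) := RiemannianManifold {
  manifold :> smooth_manifold R n;
  metric : chart R n manifold -> 'rV[R]_n -> 'M[R]_n;
  metric_smooth : forall x, atlas x -> smooth_on (coord x @` dom x) (metric x);
  metric_sym : forall x, atlas x ->
    forall p, (coord x @` dom x) p -> (metric x p)^T = metric x p;
  metric_pos : forall x, atlas x ->
    forall p, (coord x @` dom x) p ->
    forall u, u != 0 -> 0 < inner (metric x p) u u;
  metric_compatible : forall x y, atlas x -> atlas y ->
    forall p, local_dom id x y p ->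
    let J := 'J (local_rep id x y) p in
    metric x p = J *m metric y (local_rep id x y p) *m J^T }.

Section Maps.
Context {R : realType}.

Definition smooth_map {m n} (M : smooth_manifold R m) (N : smooth_manifold R n)
    (f : M -> N) : Prop :=
  continuous f /\
  forall x y, atlas x -> atlas y -> smooth_on (local_dom f x y) (local_rep f x y).

Definition constant_curvature {n} (M : riemannian_manifold R n) (c : R) : Prop :=
  forall x : chart R n M, atlas x -> forall p, (coord x @` dom x) p ->
  forall u v : 'rV[R]_n, row_free (col_mx u v) -> sectional (metric x) p u v = c.

Definition horizontal {m n} (G : 'M[R]_m) (F : 'rV[R]_m -> 'rV[R]_n)
    (p u : 'rV[R]_m) : Prop :=
  forall w : 'rV[R]_m, 'D_w F p = 0 -> inner G u w = 0.

(* phi need not be onto: only its differentials are required to be. *)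
Definition riemannian_submersion {m n} (M : riemannian_manifold R m)
    (N : riemannian_manifold R n) (phi : M -> N) : Prop :=
  smooth_map phi /\
  forall (x : chart R m M) (y : chart R n N), atlas x -> atlas y ->
  forall p, local_dom phi x y p ->
  let F := local_rep phi x y in
  (forall w : 'rV[R]_n, exists u : 'rV[R]_m, 'D_u F p = w) /\
  (forall u v, horizontal (metric x p) F p u -> horizontal (metric x p) F p v ->
     inner (metric y (F p)) ('D_u F p) ('D_v F p) = inner (metric x p) u v).

(* tau(phi) and tau_2(phi) do not depend on the charts and the local orthonormal
   frame, so a tensor field vanishes when its expressions in all of them do. *)
Definition vanishes_in_frames {m n} (M : riemannian_manifold R m)
    (N : riemannian_manifold R n) (phi : M -> N)
    (T : ('rV[R]_m -> 'M[R]_m) -> ('rV[R]_n -> 'M[R]_n) ->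
         ('rV[R]_m -> 'rV[R]_n) -> ('I_m -> 'rV[R]_m -> 'rV[R]_m) ->
         'rV[R]_m -> 'rV[R]_n) : Prop :=
  forall (x : chart R m M) (y : chart R n N), atlas x -> atlas y ->
  forall (O : set 'rV[R]_m) (e : 'I_m -> 'rV[R]_m -> 'rV[R]_m),
  open O -> O `<=` local_dom phi x y -> orthonormal_frame (metric x) O e ->
  forall p, O p -> T (metric x) (metric y) (local_rep phi x y) e p = 0.

Definition harmonic_map {m n} (M : riemannian_manifold R m)
    (N : riemannian_manifold R n) (phi : M -> N) : Prop :=
  vanishes_in_frames phi tension.

Definition lambda_biharmonic {m n} (lambda : R) (M : riemannian_manifold R m)
    (N : riemannian_manifold R n) (phi : M -> N) : Prop :=
  vanishes_in_frames phi (lambda_bitension lambda).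

End Maps.

(* Main.v *)
Require Import Defs.
From HB Require Import structures.
From mathcomp Require Import all_boot all_order all_algebra.
From mathcomp Require Import all_classical all_reals all_analysis.
From mathcomp Require Import ring lra.
Import Defs.

(** The easy direction is immediate. For the converse, work near a point where
    tau <> 0. Let e0 be a unit vertical field and write nabla_X e0 = S X on
    horizontal X, with S skew, and nabla_e0 e0 = H, so that tau = - H; a prime
    denotes the covariant derivative along e0. The Codazzi equation of the map
    and constant curvature give
<<
      (D_X S) Y = <H,X> S Y - <S X,Y> H + <H,Y> S X,
      D_X H = c X + <X,H> H + S^2 X + S' X,
      R^N(X,Y) Z = c (<Y,Z> X - <X,Z> Y) + <S Y,Z> S X - <S X,Z> S Y - 2 <S X,Y> S Z.
>>
    The curvature R^N is constant along the fibres, hence so is S, and then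
    differentiating the first equation along e0 gives |H'|^4 S = 0. The equation
    tau_2 = lambda tau becomes
<<
      ((2n-1) c + |H|^2 + 2 tr S^2 - lambda) H - S^2 H + H'' = 0.
>>
    If S has no zero, then H' = 0, so H is an eigenvector of S^2;
    differentiating the eigenvalue twice shows that it is 0, that
    lambda = 2 (n-1) c and that c + |H|^2 + 2 tr S^2 = 0. The hypothesis leaves
    c >= 0. Also S H = 0, whose derivative is (c + |H|^2) S + S^3 = 0: then
    - S^2 / (c + |H|^2) is an idempotent of trace 1/2, which is absurd.

    If S = 0, then H'' = mu H with mu = lambda - (2n-1) c - |H|^2, and
    differentiating this along horizontal fields leads to c = 0 or mu = 0. Here
    c = 0 gives H = 0, while mu = 0 gives |H|^2 = - c and lambda = 2 (n-1) c,
    which the hypothesis excludes. Finally S vanishes at a point exactly when the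
    curvature of N there is c, so a smaller open set falls in one of the two
    cases.

    The tensor identities are purely algebraic: they hold for matrices over a
    commutative ring with commuting derivations, here the ring of smooth
    functions on an open subset of a chart. Tangent vectors are rows, so
    endomorphisms act on the right. *)

Set Implicit Arguments.
Unset Strict Implicit.
Unset Printing Implicit Defensive.
Import Order.TTheory GRing.Theory Num.Theory.
Import numFieldNormedType.Exports.
Local Open Scope ring_scope.

(** * Derivations and matrices *)

Record der (A : comNzRingType) := Der {
  dfun :> A -> A;
  derD : forall x y, dfun (x + y) = dfun x + dfun y;
  derM : forall x y, dfun (x * y) = dfun x * y + x * dfun y }.

Section Der.
Variables (A : comNzRingType) (D : der A).

Lemma der0 : D 0 = 0.
Proof. by apply: (addrI (D 0)); rewrite -derD !addr0. Qed.

Lemma derB : {morph D : x y / x - y}.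
Proof.
by move=> x y; apply: (addIr (D y)); rewrite -derD !addrNK.
Qed.
HB.instance Definition _ := GRing.isZmodMorphism.Build A A D derB.

Lemma derN x : D (- x) = - D x.
Proof. exact: raddfN. Qed.

Lemma der1 : D 1 = 0.
Proof.
by apply: (addrI (D 1)); rewrite addr0 -[in RHS](mulr1 1) derM mulr1 mul1r.
Qed.

Lemma mderM m n p (U : 'M[A]_(m, n)) (V : 'M[A]_(n, p)) :
  map_mx D (U *m V) = map_mx D U *m V + U *m map_mx D V.
Proof.
apply/matrixP=> i j; rewrite !mxE raddf_sum /= -big_split; apply: eq_bigr => k _.
by rewrite derM !mxE.
Qed.

Lemma mderZ m n a (V : 'M[A]_(m, n)) :
  map_mx D (a *: V) = D a *: V + a *: map_mx D V.
Proof. by apply/matrixP=> i j; rewrite !mxE derM. Qed.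

Lemma mder_tr n (V : 'M[A]_n) : D (\tr V) = \tr (map_mx D V).
Proof. by rewrite raddf_sum; apply: eq_bigr => i _; rewrite mxE. Qed.

Lemma mder_delta m n i j : map_mx D (delta_mx i j : 'M[A]_(m, n)) = 0.
Proof.
by apply/matrixP=> k l; rewrite !mxE; case: (_ && _); rewrite ?der1 ?der0.
Qed.

End Der.

Section LinearCombinations.
Variables (A : comNzRingType) (m n : nat).
Implicit Types U V : 'M[A]_(m, n).
Lemma addmxE U V i j : (U + V) i j = U i j + V i j. Proof. by rewrite mxE. Qed.
Lemma oppmxE U i j : (- U) i j = - U i j. Proof. by rewrite mxE. Qed.
Lemma scalemxE a U i j : (a *: U) i j = a * U i j. Proof. by rewrite mxE. Qed.
Lemma zeromxE i j : (0 : 'M[A]_(m, n)) i j = 0. Proof. by rewrite mxE. Qed.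
End LinearCombinations.

(* Identities between linear combinations of matrices, products being atoms. *)
Ltac mxring :=
  apply/matrixP=> ? ?; rewrite ?(addmxE, oppmxE, scalemxE, zeromxE); ring.

(** * Bilinear forms on row vectors *)

Definition ip (A : comNzRingType) n (h : 'M[A]_n) (u v : 'rV[A]_n) : A :=
  (u *m h *m v^T) 0 0.

Section Ip.
Variables (A : comNzRingType) (n : nat) (h : 'M[A]_n).
Local Notation "<< u , v >>" := (ip h u v).

Lemma ipDl u v w : << u + v, w >> = << u, w >> + << v, w >>.
Proof. by rewrite /ip !mulmxDl mxE. Qed.
Lemma ipDr u v w : << w, u + v >> = << w, u >> + << w, v >>.
Proof. by rewrite /ip linearD mulmxDr mxE. Qed.
Lemma ipZl a v w : << a *: v, w >> = a * << v, w >>.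
Proof. by rewrite /ip -!scalemxAl mxE. Qed.
Lemma ipZr a v w : << w, a *: v >> = a * << w, v >>.
Proof. by rewrite /ip linearZ -scalemxAr mxE. Qed.
Lemma ipNl v w : << - v, w >> = - << v, w >>.
Proof. by rewrite -scaleN1r ipZl mulN1r. Qed.
Lemma ipNr v w : << w, - v >> = - << w, v >>.
Proof. by rewrite -scaleN1r ipZr mulN1r. Qed.
Lemma ipBl u v w : << u - v, w >> = << u, w >> - << v, w >>.
Proof. by rewrite ipDl ipNl. Qed.
Lemma ipBr u v w : << w, u - v >> = << w, u >> - << w, v >>.
Proof. by rewrite ipDr ipNr. Qed.
Lemma ip0l v : << 0, v >> = 0.
Proof. by rewrite /ip !mul0mx mxE. Qed.
Lemma ip0r v : << v, 0 >> = 0.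
Proof. by rewrite /ip trmx0 mulmx0 mxE. Qed.
Lemma ipC : h^T = h -> forall u v, << u, v >> = << v, u >>.
Proof.
move=> hT u v; have -> : << u, v >> = (u *m h *m v^T)^T 0 0 by rewrite mxE.
by rewrite !trmx_mul trmxK hT mulmxA.
Qed.
Lemma ip_inj (hi : 'M[A]_n) : h *m hi = 1%:M ->
  forall u, (forall v, << u, v >> = 0) -> u = 0.
Proof.
move=> hhi u uv0; rewrite -[u]mulmx1 -hhi mulmxA.
suff -> : u *m h = 0 by rewrite mul0mx.
apply/rowP=> j; have := uv0 (delta_mx 0 j).
by rewrite /ip trmx_delta -colE !mxE.
Qed.
(* the rank one endomorphism X |-> <X, u> w *)
Lemma ip_outer p (u v : 'rV_n) (w : 'rV_p) : v *m (h *m u^T *m w) = << v, u >> *: w.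
Proof.
rewrite !mulmxA; set a := v *m h *m u^T.
by rewrite [a]mx11_scalar mul_scalar_mx.
Qed.
Lemma tr_outer (u w : 'rV_n) : h^T = h -> \tr (h *m u^T *m w) = << u, w >>.
Proof.
by move=> hT; rewrite mxtrace_mulC mulmxA trace_mx11 (ipC hT).
Qed.
Lemma ip_row q (E : 'M[A]_(q, n)) i j :
  (E *m h *m E^T) i j = << row i E, row j E >>.
Proof.
rewrite /ip -row_mul mxE [RHS]mxE; apply: eq_bigr => k _.
by rewrite [row _ _ _ _]mxE 2![_^T _ _]mxE [row _ _ _ _]mxE.
Qed.
End Ip.

(** The rows [e], [L] stacked, times the columns [g *m e^T], [J] side by side, give the identity.
    Since m = n + 1 both factors are square, so the product in the other order is the identity
    too. *)
Lemma orthogonal_decomposition (A : comNzRingType) m n (g : 'M[A]_m)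
    (J : 'M[A]_(m, n)) (L : 'M[A]_(n, m)) (e : 'rV[A]_m) : m = n.+1 ->
  L *m J = 1%:M -> e *m J = 0 -> L *m g *m e^T = 0 -> e *m g *m e^T = 1%:M ->
  J *m L + g *m e^T *m e = 1%:M.
Proof.
move=> mn; move: g J L e; rewrite mn => g J L e LJ eJ Lge ege.
have PQ : (col_mx e L : 'M[A]_(1 + n)) *m (row_mx (g *m e^T) J : 'M[A]_(1 + n)) = 1%:M.
  by rewrite mul_col_row LJ eJ !mulmxA Lge ege -scalar_mx_block.
have := mulmx1C PQ; rewrite mul_row_col => <-.
by rewrite addrC.
Qed.

(** In a full rank factorization P = C B, idempotence forces B C = 1, and tr (C B) = tr (B C). *)
Lemma trace_idempotent (F : fieldType) n (P : 'M[F]_n) :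
  P *m P = P -> \tr P = (\rank P)%:R.
Proof.
move=> PP; pose C := col_base P; pose B := row_base P.
have CB : C *m B = P by exact: mulmx_base.
have BC : B *m C = 1%:M.
  apply: (row_full_inj (col_base_full P)).
  apply: (row_free_inj (row_base_free P)).
  by rewrite mulmx1 -/C -/B mulmxA CB -mulmxA CB PP.
by rewrite -{1}CB mxtrace_mulC BC mxtrace1.
Qed.

(* -S^2/r would be idempotent of trace 1/2 *)
Lemma cubic_trace_contradiction (F : realFieldType) n (S : 'M[F]_n) (r : F) :
  0 < r -> r *: S + S *m S *m S = 0 -> r + 2 * \tr (S *m S) = 0 -> False.
Proof.
move=> r0 cub tr; have rn : r != 0 by rewrite gt_eqF.
have S3 : S *m S *m S = - (r *: S) by apply/eqP; rewrite -addr_eq0 addrC cub.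
pose P := - r^-1 *: (S *m S).
have PP : P *m P = P.
  rewrite /P -scalemxAl -scalemxAr mulmxA S3 mulNmx -scalemxAl scalerN !scalerA.
  have -> : - r^-1 * r = - 1 by field.
  by rewrite scaleN1r opprK.
have := trace_idempotent PP; rewrite /P mxtraceZ.
have -> : \tr (S *m S) = - r / 2.
  by lra.
have -> : - r^-1 * (- r / 2) = 2^-1 by field.
(* Rank 0 would give 1/2 = 0, and a positive rank is at least 1. *)
case: (\rank _) => [|k]; first by move=> /eqP; rewrite invr_eq0 pnatr_eq0.
have k0 : 0 <= k%:R :> F by rewrite ler0n.
by rewrite -[k.+1%:R]natr1 => E; lra.
Qed.

(** * Connections over a commutative ring *)

Section Along.
Variables (A : comNzRingType) (m : nat) (d : 'I_m -> der A).
Implicit Types X Y : 'rV[A]_m.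

Definition along_fun X (f : A) := \sum_i X 0 i * d i f.

Lemma along_fun_add X f g : along_fun X (f + g) = along_fun X f + along_fun X g.
Proof. by rewrite -big_split; apply: eq_bigr => i _; rewrite derD mulrDr. Qed.

Lemma along_fun_mul X f g :
  along_fun X (f * g) = along_fun X f * g + f * along_fun X g.
Proof.
rewrite mulr_suml mulr_sumr -big_split; apply: eq_bigr => i _.
by rewrite derM /=; ring.
Qed.

Fact along_subproof X : {D : der A | D =1 along_fun X}.
Proof. by exists (Der (along_fun_add X) (along_fun_mul X)). Qed.

(* opaque, so that simplification never unfolds it *)
Definition along X : der A := sval (along_subproof X).

Lemma alongE X f : along X f = \sum_i X 0 i * d i f.
Proof. exact: (svalP (along_subproof X)). Qed.

Lemma alongD X Y f : along (X + Y) f = along X f + along Y f.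
Proof.
by rewrite !alongE -big_split; apply: eq_bigr => i _; rewrite !mxE mulrDl.
Qed.

Lemma alongZ a X f : along (a *: X) f = a * along X f.
Proof.
by rewrite !alongE mulr_sumr; apply: eq_bigr => i _; rewrite !mxE mulrA.
Qed.

Lemma malongD p q X Y (V : 'M[A]_(p, q)) :
  map_mx (along (X + Y)) V = map_mx (along X) V + map_mx (along Y) V.
Proof. by apply/matrixP=> i j; rewrite !mxE alongD. Qed.

Lemma malongZ p q a X (V : 'M[A]_(p, q)) :
  map_mx (along (a *: X)) V = a *: map_mx (along X) V.
Proof. by apply/matrixP=> i j; rewrite !mxE alongZ. Qed.

Definition br X Y : 'rV_m := map_mx (along X) Y - map_mx (along Y) X.

Hypothesis dC : forall i j f, d i (d j f) = d j (d i f).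

(** The second-order terms are symmetric in X and Y because the [d i] commute, so only first-order
    terms survive. *)
Lemma along_br X Y f :
  along X (along Y f) - along Y (along X f) = along (br X Y) f.
Proof.
have aa U V : along U (along V f) =
  along (map_mx (along U) V) f + \sum_i \sum_j U 0 i * V 0 j * d i (d j f).
  rewrite !alongE.
  transitivity (\sum_i (\sum_j U 0 i * d i (V 0 j) * d j f +
    \sum_j U 0 i * V 0 j * d i (d j f))).
    apply: eq_bigr => i _; rewrite (raddf_sum (d i)) mulr_sumr -big_split.
    by apply: eq_bigr => j _; rewrite /= derM mulrDr !mulrA.
  rewrite big_split; congr (_ + _).
  rewrite exchange_big; apply: eq_bigr => j _.
  by rewrite mxE alongE mulr_suml.
rewrite !aa /br opprD addrACA.
have -> : along (map_mx (along X) Y - map_mx (along Y) X) f =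
  along (map_mx (along X) Y) f - along (map_mx (along Y) X) f.
  by rewrite -[in LHS]scaleN1r alongD alongZ mulN1r.
rewrite [X in _ + (X - _)]exchange_big /=.
rewrite [X in _ + (X - _)](_ : _ = \sum_i \sum_j Y 0 i * X 0 j * d i (d j f)).
  by rewrite subrr addr0.
by apply: eq_bigr => i _; apply: eq_bigr => j _; rewrite dC [X in X * _]mulrC.
Qed.

Lemma malong_br p q X Y (V : 'M[A]_(p, q)) :
  map_mx (along X) (map_mx (along Y) V) - map_mx (along Y) (map_mx (along X) V)
  = map_mx (along (br X Y)) V.
Proof. by apply/matrixP=> i j; rewrite !mxE along_br. Qed.

End Along.

Lemma trmxD (A : nmodType) m n (U V : 'M[A]_(m, n)) : (U + V)^T = U^T + V^T.
Proof. by apply/matrixP=> i j; rewrite !mxE. Qed.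

(* In a bundle with a fixed frame, a connection is given by matrices K_i:
   the covariant derivative along d_i of the section with components V is
   d_i V + V K_i. *)
Section Connection.
Variables (A : comNzRingType) (m r : nat) (d : 'I_m -> der A).
Variable K : 'I_m -> 'M[A]_r.
Implicit Types X Y : 'rV[A]_m.

Definition conn X := \sum_i X 0 i *: K i.

(** Locked, so that it opens only through [covE]. *)
Definition cov p X (V : 'M[A]_(p, r)) :=
  locked (map_mx (along d X) V + V *m conn X).

Lemma covE p X (V : 'M[A]_(p, r)) :
  cov X V = map_mx (along d X) V + V *m conn X.
Proof. by rewrite /cov -lock. Qed.

Lemma connD X Y : conn (X + Y) = conn X + conn Y.
Proof. by rewrite -big_split; apply: eq_bigr => i _; rewrite !mxE scalerDl. Qed.

Lemma connZ a X : conn (a *: X) = a *: conn X.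
Proof. by rewrite scaler_sumr; apply: eq_bigr => i _; rewrite !mxE scalerA. Qed.

Lemma covDl p X Y (V : 'M[A]_(p, r)) : cov (X + Y) V = cov X V + cov Y V.
Proof. by rewrite !covE malongD connD mulmxDr addrACA. Qed.

Lemma covZl p a X (V : 'M[A]_(p, r)) : cov (a *: X) V = a *: cov X V.
Proof. by rewrite !covE malongZ connZ -scalemxAr scalerDr. Qed.

Lemma covNl p X (V : 'M[A]_(p, r)) : cov (- X) V = - cov X V.
Proof. by rewrite -scaleN1r covZl scaleN1r. Qed.

Lemma cov0l p (V : 'M[A]_(p, r)) : cov 0 V = 0.
Proof. by rewrite -(scale0r 0) covZl scale0r. Qed.

Lemma covDr p X (U V : 'M[A]_(p, r)) : cov X (U + V) = cov X U + cov X V.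
Proof. by rewrite !covE map_mxD mulmxDl addrACA. Qed.

Lemma covNr p X (V : 'M[A]_(p, r)) : cov X (- V) = - cov X V.
Proof. by rewrite !covE map_mxN mulNmx opprD. Qed.

Lemma covBr p X (U V : 'M[A]_(p, r)) : cov X (U - V) = cov X U - cov X V.
Proof. by rewrite covDr covNr. Qed.

Lemma cov0r p X : cov X (0 : 'M[A]_(p, r)) = 0.
Proof. by rewrite !covE map_mx0 mul0mx addr0. Qed.

Lemma covZr p X a (V : 'M[A]_(p, r)) :
  cov X (a *: V) = along d X a *: V + a *: cov X V.
Proof. by rewrite !covE mderZ scalerDr -scalemxAl addrA. Qed.

(** Matrices act on rows from the right, whence the order of the products in the commutator. *)
Definition curvm i j : 'M[A]_r :=
  map_mx (d i) (K j) - map_mx (d j) (K i) + (K j *m K i - K i *m K j).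

Lemma curvm_antisym i j : curvm i j = - curvm j i.
Proof. by rewrite /curvm; mxring. Qed.

Definition curv X Y := \sum_i \sum_j (X 0 i * Y 0 j) *: curvm i j.

Hypothesis dC : forall i j f, d i (d j f) = d j (d i f).

Lemma curvE0 X Y : curv X Y = map_mx (along d X) (conn Y)
  - map_mx (along d Y) (conn X) - conn (br d X Y)
  + (conn Y *m conn X - conn X *m conn Y).
Proof.
have aa U V : map_mx (along d U) (conn V) = conn (map_mx (along d U) V)
  + \sum_i \sum_j (U 0 i * V 0 j) *: map_mx (d i) (K j).
  rewrite exchange_big -big_split (raddf_sum (map_mx (along d U))).
  apply: eq_bigr => j _ /=.
  rewrite mderZ mxE; congr (_ + _).
  apply/matrixP=> k l; rewrite !mxE alongE mulr_sumr summxE; apply: eq_bigr => i _.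
  by rewrite !mxE; ring.
have bb U V : conn V *m conn U = \sum_i \sum_j (U 0 i * V 0 j) *: (K j *m K i).
  rewrite exchange_big mulmx_suml; apply: eq_bigr => j _.
  rewrite mulmx_sumr; apply: eq_bigr => i _.
  by rewrite -scalemxAl -scalemxAr scalerA mulrC.
rewrite !aa !bb /br connD -(scaleN1r (map_mx _ _)) connZ scaleN1r.
set a := conn _; set b := conn _; set S1 := \sum_i _; set S2 := \sum_i _.
set S3 := \sum_i _; set S4 := \sum_i _.
have -> : a + S1 - (b + S2) - (a - b) + (S3 - S4) = S1 - S2 + (S3 - S4).
  by mxring.
rewrite /S2 /S4 exchange_big [X in _ + (_ - X)]exchange_big /=.
rewrite -!sumrB -big_split; apply: eq_bigr => i _ /=.
rewrite -!sumrB -big_split; apply: eq_bigr => j _ /=.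
by rewrite (mulrC (Y 0 j)) -!scalerBr -scalerDr.
Qed.

Lemma curvE p X Y (V : 'M[A]_(p, r)) :
  cov X (cov Y V) - cov Y (cov X V) - cov (br d X Y) V = V *m curv X Y.
Proof.
rewrite curvE0 !covE -(malong_br dC) !map_mxD !mderM.
rewrite !(mulmxDl, mulmxDr, mulmxBr, mulmxBl, mulmxA, mulmxN, mulNmx).
by mxring.
Qed.

End Connection.

(** * Metric connections *)

Section Metric.
Variables (A : comNzRingType) (m r : nat) (d : 'I_m -> der A).
Variables (K : 'I_m -> 'M[A]_r) (h : 'M[A]_r).
Hypothesis hK : forall i, map_mx (d i) h = K i *m h + h *m (K i)^T.

Lemma along_metric X :
  map_mx (along d X) h = conn K X *m h + h *m (conn K X)^T.
Proof.
rewrite /conn linear_sum mulmx_suml mulmx_sumr -big_split.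
apply/matrixP=> i j; rewrite mxE alongE summxE; apply: eq_bigr => k _ /=.
by rewrite linearZ /= -scalemxAl -scalemxAr -scalerDr -hK !mxE.
Qed.

Lemma along_ip X u v :
  along d X (ip h u v) = ip h (cov d K X u) v + ip h u (cov d K X v).
Proof.
have -> : along d X (ip h u v) = (map_mx (along d X) (u *m h *m v^T)) 0 0.
  by rewrite mxE.
rewrite !mderM -map_trmx along_metric /ip !covE.
rewrite trmxD trmx_mul !(mulmxDl, mulmxDr, mulmxA) !mxE.
ring.
Qed.

Hypothesis dC : forall i j f, d i (d j f) = d j (d i f).

(** Apply [along_br] to the function [<u, v>] and expand by the product rule: the mixed terms
    cancel. *)
Lemma curv_skew X Y u v :
  ip h (u *m curv d K X Y) v = - ip h u (v *m curv d K X Y).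
Proof.
have E := along_br dC X Y (ip h u v).
rewrite !along_ip !derD !along_ip in E.
rewrite -!(curvE _ dC) !(ipBl, ipBr).
apply/eqP; rewrite -subr_eq0; move/eqP: E; rewrite -subr_eq0 => /eqP <-.
by apply/eqP; ring.
Qed.

End Metric.

Lemma mulmx_sum_sym (A : comNzRingType) m p (T : 'I_m -> 'M[A]_(m, p)) :
  (forall i j k, T i j k = T j i k) ->
  forall X Y : 'rV[A]_m,
  Y *m (\sum_i X 0 i *: T i) = X *m (\sum_i Y 0 i *: T i).
Proof.
move=> Tsym X Y; apply/rowP=> k; rewrite !mxE.
transitivity (\sum_j \sum_i Y 0 j * X 0 i * T i j k).
  apply: eq_bigr => j _; rewrite summxE mulr_sumr; apply: eq_bigr => i _.
  by rewrite mxE mulrA.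
rewrite exchange_big; apply: eq_bigr => j _; rewrite summxE mulr_sumr.
by apply: eq_bigr => i _; rewrite mxE Tsym; ring.
Qed.

(** * Torsion-free connections and the first Bianchi identity *)

Section TorsionFree.
Variables (A : comNzRingType) (m : nat) (d : 'I_m -> der A).
Variable G : 'I_m -> 'M[A]_m.
Hypothesis Gsym : forall i j k, G i j k = G j i k.
Implicit Types X Y Z : 'rV[A]_m.

Lemma br_nabla X Y : br d X Y = cov d G X Y - cov d G Y X.
Proof.
rewrite /br !covE /conn (mulmx_sum_sym Gsym Y X).
by rewrite opprD addrACA subrr addr0.
Qed.

(** For commuting fields, vanishing torsion gives nabla_X Y = nabla_Y X, and the six second
    derivatives cancel in pairs. *)
Lemma curv_bianchi X Y Z :
  (forall i j f, d i (d j f) = d j (d i f)) ->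
  br d X Y = 0 -> br d Y Z = 0 -> br d Z X = 0 ->
  Z *m curv d G X Y + X *m curv d G Y Z + Y *m curv d G Z X = 0.
Proof.
move=> dC XY YZ ZX; rewrite -!(curvE _ dC) XY YZ ZX !cov0l !subr0.
have cov_sym U V : br d U V = 0 -> cov d G V U = cov d G U V.
  by rewrite br_nabla => /subr0_eq.
by rewrite (cov_sym _ _ XY) (cov_sym _ _ YZ) (cov_sym _ _ ZX); mxring.
Qed.

End TorsionFree.

(** * Christoffel symbols *)

Section Christoffel.
Variables (A : comNzRingType) (m : nat) (d : 'I_m -> der A).
Variables (g gi : 'M[A]_m) (half : A).
Hypothesis gT : g^T = g.
Hypothesis giT : gi^T = gi.
Hypothesis gig : gi *m g = 1%:M.
Hypothesis halfE : half + half = 1.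

(* the entry (j, k) is the Christoffel symbol Gamma^k_ij *)
Definition chris i : 'M[A]_m := \matrix_(j, k) (half *
  \sum_l gi k l * (d i (g j l) + d j (g i l) - d l (g i j))).

Lemma chris_sym i j k : chris i j k = chris j i k.
Proof.
rewrite !mxE; congr (_ * _); apply: eq_bigr => l _; congr (_ * _).
have E : g i j = g j i by rewrite -[in LHS]gT mxE.
by rewrite E [X in X - _]addrC.
Qed.

(** Lowering the index gives the symbols of the first kind. In the sum of the two with j and l
    exchanged, only d_i g_jl remains, twice, and [half] absorbs the factor. *)
Lemma chris_metric i : map_mx (d i) g = chris i *m g + g *m (chris i)^T.
Proof.
have E j l : (chris i *m g) j l =
    half * (d i (g j l) + d j (g i l) - d l (g i j)).
  have -> : chris i *m g = half *: (\matrix_(j, l')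
     (d i (g j l') + d j (g i l') - d l' (g i j)) *m gi *m g).
    rewrite scalemxAl; congr (_ *m _); apply/matrixP=> a b; rewrite !mxE.
    congr (_ * _); apply: eq_bigr => l' _; rewrite mxE mulrC; congr (_ * _).
    by rewrite -[in LHS]giT mxE.
  by rewrite -mulmxA gig mulmx1 scalemxE mxE.
apply/matrixP=> j l; rewrite [LHS]mxE addmxE E.
have -> : (g *m (chris i)^T) j l = (chris i *m g) l j.
  by rewrite -{1}gT -trmx_mul [LHS]mxE.
have S : g l j = g j l by rewrite -[in LHS]gT mxE.
rewrite E S -mulrDr.
set x := d i _; set y := d j _; set z := d l _.
have -> : x + y - z + (x + z - y) = x + x by ring.
by rewrite mulrDr -mulrDl halfE mul1r.
Qed.

End Christoffel.

(* A tensor with the symmetries of a curvature tensor is determined by its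
   sectional curvatures. *)
Lemma curvature_like_eq0 (R : realFieldType) (V : zmodType)
    (T : V -> V -> V -> V -> R) :
  (forall a b v w z, T (a + b) v w z = T a v w z + T b v w z) ->
  (forall u a b w z, T u (a + b) w z = T u a w z + T u b w z) ->
  (forall u v a b z, T u v (a + b) z = T u v a z + T u v b z) ->
  (forall u v w a b, T u v w (a + b) = T u v w a + T u v w b) ->
  (forall u v w z, T v u w z = - T u v w z) ->
  (forall u v w z, T u v z w = - T u v w z) ->
  (forall u v w z, T u v w z + T v w u z + T w u v z = 0) ->
  (forall u v, T u v v u = 0) -> forall u v w z, T u v w z = 0.
Proof.
move=> D1 D2 D3 D4 S12 S34 B T0.
have Tuu u v w : T v w u u = 0.
  by have := S34 v w u u; move/eqP; rewrite -addr_eq0 -mulr2n mulrn_eq0 => /eqP.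
(* Polarization makes T(u, v, w, u) antisymmetric in v, w; the Bianchi identity makes it
   symmetric. *)
have T1 u v w : T u v w u = 0.
  have := T0 u (v + w); rewrite D2 !D3.
  have := B u v w u; have := S12 u w v u; have := Tuu u v w.
  by have := T0 u v; have := T0 u w; lra.
have S14 u v w z : T z v w u = - T u v w z.
  have := T1 (u + z) v w; rewrite D1 !D4.
  by have := T1 u v w; have := T1 z v w; lra.
have S24 u v w z : T u z w v = - T u v w z.
  by rewrite S12 S14 opprK S12.
have S23 u v w z : T u w v z = - T u v w z.
  by rewrite S34 S24 opprK S34.
(* T changes sign under the transpositions of its arguments, so the three terms of the Bianchi sum
   are equal. *)
move=> u v w z; have := B u v w z.
have -> : T v w u z = T u v w z by rewrite S12 S23 opprK S12 S23 opprK.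
have -> : T w u v z = T u v w z by rewrite S12 S23 opprK.
lra.
Qed.

(* Connection pulled back along a map with Jacobian J; DP b a stands for the
   pulled back derivative d_b P_a. *)
Section Pullback.
Variables (A : comNzRingType) (m n r : nat) (d : 'I_m -> der A).
Variables (J : 'M[A]_(m, n)) (P : 'I_n -> 'M[A]_r) (DP : 'I_n -> 'I_n -> 'M[A]_r).
Hypothesis dJ : forall i j a, d i (J j a) = d j (J i a).
Hypothesis dP : forall i a, map_mx (d i) (P a) = \sum_b J i b *: DP b a.

Definition pull i := \sum_a J i a *: P a.
Definition pull_curvm a b := DP a b - DP b a + (P b *m P a - P a *m P b).

Lemma conn_pull X : conn pull X = \sum_a (X *m J) 0 a *: P a.
Proof.
rewrite /conn /pull.
transitivity (\sum_i \sum_a (X 0 i * J i a) *: P a).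
  apply: eq_bigr => i _; rewrite scaler_sumr.
  by apply: eq_bigr => a _; rewrite scalerA.
rewrite exchange_big; apply: eq_bigr => a _.
by rewrite mxE scaler_suml.
Qed.

(** The terms with derivatives of [J] cancel by the symmetry [dJ] of second derivatives; the rest is
    the curvature of the target, whose coefficients are [pull_curvm]. *)
Lemma curvm_pull i j : curvm d pull i j =
  \sum_a \sum_b (J i a * J j b) *: pull_curvm a b.
Proof.
have dpull k l : map_mx (d k) (pull l) = \sum_a d k (J l a) *: P a +
    \sum_a \sum_b (J k a * J l b) *: DP a b.
  rewrite exchange_big -big_split (raddf_sum (map_mx (d k))).
  apply: eq_bigr => b _ /=; rewrite mderZ dP scaler_sumr; congr (_ + _).
  by apply: eq_bigr => a _; rewrite scalerA mulrC.
have mpull k l : pull k *m pull l = \sum_a \sum_b (J k a * J l b) *: (P a *m P b).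
  rewrite mulmx_suml; apply: eq_bigr => a _; rewrite mulmx_sumr.
  by apply: eq_bigr => b _; rewrite -scalemxAl -scalemxAr scalerA.
rewrite /curvm !dpull !mpull.
have -> : \sum_a d j (J i a) *: P a = \sum_a d i (J j a) *: P a.
  by apply: eq_bigr => a _; rewrite dJ.
set z := \sum_a d i (J j a) *: P a.
set s1 := \sum_a _; set s2 := \sum_a _; set s3 := \sum_a _; set s4 := \sum_a _.
transitivity (s1 - s2 + (s3 - s4)); first by mxring.
rewrite /s1 /s2 /s3 /s4.
rewrite [X in _ - X + _]exchange_big [X in _ + (X - _)]exchange_big /=.
rewrite -!sumrB -big_split; apply: eq_bigr => a _ /=.
rewrite -!sumrB -big_split; apply: eq_bigr => b _ /=.
rewrite [J j b * _]mulrC -scalerBr -scalerBr -scalerDr /pull_curvm.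
by [].
Qed.

Lemma curv_pull X Y : curv d pull X Y =
  \sum_a \sum_b ((X *m J) 0 a * (Y *m J) 0 b) *: pull_curvm a b.
Proof.
transitivity (\sum_i \sum_j \sum_a \sum_b
    (X 0 i * J i a * (Y 0 j * J j b)) *: pull_curvm a b).
  apply: eq_bigr => i _; apply: eq_bigr => j _; rewrite curvm_pull scaler_sumr.
  apply: eq_bigr => a _; rewrite scaler_sumr; apply: eq_bigr => b _.
  by rewrite scalerA; congr (_ *: _); ring.
under eq_bigr => i _ do rewrite exchange_big.
rewrite exchange_big; apply: eq_bigr => a _.
under eq_bigr => i _ do rewrite exchange_big.
rewrite exchange_big; apply: eq_bigr => b _.
rewrite [(X *m J) 0 a]mxE [(Y *m J) 0 b]mxE mulr_suml scaler_suml.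
apply: eq_bigr => i _; rewrite mulr_sumr scaler_suml.
by apply: eq_bigr => j _.
Qed.

End Pullback.

Lemma pull_sym (A : comNzRingType) m n (J : 'M[A]_(m, n)) (P : 'I_n -> 'M[A]_n) :
  (forall a b c, P a b c = P b a c) ->
  forall i j k, (J *m pull J P i) j k = (J *m pull J P j) i k.
Proof.
have E i j k : (J *m pull J P i) j k = \sum_b \sum_a J j b * J i a * P a b k.
  rewrite mxE; apply: eq_bigr => b _; rewrite summxE mulr_sumr.
  by apply: eq_bigr => a _; rewrite mxE mulrA.
move=> Psym i j k; rewrite !E exchange_big; apply: eq_bigr => a _.
by apply: eq_bigr => b _; rewrite Psym; ring.
Qed.

(** * Riemannian submersions with one-dimensional fibres *)

(* J is the matrix of the differential, L that of the horizontal lift and e0 a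
   unit vertical field; h and K are the metric and the connection of the target,
   both pulled back to the source. *)
Section Submersion.
Variables (A : comNzRingType) (m n : nat) (d : 'I_m -> der A).
Hypothesis dC : forall i j f, d i (d j f) = d j (d i f).
Hypothesis natI : forall k (x : A), k.+1%:R * x = 0 -> x = 0.

Variables (g : 'M[A]_m) (G : 'I_m -> 'M[A]_m).
Hypothesis gT : g^T = g.
Hypothesis gG : forall i, map_mx (d i) g = G i *m g + g *m (G i)^T.
Hypothesis Gsym : forall i j k, G i j k = G j i k.

Variables (h hi : 'M[A]_n) (K : 'I_m -> 'M[A]_n).
Hypothesis hT : h^T = h.
Hypothesis hhi : h *m hi = 1%:M.
Hypothesis hK : forall i, map_mx (d i) h = K i *m h + h *m (K i)^T.

Variable J : 'M[A]_(m, n).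
Hypothesis JT : forall i j k, (map_mx (d i) J + J *m K i) j k =
                              (map_mx (d j) J + J *m K j) i k.

Variables (L : 'M[A]_(n, m)) (e0 : 'rV[A]_m).
Hypothesis LJ : L *m J = 1%:M.
Hypothesis gL : g *m L^T = J *m h.
Hypothesis e0J : e0 *m J = 0.
Hypothesis e0u : ip g e0 e0 = 1.
Hypothesis dec : J *m L + g *m e0^T *m e0 = 1%:M.

Implicit Types (X Y Z : 'rV[A]_m) (u v w : 'rV[A]_n).
Local Notation "<< u , v >>" := (ip h u v).
Local Notation "X '.∂' V" := (map_mx (along d X) V) (at level 40).
Local Notation D := (cov d K).
Local Notation nb := (cov d G).

Lemma half (x : A) : x + x = 0 -> x = 0.
Proof. by move=> xx; apply: (natI (k := 1)); rewrite mulr_natl. Qed.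

(** * The second fundamental form [BB] of the map *)

Definition BM X := X .∂ J + J *m conn K X - conn G X *m J.
Definition BB X Y := D X (Y *m J) - nb X Y *m J.

(** The derivatives of Y cancel, so [BB] is tensorial in its second argument, with matrix [BM X]. *)
Lemma BBE X Y : BB X Y = Y *m BM X.
Proof.
rewrite /BB /BM !covE mderM !(mulmxDl, mulmxDr, mulmxN, mulmxA).
by mxring.
Qed.

Lemma BBDl X Y Z : BB (X + Y) Z = BB X Z + BB Y Z.
Proof. by rewrite /BB !covDl mulmxDl opprD addrACA. Qed.
Lemma BBZl a X Z : BB (a *: X) Z = a *: BB X Z.
Proof. by rewrite /BB !covZl -scalemxAl scalerBr. Qed.
Lemma BBNl X Z : BB (- X) Z = - BB X Z.
Proof. by rewrite -scaleN1r BBZl scaleN1r. Qed.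
Lemma BBDr X Y Z : BB Z (X + Y) = BB Z X + BB Z Y.
Proof. by rewrite !BBE mulmxDl. Qed.
Lemma BBZr a X Z : BB Z (a *: X) = a *: BB Z X.
Proof. by rewrite !BBE scalemxAl. Qed.

Lemma pull_torsion X Y : D X (Y *m J) - D Y (X *m J) = br d X Y *m J.
Proof.
have TE Z : Z .∂ J + J *m conn K Z =
    \sum_i Z 0 i *: (map_mx (d i) J + J *m K i).
  rewrite /conn mulmx_sumr; apply/matrixP=> i j.
  rewrite !mxE alongE !summxE -big_split; apply: eq_bigr => k _ /=.
  by rewrite -scalemxAr !scalemxE addmxE mulrDr; congr (_ * _ + _); rewrite mxE.
have := mulmx_sum_sym JT X Y; rewrite -!TE => E.
apply/eqP; rewrite -subr_eq0; move/eqP: E; rewrite -subr_eq0 => /eqP <-.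
apply/eqP; rewrite !covE /br !mderM !(mulmxDr, mulmxBl, mulmxA).
by mxring.
Qed.

Lemma BBC X Y : BB X Y = BB Y X.
Proof.
have := pull_torsion X Y; rewrite (br_nabla d Gsym) mulmxBl => /eqP.
rewrite -subr_eq0 => /eqP E; apply/eqP; rewrite -subr_eq0 -E /BB.
by apply/eqP; mxring.
Qed.

(* The horizontal lift w |-> wL is the adjoint of the differential. *)
Lemma ip_lift X v : ip g X (v *m L) = << X *m J, v >>.
Proof. by rewrite /ip trmx_mul !mulmxA -[X *m g *m _]mulmxA gL mulmxA. Qed.

Lemma liftJ v : v *m L *m J = v.
Proof. by rewrite -mulmxA LJ mulmx1. Qed.

Lemma decomp X : X = X *m J *m L + ip g X e0 *: e0.
Proof.
rewrite -[X in LHS]mulmx1 -dec mulmxDr !mulmxA; congr (_ + _).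
by rewrite /ip [X in X *m e0]mx11_scalar mul_scalar_mx.
Qed.

Lemma ip_e0_lift v : ip g e0 (v *m L) = 0.
Proof. by rewrite ip_lift e0J ip0l. Qed.

Lemma ip_lift_e0 v : ip g (v *m L) e0 = 0.
Proof. by rewrite (ipC gT) ip_e0_lift. Qed.

(** The trilinear expression [t] is symmetric in its first two arguments, since both connections are
    torsion-free, and antisymmetric in the last two, since the map is isometric on horizontal
    vectors. Such an expression is zero. *)
Lemma BB_hor u v : BB (u *m L) (v *m L) = 0.
Proof.
pose t a b e := << BB (a *m L) (b *m L), e >>.
have tC a b e : t a b e = t b a e by rewrite /t BBC.
have tN a b e : t a b e = - t a e b.
  apply/eqP; rewrite -addr_eq0 /t /BB !ipBl !liftJ.
  rewrite -!ip_lift (ipC hT (D _ e)) addrACA -opprD.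
  rewrite -(along_ip hK) (ipC gT (nb _ (e *m L))) -(along_ip gG).
  by rewrite ip_lift liftJ subrr.
apply: (ip_inj hhi) => w; apply: half.
suff : t u v w = - t u v w.
  by move/eqP; rewrite -addr_eq0 => /eqP.
by rewrite {1}tN tC tN tC opprK tN tC.
Qed.

(* locked: rewriting must not see the leading sign *)
Definition SS := locked (- (L *m BM e0)).
Definition HH := locked (- (e0 *m BM e0)).

Lemma SSE w : w *m SS = - BB (w *m L) e0.
Proof. by rewrite /SS -lock mulmxN mulmxA -BBE BBC. Qed.
Lemma HHE : HH = - BB e0 e0.
Proof. by rewrite /HH -lock BBE. Qed.

(** * The connection of the source in terms of [SS] and [HH] *)

Lemma nabla_e0_u X : ip g (nb X e0) e0 = 0.
Proof.
apply: half; rewrite {2}(ipC gT) -(along_ip gG) e0u.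
exact: der1.
Qed.

Lemma nabla_e0 X : nb X e0 = - BB X e0 *m L.
Proof.
by rewrite [LHS]decomp nabla_e0_u scale0r addr0 /BB e0J cov0r sub0r opprK.
Qed.

Lemma nabla_lift X v :
  nb X (v *m L) = (D X v - BB X (v *m L)) *m L + << v, BB X e0 >> *: e0.
Proof.
rewrite [LHS]decomp; congr (_ *m L + _ *: e0).
  by rewrite /BB liftJ opprB addrCA subrr addr0.
have := along_ip gG X (v *m L) e0.
rewrite ip_lift_e0 der0 => /eqP; rewrite eq_sym addr_eq0 => /eqP ->.
by rewrite nabla_e0 (ipC gT) ip_lift -mulmxA LJ mulmx1 (ipC hT) ipNr opprK.
Qed.

Lemma nabla_lift_e0 w : nb (w *m L) e0 = w *m SS *m L.
Proof. by rewrite nabla_e0 SSE. Qed.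

Lemma nabla_e0_e0 : nb e0 e0 = HH *m L.
Proof. by rewrite nabla_e0 HHE. Qed.

Lemma nabla_lift_lift w v :
  nb (w *m L) (v *m L) = D (w *m L) v *m L - << v, w *m SS >> *: e0.
Proof.
by rewrite nabla_lift BB_hor subr0 SSE ipNr scaleNr opprK.
Qed.

Lemma nabla_e0_lift v :
  nb e0 (v *m L) = (D e0 v + v *m SS) *m L - << v, HH >> *: e0.
Proof. by rewrite nabla_lift BBC SSE HHE ipNr scaleNr opprK. Qed.

(** Differentiate [<u, v>] along [e0] with the metric of the target, and again with that of the
    source on the lifts. The symmetric part of [SS] is the difference. *)
Lemma SS_skew u v : << u *m SS, v >> = - << u, v *m SS >>.
Proof.
rewrite !SSE !(BBC _ e0) /BB !liftJ !(ipNl, ipNr) opprK.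
rewrite !ipBl !ipBr; set a := << D e0 u, v >>.
have -> : a = along d e0 << u, v >> - << u, D e0 v >>.
  by rewrite (along_ip hK) addrK.
rewrite -ip_lift (ipC hT u (nb _ _ *m _)) -ip_lift (ipC gT _ (u *m L)).
have := along_ip gG e0 (u *m L) (v *m L); rewrite ip_lift liftJ => ->.
by ring.
Qed.

(** Both curvatures are expanded as commutators, with [nb U V *m J] written as
    [D U (V *m J) - BB U V]; the second derivatives of [Z *m J] cancel. *)
Lemma codazzi X Y Z : Z *m J *m curv d K X Y - Z *m curv d G X Y *m J =
  D X (BB Y Z) - D Y (BB X Z) + BB X (nb Y Z) - BB Y (nb X Z)
  - BB (br d X Y) Z.
Proof.
rewrite -(curvE K dC) -(curvE G dC) !mulmxBl.
have E U V : nb U V *m J = D U (V *m J) - BB U V by rewrite /BB subKr.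
rewrite !E !covBr.
by mxring.
Qed.

Lemma br_lift w u : br d (w *m L) (u *m L) =
  (D (w *m L) u - D (u *m L) w) *m L - 2 * << w *m SS, u >> *: e0.
Proof.
have E : << w, u *m SS >> = - << w *m SS, u >> by rewrite SS_skew opprK.
by rewrite (br_nabla d Gsym) !nabla_lift_lift E (ipC hT u) mulmxBl; mxring.
Qed.

(** * Derivatives of endomorphisms and the components of the Codazzi equation *)

Definition dEnd X (Q : 'M[A]_n) := X .∂ Q + Q *m conn K X - conn K X *m Q.

Lemma cov_mulmx X u Q : D X (u *m Q) = D X u *m Q + u *m dEnd X Q.
Proof.
rewrite /dEnd !covE mderM !(mulmxDl, mulmxDr, mulmxN, mulNmx, mulmxA).
by mxring.
Qed.

Lemma mul_dEnd X u Q : u *m dEnd X Q = D X (u *m Q) - D X u *m Q.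
Proof. by rewrite cov_mulmx addrC addKr. Qed.

Lemma dEnd_mul X Q Q' : dEnd X (Q *m Q') = dEnd X Q *m Q' + Q *m dEnd X Q'.
Proof.
rewrite /dEnd mderM !(mulmxDl, mulmxDr, mulmxN, mulNmx, mulmxA).
by mxring.
Qed.

Lemma dEnd_tr X Q : \tr (dEnd X Q) = along d X (\tr Q).
Proof.
by rewrite /dEnd !raddfB raddfD /= mxtrace_mulC addrK mder_tr.
Qed.

Lemma dEnd_SS_skew X u v : << u *m dEnd X SS, v >> = - << u, v *m dEnd X SS >>.
Proof.
rewrite !mul_dEnd ipBl ipBr !SS_skew.
have /eqP := congr1 (along d X) (SS_skew u v).
rewrite derN !(along_ip hK) SS_skew -subr_eq0 => /eqP E2.
apply/eqP; rewrite -subr_eq0 -E2; apply/eqP; ring.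
Qed.

Variable c : A.
Hypothesis dc : forall X, along d X c = 0.
Hypothesis hM : forall X Y Z,
  Z *m curv d G X Y = c *: (ip g Y Z *: X - ip g X Z *: Y).

Lemma codazzi_e0 w u : u *m dEnd (w *m L) SS - w *m dEnd (u *m L) SS =
  - (2 * << w *m SS, u >>) *: HH.
Proof.
have := codazzi (w *m L) (u *m L) e0.
rewrite hM e0J mul0mx !ip_lift_e0 !scale0r subrr scaler0 mul0mx subrr.
have E a : BB (a *m L) e0 = - (a *m SS) by rewrite SSE opprK.
rewrite !E !nabla_lift_e0 !BB_hor !covNr br_lift.
rewrite -scaleNr BBDl BBZl E -[BB e0 e0]opprK -HHE !mul_dEnd mulmxBl => /eqP.
rewrite -subr_eq0 => /eqP E0; apply/eqP; rewrite -subr_eq0 -E0; apply/eqP.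
by mxring.
Qed.

(** As in the Koszul formula: the form [b] is skew in its last two arguments, and [codazzi_e0] gives
    its skew part in the first two, so it is determined. *)
Lemma codazzi_SS w u : u *m dEnd (w *m L) SS =
  << w, HH >> *: (u *m SS) - << w *m SS, u >> *: HH
  + << u, HH >> *: (w *m SS).
Proof.
apply/eqP; rewrite -subr_eq0; apply/eqP; apply: (ip_inj hhi) => v.
apply: half.
pose b x y z := << y *m dEnd (x *m L) SS, z >>.
have bN x y z : b x y z = - b x z y by rewrite /b dEnd_SS_skew (ipC hT y).
pose s x y := << x *m SS, y >>.
have sN x y : s x y = - s y x by rewrite /s SS_skew (ipC hT x).
have E x y z : b x y z - b y x z + 2 * s x y * << z, HH >> = 0.
  have := congr1 (fun a => << a, z >>) (codazzi_e0 x y).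
  by rewrite /b /s ipBl ipZl (ipC hT HH) => ->; ring.
(* In the combination E(w,u,v) - E(u,v,w) + E(v,w,u) everything cancels but 2 b(w,u,v) and known
   terms. *)
have := congr2 +%R (congr2 (fun x y => x - y) (E w u v) (E u v w)) (E v w u).
rewrite subrr addr0 (bN u w) (bN v u) (bN w v) (sN v w) => <-.
rewrite ipBl ipDl ipBl !ipZl -/(b _ _ _) -!/(s _ _) (ipC hT HH); ring.
Qed.

(** The Codazzi equation on ([w *m L], [e0], [e0]). *)
Lemma cov_HH w : D (w *m L) HH =
  c *: w + << w, HH >> *: HH + w *m SS *m SS + w *m dEnd e0 SS.
Proof.
have := codazzi (w *m L) e0 e0.
have E a : BB (a *m L) e0 = - (a *m SS) by rewrite SSE opprK.
rewrite hM e0J mul0mx e0u ip_lift_e0 scale0r subr0 scale1r sub0r.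
rewrite -scalemxAl liftJ nabla_lift_e0 nabla_e0_e0 BB_hor addr0.
rewrite -[BB e0 e0]opprK -HHE covNr E covNr opprK.
rewrite [BB e0 (w *m SS *m L)]BBC E opprK.
have -> : br d (w *m L) e0 = - (D e0 w *m L) + << w, HH >> *: e0.
  by rewrite (br_nabla d Gsym) nabla_lift_e0 nabla_e0_lift mulmxDl; mxring.
rewrite BBDl BBNl BBZl E -[BB e0 e0]opprK -HHE cov_mulmx => /eqP.
rewrite -subr_eq0 => /eqP E0; apply/eqP; rewrite -subr_eq0 -E0; apply/eqP.
by mxring.
Qed.

(** The Codazzi equation on three horizontal vectors, which is O'Neill's formula for the curvature
    of the target. *)
Lemma codazzi_hor w u v : v *m curv d K (w *m L) (u *m L) =
  c *: (<< u, v >> *: w - << w, v >> *: u) + << u *m SS, v >> *: (w *m SS)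
  - << w *m SS, v >> *: (u *m SS) - (2 * << w *m SS, u >>) *: (v *m SS).
Proof.
have E a b : BB (a *m L) (b *m L) = 0 by exact: BB_hor.
have := codazzi (w *m L) (u *m L) (v *m L).
rewrite hM liftJ !BB_hor !cov0r !nabla_lift_lift -!scaleNr !BBDr !BBZr !BB_hor.
rewrite br_lift BBDl -scaleNr BBZl BB_hor [BB e0 _]BBC.
have Ee a : BB (a *m L) e0 = - (a *m SS) by rewrite SSE opprK.
rewrite !Ee -!scalemxAl mulmxDl -!scalemxAl !liftJ !ip_lift !liftJ.
rewrite !(ipC hT v) => /eqP.
rewrite -subr_eq0 => /eqP E0; apply/eqP; rewrite -subr_eq0 -E0; apply/eqP.
by mxring.
Qed.

Lemma delta_mulmx_eq0 p (M : 'M[A]_(n, p)) :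
  (forall a, delta_mx 0 a *m M = 0 :> 'rV_p) -> M = 0.
Proof. by move=> M0; apply/row_matrixP=> a; rewrite rowE M0 row0. Qed.

(** * Constancy along the fibres *)

Variable Q : 'I_n -> 'I_n -> 'M[A]_n.
Definition RN u v := \sum_a \sum_b (u 0 a * v 0 b) *: Q a b.
Hypothesis curvK : forall X Y, curv d K X Y = RN (X *m J) (Y *m J).
Hypothesis e0K : conn K e0 = 0.
Hypothesis dK : forall a, e0 .∂ conn K (delta_mx 0 a *m L) = 0.
Hypothesis dQ : forall a b, e0 .∂ Q a b = 0.
Hypothesis reduced : forall x : A, x * x * x = 0 -> x = 0.

(** The pulled back connection is trivial along the fibres: covariant derivatives along [e0] are
    taken componentwise, and sections with constant components are parallel. *)
Lemma cov_e0 p (V : 'M[A]_(p, n)) : D e0 V = e0 .∂ V.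
Proof. by rewrite !covE e0K mulmx0 addr0. Qed.

Lemma cov_e0_delta a : D e0 (delta_mx 0 a : 'rV_n) = 0.
Proof. by rewrite cov_e0 mder_delta. Qed.

Lemma dEnd_e0 M : dEnd e0 M = e0 .∂ M.
Proof. by rewrite /dEnd e0K mulmx0 mul0mx subr0 addr0. Qed.

Lemma RN_delta a b : RN (delta_mx 0 a) (delta_mx 0 b) = Q a b.
Proof.
rewrite /RN (bigD1 a) //= [X in _ + X]big1 ?addr0 => [|k /negPf ki].
  rewrite (bigD1 b) //= big1 ?addr0 => [|k /negPf ki].
    by rewrite !mxE !eqxx mul1r scale1r.
  by rewrite [X in _ * X]mxE ki andbF mulr0 scale0r.
by rewrite big1 // => l _; rewrite mxE ki andbF mul0r scale0r.
Qed.

(* The squares <Sw,u>^2 are curvatures of N, hence constant along the fibres. *)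
Lemma dSS0 : e0 .∂ SS = 0.
Proof.
suff E : e0 .∂ SS *m h = 0.
  by rewrite -[LHS]mulmx1 -hhi mulmxA E mul0mx.
apply: delta_mulmx_eq0 => a; apply/rowP=> b.
pose da : 'rV[A]_n := delta_mx 0 a; pose db : 'rV[A]_n := delta_mx 0 b.
pose s := << da *m SS, db >>.
have -> : (da *m (e0 .∂ SS *m h)) 0 b = along d e0 s.
  rewrite /s (along_ip hK) /db cov_e0_delta ip0r addr0 cov_e0 mderM.
  by rewrite mder_delta mul0mx add0r mulmxA /ip trmx_delta -colE !mxE.
have de a' b' : along d e0 << delta_mx 0 a', delta_mx 0 b' >> = 0.
  by rewrite (along_ip hK) !cov_e0_delta ip0l ip0r addr0.
have bb : << db *m SS, db >> = 0.
  by apply: half; rewrite {2}SS_skew (ipC hT db) subrr.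
have ba : << db *m SS, da >> = - s by rewrite SS_skew (ipC hT db).
(* The sectional curvature expression of N on [da], [db] is 3 s^2 plus terms constant along the
   fibres. Its derivative is 6 s s', and 6 = 5 + 1 is the factor cancelled by [natI]. *)
have ds0 : s * along d e0 s = 0.
  have := congr1 (fun x => along d e0 << x, da >>) (codazzi_hor da db db).
  rewrite /= bb curvK !liftJ RN_delta (along_ip hK) cov_e0_delta ip0r addr0 cov_e0.
  rewrite mderM mder_delta mul0mx add0r dQ mulmx0 ip0l.
  rewrite scale0r addr0 !(ipBl, ipDl, ipZl) ba -/s !(derD, derB, derN, derM) !de dc.
  rewrite !(mul0r, mulr0, add0r, addr0, oppr0) => E.
  apply: (natI (k := 5)); rewrite [RHS]E.
  by rewrite der1; ring.
(* Differentiating s s' = 0 and multiplying by s' gives s'^3 = 0. *)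
rewrite [RHS]mxE; apply: reduced.
have := congr1 (fun x => along d e0 x * along d e0 s) ds0.
rewrite /= derM der0 mul0r; set s' := along d e0 s; set s'' := along d e0 s'.
have -> : (s' * s' + s * s'') * s' = s' * s' * s' + s * s' * s'' by ring.
by rewrite ds0 mul0r addr0.
Qed.

Local Notation H' := (D e0 HH).

Lemma cov_lift_HH w :
  D (w *m L) HH = w *m (c%:M + h *m HH^T *m HH + SS *m SS).
Proof.
rewrite cov_HH dEnd_e0 dSS0 mulmx0 addr0 !mulmxDr mul_mx_scalar ip_outer.
by rewrite mulmxA.
Qed.

Lemma HH'_SS : (<< H', H' >> ^+ 2) *: SS = 0.
Proof.
(* For a basis vector the bracket of its lift with [e0] is a multiple of [e0], and S is constant
   along [e0]; hence so is its covariant derivative. *)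
have dd a : e0 .∂ dEnd (delta_mx 0 a *m L) SS = 0.
  rewrite /dEnd map_mxB map_mxD !mderM dSS0 dK !mul0mx !mulmx0 !addr0 subr0.
  have := malong_br dC (delta_mx 0 a *m L) e0 SS.
  rewrite (br_nabla d Gsym) nabla_lift_e0 nabla_e0_lift cov_e0_delta add0r.
  rewrite opprB addrCA subrr addr0 malongZ dSS0 scaler0 map_mx0 sub0r.
  by move/eqP; rewrite oppr_eq0 => /eqP.
(* This is the derivative of [codazzi_SS] along [e0]. It is taken on basis vectors, which are
   parallel along [e0], and extended by linearity through [lin1] and [lin2]. *)
have E w u : << w, H' >> *: (u *m SS) - << w *m SS, u >> *: H'
    + << u, H' >> *: (w *m SS) = 0.
  have lin1 x y : << x, H' >> *: (y *m SS) - << x *m SS, y >> *: H'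
      + << y, H' >> *: (x *m SS) =
      x *m (h *m H'^T *m (y *m SS) + h *m (y *m SS)^T *m H'
            + << y, H' >> *: SS).
    by rewrite !mulmxDr !ip_outer -scalemxAr SS_skew; mxring.
  have lin2 x y : << x, H' >> *: (y *m SS) - << x *m SS, y >> *: H'
      + << y, H' >> *: (x *m SS) =
      y *m (<< x, H' >> *: SS - h *m (x *m SS)^T *m H'
            + h *m H'^T *m (x *m SS)).
    by rewrite mulmxDr mulmxBr !ip_outer -scalemxAr (ipC hT y (_ *m _)).
  rewrite lin1 (_ : _ + _ = 0) ?mulmx0 //; apply: delta_mulmx_eq0 => a.
  rewrite -lin1 lin2 (_ : _ + _ = 0) ?mulmx0 //; apply: delta_mulmx_eq0 => b.
  rewrite -lin2.
  have := congr1 (map_mx (along d e0))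
    (codazzi_SS (delta_mx 0 a) (delta_mx 0 b)).
  rewrite mderM dd mulmx0 mder_delta mul0mx addr0 map_mxD map_mxB !mderZ !mderM.
  rewrite !mder_delta dSS0 !mulmx0 !mul0mx !addr0 !scaler0 !addr0.
  rewrite !(along_ip hK) cov_mulmx dEnd_e0 dSS0 mulmx0 !cov_e0_delta !mul0mx.
  by rewrite addr0 !ip0l !ip0r !add0r scale0r add0r -cov_e0.
move: E; generalize H' => x E.
set q := << x, x >>.
(* With w = u = H' the equation gives q H'S = 0. With w = H' alone, multiplied by q, two of its
   terms then vanish and q^2 S = 0 remains. *)
have HS0 : q *: (x *m SS) = 0.
  have := E x x; have -> : << x *m SS, x >> = 0.
    by apply: half; rewrite {2}SS_skew (ipC hT x) subrr.
  rewrite scale0r subr0 -/q -scalerDl => E2.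
  apply/matrixP=> i j; rewrite [RHS]mxE; apply: half.
  by rewrite -addmxE -scalerDl E2 zeromxE.
apply: delta_mulmx_eq0 => a; rewrite -scalemxAr expr2 -scalerA.
have /eqP := congr1 ( *:%R q) (E x (delta_mx 0 a)).
rewrite !(scalerDr, scalerBr, scalerN) scaler0 -/q.
rewrite [q *: (_ *: (x *m SS))]scalerA [q * << _, _ >>]mulrC -scalerA HS0.
rewrite scaler0 addr0 [X in _ - X]scalerA -ipZl scalemxAl.
by rewrite HS0 ip0l scale0r subr0 => /eqP.
Qed.

(** * Traces of bilinear maps *)

Definition bilin p (Phi : 'rV[A]_m -> 'rV[A]_m -> 'rV[A]_p) :=
  (forall a X Y Z, Phi (a *: X + Y) Z = a *: Phi X Z + Phi Y Z) /\
  (forall a X Y Z, Phi Z (a *: X + Y) = a *: Phi Z X + Phi Z Y).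

Lemma bilinE p (Phi : 'rV[A]_m -> 'rV[A]_m -> 'rV[A]_p) : bilin Phi ->
  forall X Y, Phi X Y =
  \sum_k \sum_l (X 0 k * Y 0 l) *: Phi (delta_mx 0 k) (delta_mx 0 l).
Proof.
move=> [linl linr].
have lin (f : 'rV[A]_m -> 'rV[A]_p) :
    (forall a U V, f (a *: U + V) = a *: f U + f V) ->
    forall U, f U = \sum_k U 0 k *: f (delta_mx 0 k).
  move=> flin U; have f0 : f 0 = 0.
    by have /eqP := flin 1 0 0; rewrite !scale1r addr0 -subr_eq0 opprD addNKr
      oppr_eq0 => /eqP.
  have fsum (s : seq 'I_m) : f (\sum_(k <- s) U 0 k *: delta_mx 0 k) =
      \sum_(k <- s) U 0 k *: f (delta_mx 0 k).
    by elim: s => [|k s IH]; rewrite ?big_nil // !big_cons flin IH.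
  by rewrite -fsum {1}[U]row_sum_delta.
move=> X Y; rewrite (lin (Phi^~ Y)) => [|a U V]; last exact: linl.
apply: eq_bigr => k _; rewrite (lin (Phi (delta_mx 0 k))) => [|a U V]; last exact: linr.
by rewrite scaler_sumr; apply: eq_bigr => l _; rewrite scalerA.
Qed.

(** A weighted trace depends on the vectors [E] and the weights [W] only through [E^T *m W *m E], so
    traces over different families can be compared. *)
Lemma bilin_trace p (Phi : 'rV[A]_m -> 'rV[A]_m -> 'rV[A]_p) : bilin Phi ->
  forall q (E : 'M[A]_(q, m)) (W : 'M[A]_q),
  \sum_i \sum_j W i j *: Phi (row i E) (row j E) =
  \sum_k \sum_l (E^T *m W *m E) k l *: Phi (delta_mx 0 k) (delta_mx 0 l).
Proof.
move=> Pb q E W.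
transitivity (\sum_i \sum_j \sum_k \sum_l
    (E i k * W i j * E j l) *: Phi (delta_mx 0 k) (delta_mx 0 l)).
  apply: eq_bigr => i _; apply: eq_bigr => j _.
  rewrite (bilinE Pb) scaler_sumr; apply: eq_bigr => k _.
  rewrite scaler_sumr; apply: eq_bigr => l _.
  by rewrite scalerA !mxE; congr (_ *: _); ring.
under eq_bigr => i _ do rewrite exchange_big.
rewrite exchange_big; apply: eq_bigr => k _.
under eq_bigr => i _ do rewrite exchange_big.
rewrite exchange_big; apply: eq_bigr => l _.
rewrite exchange_big mxE scaler_suml; apply: eq_bigr => j _.
rewrite mxE mulr_suml scaler_suml; apply: eq_bigr => i _.
by rewrite !mxE.
Qed.

Definition htr p (Phi : 'rV[A]_n -> 'rV[A]_n -> 'rV[A]_p) :=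
  \sum_a \sum_b hi a b *: Phi (delta_mx 0 a) (delta_mx 0 b).

(** The hypothesis on [E] says that the frame and the family of [L] and [e0], weighted by [hi] and
    1, define the same contravariant tensor. *)
Lemma frame_trace p (Phi : 'rV[A]_m -> 'rV[A]_m -> 'rV[A]_p) : bilin Phi ->
  forall E : 'M[A]_m, E^T *m E = L^T *m hi *m L + e0^T *m e0 ->
  \sum_i Phi (row i E) (row i E) =
  htr (fun u v => Phi (u *m L) (v *m L)) + Phi e0 e0.
Proof.
move=> Pb E EE.
have -> : \sum_i Phi (row i E) (row i E) =
    \sum_i \sum_j (1%:M : 'M[A]_m) i j *: Phi (row i E) (row j E).
  apply: eq_bigr => i _; rewrite (bigD1 i) //= big1 ?addr0 => [|j /negPf ij].
    by rewrite mxE eqxx scale1r.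
  by rewrite mxE eq_sym ij scale0r.
have -> : Phi e0 e0 =
    \sum_i \sum_j (1%:M : 'M[A]_1) i j *: Phi (row i e0) (row j e0).
  by rewrite !big_ord1 mxE eqxx scale1r !row_id.
have -> : htr (fun u v => Phi (u *m L) (v *m L)) =
    \sum_i \sum_j hi i j *: Phi (row i L) (row j L).
  by apply: eq_bigr => i _; apply: eq_bigr => j _; rewrite !rowE.
rewrite !(bilin_trace Pb) !mulmx1 EE -big_split; apply: eq_bigr => k _.
by rewrite -big_split; apply: eq_bigr => l _; rewrite mxE scalerDl.
Qed.

Lemma hiT : hi^T = hi.
Proof.
have : hi^T *m h = 1%:M by rewrite -[h]hT -trmx_mul hhi trmx1.
by move=> E; rewrite -[LHS]mulmx1 -hhi mulmxA E mul1mx.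
Qed.

Lemma htr_eq p (Phi Psi : 'rV[A]_n -> 'rV[A]_n -> 'rV[A]_p) :
  (forall a b, Phi (delta_mx 0 a) (delta_mx 0 b) =
               Psi (delta_mx 0 a) (delta_mx 0 b)) -> htr Phi = htr Psi.
Proof. by move=> E; apply: eq_bigr => a _; apply: eq_bigr => b _; rewrite E. Qed.

Lemma htrD p (Phi Psi : 'rV[A]_n -> 'rV[A]_n -> 'rV[A]_p) :
  htr (fun u v => Phi u v + Psi u v) = htr Phi + htr Psi.
Proof.
rewrite -big_split; apply: eq_bigr => a _.
by rewrite -big_split; apply: eq_bigr => b _; rewrite scalerDr.
Qed.

Lemma htrZ p x (Phi : 'rV[A]_n -> 'rV[A]_n -> 'rV[A]_p) :
  htr (fun u v => x *: Phi u v) = x *: htr Phi.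
Proof.
rewrite scaler_sumr; apply: eq_bigr => a _.
by rewrite scaler_sumr; apply: eq_bigr => b _; rewrite !scalerA mulrC.
Qed.

Lemma htrC p (Phi : 'rV[A]_n -> 'rV[A]_n -> 'rV[A]_p) :
  htr (fun u v => Phi v u) = htr Phi.
Proof.
rewrite /htr exchange_big; apply: eq_bigr => a _; apply: eq_bigr => b _.
by rewrite -[hi in LHS]hiT mxE.
Qed.

Lemma htr_ip_l p u (M : 'M[A]_(n, p)) :
  htr (fun a b => << b, u >> *: (a *m M)) = u *m M.
Proof.
have -> : u *m M = \sum_a u 0 a *: (delta_mx 0 a *m M).
  rewrite {1}[u]row_sum_delta mulmx_suml.
  by apply: eq_bigr => a _; rewrite scalemxAl.
apply: eq_bigr => a _; under eq_bigr => b _ do rewrite scalerA.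
rewrite -scaler_suml; congr (_ *: _).
transitivity ((u *m h *m hi) 0 a); last by rewrite -mulmxA hhi mulmx1.
rewrite mxE; apply: eq_bigr => b _; rewrite (ipC hT) /ip trmx_delta -colE !mxE.
by rewrite mulrC -[hi]hiT mxE hiT.
Qed.

Lemma htr_ip_r p u (M : 'M[A]_(n, p)) :
  htr (fun a b => << a, u >> *: (b *m M)) = u *m M.
Proof. by rewrite -[RHS]htr_ip_l [LHS]htrC. Qed.

Lemma htr_tr p (M : 'M[A]_n) (w : 'rV[A]_p) :
  htr (fun a b => << a *m M, b >> *: w) = \tr M *: w.
Proof.
rewrite /htr; under eq_bigr => a _ do under eq_bigr => b _ do rewrite scalerA.
under eq_bigr => a _ do rewrite -scaler_suml.
rewrite -scaler_suml; congr (_ *: _); rewrite -[M in RHS]mulmx1 -hhi mulmxA.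
apply: eq_bigr => a _; rewrite [RHS]mxE; apply: eq_bigr => b _.
rewrite /ip trmx_delta -colE -mulmxA -rowE [col _ _ _ _]mxE [row _ _ _ _]mxE.
by rewrite mulrC -{1}hiT [hi^T _ _]mxE.
Qed.

Lemma tr_SS : \tr SS = 0.
Proof.
have E : hi *m (SS *m h)^T = - (hi *m (SS *m h)).
  rewrite -mulmxN; congr (_ *m _); apply/matrixP=> a b.
  have := SS_skew (delta_mx 0 b) (delta_mx 0 a).
  rewrite (ipC hT (delta_mx 0 b)) /ip !trmx_delta -!colE -!(mulmxA (delta_mx _ _)).
  rewrite -!rowE ![col _ _ _ _]mxE ![row _ _ _ _]mxE => E1.
  by rewrite [LHS]mxE [RHS]oppmxE E1.
apply: half; have -> : \tr SS = \tr (hi *m (SS *m h)).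
  by rewrite mxtrace_mulC -mulmxA hhi mulmx1.
by rewrite -{1}mxtrace_tr trmx_mul hiT mxtrace_mulC E raddfN addNr.
Qed.

(** * The tension and bitension fields *)

Definition tens (E : 'M[A]_m) := \sum_i BB (row i E) (row i E).

Definition bitens (E : 'M[A]_m) := \sum_i
  (D (row i E) (D (row i E) (tens E)) - D (nb (row i E) (row i E)) (tens E)
   - row i E *m J *m RN (row i E *m J) (tens E)).

Variable E : 'M[A]_m.
Hypothesis EE : E^T *m E = L^T *m hi *m L + e0^T *m e0.

Lemma htr0 p : htr (fun _ _ => 0 : 'rV[A]_p) = 0.
Proof. by rewrite /htr big1 // => a _; rewrite big1 // => b _; rewrite scaler0. Qed.

(** The horizontal part of the trace vanishes by [BB_hor], which leaves [BB e0 e0]. *)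
Lemma tensE : tens E = - HH.
Proof.
rewrite /tens (frame_trace (Phi := BB)) //; last first.
  by split=> a X Y Z; rewrite ?(BBDl, BBZl, BBDr, BBZr).
rewrite HHE opprK (htr_eq (Psi := fun _ _ => 0)) ?htr0 ?add0r // => a b.
exact: BB_hor.
Qed.

Local Notation k := << HH, HH >>.
Local Notation t := (\tr (SS *m SS)).

Lemma RN_linl a u v w : RN (a *: u + v) w = a *: RN u w + RN v w.
Proof.
rewrite scaler_sumr -big_split; apply: eq_bigr => i _.
rewrite scaler_sumr -big_split; apply: eq_bigr => j _ /=.
by rewrite !mxE mulrDl scalerDl scalerA mulrA.
Qed.

Lemma RN_Nr u v : RN u (- v) = - RN u v.
Proof.
rewrite /RN -sumrN; apply: eq_bigr => i _.
rewrite -sumrN; apply: eq_bigr => j _; by rewrite mxE mulrN scaleNr.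
Qed.

Local Notation TT := (c%:M + h *m HH^T *m HH + SS *m SS).

Lemma tr_TT : \tr TT = n%:R * c + k + t.
Proof. by rewrite !raddfD /= mxtrace_scalar (tr_outer _ _ hT) mulr_natl. Qed.

Lemma mul_TT w : w *m TT = c *: w + << w, HH >> *: HH + w *m SS *m SS.
Proof. by rewrite !mulmxDr mul_mx_scalar ip_outer mulmxA. Qed.

Lemma mul_dEnd_TT w u : u *m dEnd (w *m L) TT =
  << u, w *m TT >> *: HH + << u, HH >> *: (w *m TT)
  + u *m dEnd (w *m L) SS *m SS + u *m SS *m dEnd (w *m L) SS.
Proof.
rewrite mul_dEnd !mul_TT -(mul_TT w) -cov_lift_HH.
rewrite -[u *m SS *m SS]mulmxA !covDr !covZr dc (along_ip hK) !cov_mulmx dEnd_mul.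
by rewrite !(mulmxDr, mulmxA); mxring.
Qed.

Definition Hess X Y := D X (D Y HH) - D (nb X Y) HH.

Lemma Hess_lift u v : Hess (u *m L) (v *m L) =
  v *m dEnd (u *m L) TT + << v, u *m SS >> *: H'.
Proof.
rewrite /Hess nabla_lift_lift covDl -scaleNr covZl !cov_lift_HH cov_mulmx.
by mxring.
Qed.

Lemma Hess_e0 : Hess e0 e0 = D e0 H' - HH *m TT.
Proof. by rewrite /Hess nabla_e0_e0 cov_lift_HH. Qed.

Lemma htr_Hess : htr (fun u v => Hess (u *m L) (v *m L)) =
  (n%:R * c + k + 2 * t) *: HH + HH *m TT + 2 *: (HH *m SS *m SS).
Proof.
(* The Hessian is split into pieces contracted by [htr_tr], [htr_ip_l] and [htr_ip_r]; the trace of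
   [T4] contains tr S = 0. *)
pose T1 (u v : 'rV[A]_n) := << u *m TT, v >> *: HH.
pose T2 (u v : 'rV[A]_n) := << v, HH >> *: (u *m TT).
pose T3 (u v : 'rV[A]_n) := << u, HH >> *: (v *m (SS *m SS)).
pose T4 (u v : 'rV[A]_n) := << u *m SS, v >> *: (H' - HH *m SS).
pose T5 (u v : 'rV[A]_n) := << v, HH >> *: (u *m (SS *m SS)).
pose T6 (u v : 'rV[A]_n) := << u *m (SS *m SS), v >> *: HH.
pose T7 (u v : 'rV[A]_n) := << v, HH *m SS >> *: (u *m SS).
have E0 a b : Hess (a *m L) (b *m L) =
    T1 a b + T2 a b + 2 *: T3 a b + T4 a b + T5 a b + T6 a b + -1 *: T7 a b.
  rewrite Hess_lift mul_dEnd_TT (ipC hT b) /T1 /T2 /T3 /T4 /T5 /T6 /T7.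
  have f1 : << a *m SS, b *m SS >> = - << a *m (SS *m SS), b >>.
    by rewrite mulmxA (SS_skew (a *m SS)) opprK.
  rewrite !codazzi_SS f1 (SS_skew b) (ipC hT b (a *m SS)) (ipC hT b) !mulmxDl.
  by rewrite mulNmx -!scalemxAl !mulmxA (ipC hT b); mxring.
rewrite (htr_eq (Psi := fun a b => T1 a b + T2 a b + 2 *: T3 a b + T4 a b +
  T5 a b + T6 a b + -1 *: T7 a b)) => [|a b]; last exact: E0.
rewrite !htrD !htrZ /T1 /T2 /T3 /T4 /T5 /T6 /T7 !htr_tr !htr_ip_l !htr_ip_r.
by rewrite tr_SS tr_TT !mulmxA; mxring.
Qed.

(** As tau = - H, the bitension is the trace of the curvature term [Ric] minus the trace of the
    Hessian of H. The curvature term has no vertical part, since [e0 *m J = 0]. *)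
Lemma bitensE : bitens E =
  - (((2 * n%:R - 1) * c + k + 2 * t) *: HH - HH *m SS *m SS + D e0 H').
Proof.
pose Ric X Y := Y *m J *m RN (X *m J) HH.
have -> : bitens E = \sum_i (Ric (row i E) (row i E) - Hess (row i E) (row i E)).
  apply: eq_bigr => i _; rewrite tensE /Hess !covNr RN_Nr mulmxN /Ric.
  by mxring.
rewrite sumrB (frame_trace _ EE) ?(frame_trace (Phi := Hess) _ EE); first last.
- split=> a X Y Z; first by rewrite /Ric mulmxDl -scalemxAl RN_linl mulmxDr -scalemxAr.
  by rewrite /Ric !mulmxDl -!scalemxAl.
- split=> a X Y Z; first last.
    rewrite /Hess (covDr d G) (covZr d G); move: (nb Z X) (nb Z Y) => U V.
    by rewrite !(covDl, covZl) covDr covZr; mxring.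
  rewrite /Hess (covDl d G) covZl; move: (nb X Z) (nb Y Z) => U V.
  by rewrite !(covDl, covZl); mxring.
rewrite htr_Hess Hess_e0.
pose T1 (u v : 'rV[A]_n) := << v, HH >> *: (u *m 1%:M).
pose T2 (u v : 'rV[A]_n) := << u *m 1%:M, v >> *: HH.
pose T3 (u v : 'rV[A]_n) := << v, HH *m SS >> *: (u *m SS).
pose T4 (u v : 'rV[A]_n) := << u *m SS, v >> *: (HH *m SS).
pose T5 (u v : 'rV[A]_n) := << u, HH *m SS >> *: (v *m SS).
have E0 a b : Ric (a *m L) (b *m L) =
    c *: T1 a b + (- c) *: T2 a b + T3 a b + (-1) *: T4 a b + 2 *: T5 a b.
  rewrite /Ric !liftJ.
  have -> : RN a HH = curv d K (a *m L) (HH *m L) by rewrite curvK !liftJ.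
  rewrite codazzi_hor.
  rewrite /T1 /T2 /T3 /T4 /T5 !mulmx1 (ipC hT HH) (ipC hT (HH *m SS)).
  by rewrite (SS_skew a HH); mxring.
rewrite (htr_eq (Psi := fun a b => c *: T1 a b + (- c) *: T2 a b + T3 a b +
  (-1) *: T4 a b + 2 *: T5 a b)) => [|a b]; last exact: E0.
rewrite !htrD !htrZ /T1 /T2 /T3 /T4 /T5 !htr_tr !htr_ip_l !htr_ip_r.
rewrite tr_SS mxtrace1 /Ric e0J !mul0mx !mulmx1.
by mxring.
Qed.

(** * Consequences of the biharmonic equation where H does not vanish *)

Section Biharmonic.
Variable lam : A.
Hypothesis dlam : forall X, along d X lam = 0.
Hypothesis biharm : bitens E - lam *: tens E = 0.
Hypothesis kreg : forall x, k * x = 0 -> x = 0.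

Lemma biharmE : HH *m SS *m SS - D e0 H' =
  ((2 * n%:R - 1) * c + k + 2 * t - lam) *: HH.
Proof.
have := biharm; rewrite bitensE tensE => /eqP.
rewrite -subr_eq0 => /eqP E0; apply/eqP; rewrite -subr_eq0 -E0; apply/eqP.
by mxring.
Qed.

Lemma scaleHH_eq0 x : x *: HH = 0 -> x = 0.
Proof. by move=> xH; apply: kreg; rewrite mulrC -ipZl xH ip0l. Qed.

Lemma cst_nat i X : along d X i%:R = 0.
Proof. by elim: i => [|i IH]; rewrite ?der0 // -addn1 natrD derD IH der1 addr0. Qed.

Lemma along_natM i X x : along d X (i%:R * x) = i%:R * along d X x.
Proof. by rewrite derM cst_nat mul0r add0r. Qed.

Lemma along_HH w : along d (w *m L) k = 2 * << w *m TT, HH >>.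
Proof. by rewrite (along_ip hK) cov_lift_HH (ipC hT HH); ring. Qed.

Section Nonintegrable.
Hypothesis H'0 : H' = 0.

Local Notation b := ((2 * n%:R - 1) * c + k + 2 * t - lam).

Lemma HH_SS_SS : HH *m SS *m SS = b *: HH.
Proof. by rewrite -biharmE H'0 cov0r subr0. Qed.

(** By [HH_SS_SS], b is the eigenvalue of S^2 on H. Its derivative along the lift X of H is computed
    from the eigenvector equation ([db]) and from the definition of b ([db2]); the comparison is
    [C1], and the derivative of [C1] gives b = 0. *)
Lemma nonintegrable : [/\ lam = 2 * (n%:R - 1) * c, c + k + 2 * t = 0 &
  HH *m SS *m SS = 0].
Proof.
pose X := HH *m L; pose S' := dEnd X SS.
have SHH : << HH *m SS, HH >> = 0.
  by apply: half; rewrite {2}SS_skew (ipC hT HH) subrr.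
have SHSH : << HH *m SS, HH *m SS >> = - (b * k).
  by rewrite SS_skew (ipC hT) HH_SS_SS ipZl.
have S'E u : u *m S' = k *: (u *m SS) - << HH *m SS, u >> *: HH
  + << u, HH >> *: (HH *m SS) by rewrite codazzi_SS.
have S'M : S' = k *: SS - h *m (HH *m SS)^T *m HH + h *m HH^T *m (HH *m SS).
  apply/eqP; rewrite -subr_eq0; apply/eqP; apply: delta_mulmx_eq0 => a.
  rewrite mulmxBr S'E !(mulmxDr, mulmxN) -scalemxAr !ip_outer.
  by rewrite (ipC hT _ (HH *m SS)); mxring.
have DH : D X HH = (c + k + b) *: HH.
  by rewrite cov_lift_HH mul_TT HH_SS_SS; mxring.
have dk : along d X k = 2 * (c + k + b) * k.
  by rewrite (along_ip hK) DH ipZl ipZr; ring.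
have dt : along d X t = 2 * k * (t + 2 * b).
  rewrite -dEnd_tr dEnd_mul raddfD /= -/S' (mxtrace_mulC SS) S'M.
  rewrite mulmxDl mulmxBl -scalemxAl -!(mulmxA (h *m _)) raddfD raddfB /=.
  by rewrite mxtraceZ !(tr_outer _ _ hT) SHSH HH_SS_SS ipZr; ring.
have db : along d X b = 4 * k * b.
  have : D X (HH *m SS *m SS) = D X (b *: HH) by rewrite HH_SS_SS.
  rewrite covZr !cov_mulmx -/S' DH -!scalemxAl mulmxDl -!scalemxAl HH_SS_SS.
  rewrite !S'E SHH SHSH !(mulmxDl, mulNmx) -!scalemxAl HH_SS_SS => E0.
  apply/eqP; rewrite -subr_eq0; apply/eqP/scaleHH_eq0.
  apply/eqP; rewrite scalerBl subr_eq0; apply/eqP.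
  apply: (addIr (b *: ((c + k + b) *: HH))); rewrite -E0; mxring.
have db2 : along d X b = 2 * (c + k + b) * k + 2 * (2 * k * (t + 2 * b)).
  rewrite derB 2!derD along_natM derM dk dt dc dlam derB along_natM cst_nat der1.
  by ring.
(* The difference of the two derivatives of b is 2 k times this expression. *)
have C1 : c + k + 3 * b + 2 * t = 0.
  apply: (natI (k := 1)); apply: kreg; move: db2; rewrite db => /eqP.
  rewrite eq_sym -subr_eq0 => /eqP <-; ring.
(* The derivative of [C1] minus 2 k times [C1] is 16 k b. *)
have b0 : b = 0.
  apply: (natI (k := 15)); apply: kreg.
  have := congr1 (along d X) C1.
  rewrite der0 3!derD 2!along_natM db dt dk dc => E0.
  transitivity (0 + 2 * (c + k + b) * k + 3 * (4 * k * b)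
    + 2 * (2 * k * (t + 2 * b)) - 2 * k * (c + k + 3 * b + 2 * t)); first by ring.
  by rewrite E0 C1 mulr0 subr0.
have C2 : c + k + 2 * t = 0 by rewrite -[RHS]C1 b0; ring.
split=> //; last by rewrite HH_SS_SS b0 scale0r.
apply/eqP; rewrite -subr_eq0 -oppr_eq0; apply/eqP.
transitivity (b - (c + k + 2 * t)); first by ring.
by rewrite b0 C2 subrr.
Qed.

End Nonintegrable.

(** Differentiate H S = 0 along [w *m L]: the derivative of H contributes c wS + w S^3, and the
    derivative of S, by [codazzi_SS], only |H|^2 wS. *)
Lemma SS_cubic : HH *m SS = 0 -> (c + k) *: SS + SS *m SS *m SS = 0.
Proof.
move=> HS; apply: delta_mulmx_eq0 => a; set w := delta_mx 0 a.
have := congr1 (D (w *m L)) HS; rewrite cov0r cov_mulmx cov_lift_HH mul_TT => E0.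
have wSH : << w *m SS, HH >> = 0 by rewrite SS_skew HS ip0r oppr0.
move: E0; rewrite codazzi_SS wSH HS !mulmxDl -!scalemxAl HS => E0.
by rewrite mulmxDr -scalemxAr !mulmxA -[RHS]E0; mxring.
Qed.

(** * The integrable case S = 0 *)

Section Integrable.
Hypothesis SS0 : SS = 0.
Hypothesis n2 : (1 < n)%N.

Local Notation nu := (lam - (2 * n%:R - 1) * c).
Local Notation mu := (nu - k).
Local Notation b := (<< HH, H' >>).
Local Notation q := (<< H', H' >>).
Local Notation s := (3 * mu + 2 * (c + k)).

Lemma int_TT w : w *m TT = c *: w + << w, HH >> *: HH.
Proof. by rewrite mul_TT SS0 !mulmx0 addr0. Qed.

Lemma int_H'' : D e0 H' = mu *: HH.
Proof.
have := biharmE; rewrite SS0 !mulmx0 sub0r raddf0 => /eqP.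
rewrite -subr_eq0 => /eqP E0; apply/eqP; rewrite -subr_eq0 -oppr_eq0 -E0.
by apply/eqP; mxring.
Qed.

Lemma RN0r u : RN u 0 = 0.
Proof.
by rewrite /RN big1 // => i _; rewrite big1 // => j _; rewrite mxE mulr0 scale0r.
Qed.

(** The curvature of the pulled back connection vanishes when one argument is vertical, so only the
    bracket enters. *)
Lemma cov_comm w (V : 'rV[A]_n) : D (w *m L) (D e0 V) =
  D e0 (D (w *m L) V) - D (D e0 w *m L) V + << w, HH >> *: D e0 V.
Proof.
have := curvE K dC (w *m L) e0 V; rewrite curvK e0J RN0r mulmx0.
have -> : br d (w *m L) e0 = - (D e0 w *m L) + << w, HH >> *: e0.
  by rewrite (br_nabla d Gsym) nabla_lift_e0 nabla_e0_lift mulmxDl; mxring.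
rewrite covDl covZl covNl => /eqP.
rewrite -subr_eq0 subr0 => /eqP E0; apply/eqP; rewrite -subr_eq0 -[X in _ == X]E0.
by apply/eqP; mxring.
Qed.

Lemma int_HH w : D (w *m L) HH = c *: w + << w, HH >> *: HH.
Proof. by rewrite cov_lift_HH int_TT. Qed.

Lemma int_H' w : D (w *m L) H' = << w, H' >> *: HH + (2 * << w, HH >>) *: H'.
Proof.
rewrite cov_comm !int_HH covDr !covZr !dc (along_ip hK).
by mxring.
Qed.

Lemma int_mu w : along d (w *m L) mu = - (2 * (c + k) * << w, HH >>).
Proof.
rewrite !derB dlam derM !dc along_HH int_TT ipDl !ipZl derB along_natM cst_nat.
by rewrite der1; ring.
Qed.

(* D_w of H'' = mu H, computed in two ways *)
Lemma int_main w : (mu * c) *: w =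
  (3 * << w, H' >>) *: H' + (s * << w, HH >>) *: HH.
Proof.
have := congr1 (D (w *m L)) int_H''; rewrite cov_comm !int_H'.
rewrite int_H'' covZr int_mu int_HH covDr !covZr derM !(along_ip hK) int_H''.
rewrite cst_nat ipZr => /eqP.
rewrite -subr_eq0 => /eqP E0; apply/eqP; rewrite -subr_eq0 -oppr_eq0 -E0.
by apply/eqP; mxring.
Qed.

(** The trace of [int_main], read as an equation between a scalar matrix and a sum of two rank one
    endomorphisms. *)
Lemma int_trace : n%:R * (mu * c) = 3 * q + s * k.
Proof.
have E0 : (mu * c)%:M = 3 *: (h *m H'^T *m H') + s *: (h *m HH^T *m HH).
  apply/eqP; rewrite -subr_eq0; apply/eqP; apply: delta_mulmx_eq0 => a.
  rewrite mulmxBr mul_mx_scalar int_main mulmxDr -!scalemxAr !ip_outer.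
  by mxring.
have := congr1 (fun M => \tr M) E0.
rewrite mxtrace_scalar raddfD /= !mxtraceZ !(tr_outer _ _ hT) => <-.
by rewrite mulr_natl.
Qed.

Lemma int_b w :
  along d (w *m L) b = (c + k) * << w, H' >> + 3 * b * << w, HH >>.
Proof.
by rewrite (along_ip hK) int_HH int_H' !(ipDl, ipDr, ipZl, ipZr); ring.
Qed.

Lemma int_q w :
  along d (w *m L) q = 2 * << w, H' >> * b + 4 * << w, HH >> * q.
Proof.
rewrite (along_ip hK) int_H' !(ipDl, ipDr, ipZl, ipZr) (ipC hT H' HH).
by ring.
Qed.

Lemma int_k w : along d (w *m L) k = 2 * (c + k) * << w, HH >>.
Proof. by rewrite along_HH int_TT ipDl !ipZl; ring. Qed.

Lemma int_b0 : along d e0 b = q + mu * k.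
Proof. by rewrite (along_ip hK) int_H'' ipZr. Qed.

Lemma int_mu0 : along d e0 mu = - (2 * b).
Proof.
rewrite !derB dlam derM !dc derB along_natM cst_nat der1 (along_ip hK).
by rewrite (ipC hT H'); ring.
Qed.

(** Pairing [int_main] at w = H' with H gives mu c b, and [int_trace] times b gives n mu c b; the
    right-hand sides agree, so (n - 1) mu c b = 0. *)
Lemma int_mcb : c * mu * b = 0.
Proof.
have E1 : mu * c * b = 3 * b * q + s * k * b.
  have := congr1 (fun x => << x, HH >>) (int_main H').
  by rewrite !(ipDl, ipZl) (ipC hT H' HH) => ->; ring.
(* As n >= 2, the factor n - 1 is the successor of n - 2, the form [natI] asks for. *)
have n1 : n%:R = n.-2.+1%:R + 1 :> A 
  by rewrite -mulrSr; congr (_ *+ _); move: n2; case: (n) => [|[|]].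
apply: (natI (k := n.-2)).
transitivity (n%:R * (mu * c) * b - mu * c * b); first by rewrite n1; ring.
by rewrite int_trace E1; ring.
Qed.

(** Now mu b = 0. Its derivatives along [e0] and along the lift of H', multiplied by mu to remove b,
    give [E6] and [E7]; these express mu^2 q through c and mu. Substituted into [E4], they leave 2
    c^2 mu^9 = 0. *)
Lemma int_mu_eq0 : (forall x, c * x = 0 -> x = 0) -> mu = 0.
Proof.
move=> creg.
have mb : mu * b = 0 by apply: creg; rewrite mulrA int_mcb.
have E4 : mu * c * q = 3 * q * q + s * b * b.
  have := congr1 (fun x => << x, H' >>) (int_main H').
  by rewrite !(ipDl, ipZl) (ipC hT H' HH) => ->; ring.
have E6 : mu * mu * (q + mu * k) = 0.
  have := congr1 (fun x => along d e0 x * mu) mb.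
  rewrite /= derM int_mu0 int_b0 der0 mul0r => E0.
  transitivity ((- (2 * b) * b + mu * (q + mu * k)) * mu + 2 * b * (mu * b)).
    by ring.
  by rewrite E0 mb mulr0 addr0.
have E7 : mu * mu * (c + k) * q = 0.
  have := congr1 (fun x => along d (H' *m L) x * mu) mb.
  rewrite /= derM int_mu int_b der0 mul0r (ipC hT H' HH) => E0.
  rewrite -[RHS]E0; apply/eqP; rewrite -subr_eq0; apply/eqP.
  transitivity ((2 * (c + k) * b - 3 * mu * b) * (mu * b)); first by ring.
  by rewrite mb mulr0.
have E8 : mu * mu * mu * (c + k) = 0.
  apply: kreg.
  transitivity ((c + k) * (mu * mu * (q + mu * k)) - mu * mu * (c + k) * q).
    by ring.
  by rewrite E6 E7 mulr0 subr0.
have E9 : mu * mu * q = c * (mu * mu * mu).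
  apply/eqP; rewrite -subr_eq0; apply/eqP.
  transitivity (mu * mu * (q + mu * k) - mu * mu * mu * (c + k)); first by ring.
  by rewrite E6 E8 subrr.
(* Using [reduced] twice replaces mu by mu^9; the factors c, c and 2 are then supplied. *)
apply: reduced; apply: reduced; apply: (creg); apply: (creg).
apply: (natI (k := 1)).
transitivity (mu * mu * mu * (3 * (mu * mu * q) * (mu * mu * q)
  - c * (mu * mu * mu) * (mu * mu * q))); first by rewrite !E9; ring.
transitivity (mu ^+ 7 * (3 * q * q - mu * c * q)); first by ring.
rewrite E4; transitivity (- (s * mu ^+ 6 * b) * (mu * b)); first by ring.
by rewrite mb mulr0.
Qed.

Lemma integrable : (forall x, c * x = 0 -> x = 0) ->
  lam = 2 * (n%:R - 1) * c /\ c + k = 0.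
Proof.
move=> creg; have mu0 := int_mu_eq0 creg.
have ck : c + k = 0.
  apply: kreg; apply: (natI (k := 1)).
  have := congr1 (along d (HH *m L)) mu0; rewrite int_mu der0 => /eqP.
  by rewrite oppr_eq0 => /eqP <-; ring.
split=> //; apply/eqP; rewrite -subr_eq0; apply/eqP.
transitivity (mu + (c + k)); first by ring.
by rewrite mu0 ck addr0.
Qed.

(** The trace [E1] and the value [E2] on H, together with the derivative of [E1] along the lift of
    H, give k = - 2 s, that is, k = 6 lambda. So k is constant, although its derivative along that
    lift is 2 k^2. *)
Lemma integrable_flat : c = 0 -> False.
Proof.
move=> c0.
have E1 : 3 * q + s * k = 0 by rewrite -int_trace c0 mulr0 mulr0.
have E2 : 3 * b * b + s * k * k = 0.
  have := congr1 (fun x => << x, HH >>) (int_main HH).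
  rewrite c0 mulr0 scale0r ip0l ipDl !ipZl (ipC hT H' HH) => E0.
  by rewrite [RHS]E0; ring.
have dk w : along d (w *m L) k = 2 * k * << w, HH >>.
  by rewrite int_k c0 add0r.
have E3 : k = - (2 * s).
  apply/eqP; rewrite -subr_eq0 opprK; apply/eqP; apply: kreg; apply: kreg.
  apply: (natI (k := 1)).
  have := congr1 (along d (HH *m L)) E1; rewrite der0 derD along_natM int_q derM.
  rewrite derD !along_natM int_mu dk derD dk !dc c0 => E0.
  rewrite -[RHS]oppr0 -[in RHS]E0; apply/eqP; rewrite -subr_eq0; apply/eqP.
  transitivity (4 * k * (3 * q + s * k) + 2 * (3 * b * b + s * k * k)).
    by rewrite c0; ring.
  by rewrite E1 E2 !mulr0 addr0.
have E4 : k - 6 * lam = 0.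
  apply/eqP; rewrite -oppr_eq0; apply/eqP.
  transitivity (k - - (2 * s)); first by rewrite c0; ring.
  by rewrite -E3 subrr.
(* In this form, regularity of k cancels twice and leaves 1 = 0. *)
have kk : k * (k * 1) = 0.
  apply: (natI (k := 1)).
  have := congr1 (along d (HH *m L)) E4.
  by rewrite der0 derB along_natM dlam dk mulr0 subr0 => <-; ring.
by have /eqP := kreg (kreg kk); rewrite oner_eq0.
Qed.

End Integrable.
End Biharmonic.

(** The interface between the algebra and the analysis. The curvature formula describes the zeros of
    S by the target alone. *)
Lemma submersion_summary : exists (S : 'M[A]_n) (H H' : 'rV[A]_n),
  [/\ tens E = - H,
      forall w u, << u *m RN w u, w >> =
        c * (<< u, u >> * << w, w >> - << w, u >> ^+ 2)
        + 3 * << w *m S, u >> ^+ 2,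
      forall u v, << u *m S, v >> = - << u, v *m S >>,
      (<< H', H' >> ^+ 2) *: S = 0 &
      H *m S = 0 -> (c + << H, H >>) *: S + S *m S *m S = 0] /\
  forall lam, (forall X, along d X lam = 0) ->
    bitens E - lam *: tens E = 0 ->
    (forall x, << H, H >> * x = 0 -> x = 0) ->
  [/\ H' = 0 -> [/\ lam = 2 * (n%:R - 1) * c,
        c + << H, H >> + 2 * \tr (S *m S) = 0 & H *m S *m S = 0],
      S = 0 -> (1 < n)%N -> (forall x, c * x = 0 -> x = 0) ->
        lam = 2 * (n%:R - 1) * c /\ c + << H, H >> = 0 &
      S = 0 -> c = 0 -> False].
Proof.
exists SS, HH, H'; split.
  split; [exact: tensE| |exact: SS_skew|exact: HH'_SS|exact: SS_cubic].
  move=> w u; have := congr1 (fun x => << x, w >>) (codazzi_hor w u u).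
  have uu : << u *m SS, u >> = 0.
    by apply: half; rewrite {2}SS_skew (ipC hT u) subrr.
  have -> : << w *m SS, u >> ^+ 2 = - (<< w *m SS, u >> * << u *m SS, w >>).
    by rewrite (SS_skew u w) (ipC hT u (w *m SS)); ring.
  rewrite curvK !liftJ => ->.
  by rewrite uu !(ipDl, ipNl, ipZl) (ipC hT u w); ring.
move=> lam dlam bi kreg; split.
- exact: (nonintegrable dlam bi kreg).
- exact: (integrable dlam bi kreg).
- exact: (integrable_flat dlam bi kreg).
Qed.

End Submersion.

(** * Smooth functions on an open set *)

Local Open Scope classical_set_scope.
Local Open Scope ring_scope.

Lemma near_differentiable (R : numFieldType) (V W : normedModType R)
    (f g : V -> W) (a : V) :
  (\near a, f a = g a) -> differentiable f a -> differentiable g a.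
Proof.
move=> fg /diff_locallyP [dfc dfe].
have ga : f a = g a := nbhs_singleton fg.
have fg0 : \forall h \near (0 : V), f (h + a) = g (h + a).
  by move: fg; rewrite (near_shift 0 a) /=; apply: filterS => h; rewrite subr0.
have dg : g \o shift a = cst (g a) + 'd f a +o_ (0 : V) id.
  apply/eqaddoP => _/posnumP[e].
  move: dfe => /eqaddoP /(_ e%:num) /(_ [gt0 of e%:num]) /=.
  apply: filterS2 fg0 => h /= fgh.
  by rewrite !fctE /= -ga -fgh.
have df : 'd g a = 'd f a :> (V -> W) by apply: diff_unique.
by apply/diff_locallyP; rewrite df.
Qed.

(** * Functions of class C^k *)

Section ContinuouslyDifferentiable.
Context {R : realType} {m : nat}.
Implicit Types U : set 'rV[R]_m.

Lemma open_near_eq {W : Type} U (f g : 'rV[R]_m -> W) p : open U -> U p ->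
  (forall q, U q -> f q = g q) -> \near p, f p = g p.
Proof. by move=> Uo Up fg; apply: filterS fg _; exact: open_nbhs_nbhs. Qed.

Lemma C_on_sub {W : normedModType R} k U U' (f : 'rV[R]_m -> W) :
  U' `<=` U -> C_on k U f -> C_on k U' f.
Proof.
move=> sub; elim: k f => [|k IH] f /=; first by move=> fc p /sub; exact: fc.
by move=> [fd fD]; split=> [p /sub|v]; [exact: fd|exact: IH].
Qed.

Lemma C_on_ext {W : normedModType R} k U (f g : 'rV[R]_m -> W) : open U ->
  (forall p, U p -> f p = g p) -> C_on k U f -> C_on k U g.
Proof.
move=> Uo; elim: k f g => [|k IH] f g fg /=.
  move=> fc p Up; have := fc p Up; rewrite /prop_for /continuous_at -fg //.
  move=> fp; apply: cvg_trans fp; apply: near_eq_cvg.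
    exact: (nbhs_filter p).
  exact: open_near_eq Uo Up fg.
move=> [fd fD]; split=> [p Up|v].
  by apply: near_differentiable (fd p Up); exact: open_near_eq Uo Up fg.
apply: IH (fD v) => p Up; apply: near_eq_derive.
exact: open_near_eq Uo Up fg.
Qed.

(** The inductive step when derivatives are given by a formula valid on U only. *)
Lemma C_onS {W : normedModType R} k U (f : 'rV[R]_m -> W) : open U ->
  (forall p, U p -> differentiable f p) ->
  (forall v, exists2 g, C_on k U g & forall p, U p -> 'D_v f p = g p) ->
  C_on k.+1 U f.
Proof.
move=> Uo fd fD; split=> // v; have [g gC Dg] := fD v.
by apply: C_on_ext gC => // p Up; rewrite Dg.
Qed.

Lemma C_onW {W : normedModType R} k U (f : 'rV[R]_m -> W) :
  C_on k.+1 U f -> C_on k U f.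
Proof.
elim: k f => [|k IH] f [fd fD]; first by move=> p Up; exact/differentiable_continuous/fd.
by split=> // v; apply: IH.
Qed.

Lemma C_on_cst {W : normedModType R} k U (a : W) : C_on k U (fun=> a).
Proof.
elim: k a => [|k IH] a /=; first by move=> p _; exact: cst_continuous.
split=> [p _|v]; first exact: differentiable_cst.
have -> : 'D_v (fun=> a) = fun=> (0 : W).
  by rewrite funeqE => p; rewrite derive_cst.
exact: IH.
Qed.

Lemma C_onD {W : normedModType R} k U (f g : 'rV[R]_m -> W) : open U ->
  C_on k U f -> C_on k U g -> C_on k U (fun p => f p + g p).
Proof.
move=> Uo; elim: k f g => [|k IH] f g /=.
  by move=> fc gc p Up; apply: continuousD; [exact: fc|exact: gc].
move=> [fd fD] [gd gD]; apply: C_onS => // [p Up|v].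
  by apply: differentiableD; [exact: fd|exact: gd].
exists (fun p => 'D_v f p + 'D_v g p) => [|p Up]; first exact: IH.
by rewrite deriveD //; apply: diff_derivable; [exact: fd|exact: gd].
Qed.

Lemma C_onM k U (f g : 'rV[R]_m -> R) : open U ->
  C_on k U f -> C_on k U g -> C_on k U (fun p => f p * g p).
Proof.
move=> Uo; elim: k f g => [|k IH] f g.
  by move=> fc gc p Up; apply: continuousM; [exact: fc|exact: gc].
move=> fC gC; have [fd fD] := fC; have [gd gD] := gC.
apply: C_onS => // [p Up|v].
  by apply: differentiableM; [exact: fd|exact: gd].
exists (fun p => f p * 'D_v g p + g p * 'D_v f p) => [|p Up].
  apply: C_onD => //; apply: IH.
  - exact: C_onW fC.
  - exact: gD.
  - exact: C_onW gC.
  - exact: fD.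
by rewrite deriveM //; apply: diff_derivable; [exact: fd|exact: gd].
Qed.

Lemma C_onN k U (f : 'rV[R]_m -> R) : open U ->
  C_on k U f -> C_on k U (fun p => - f p).
Proof.
move=> Uo fC; have cC : C_on k U (fun _ : 'rV[R]_m => -1 : R) by exact: C_on_cst.
by apply: (C_on_ext Uo _ (C_onM Uo cC fC)) => p _; rewrite mulN1r.
Qed.

Lemma C_onV k U (f : 'rV[R]_m -> R) : open U ->
  (forall p, U p -> f p != 0) -> C_on k U f -> C_on k U (fun p => (f p)^-1).
Proof.
move=> Uo f0; elim: k => [|k IH] fC.
  by move=> p Up; apply: continuousV; [exact: f0|exact: fC].
have [fd fD] := fC; apply: C_onS => // [p Up|v].
  by apply: differentiableV; [exact: fd|exact: f0].
exists (fun p => - ((f p)^-1 * (f p)^-1 * 'D_v f p)) => [|p Up].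
  apply: C_onN => //; apply: C_onM => //; last exact: fD.
  by apply: C_onM => //; apply: IH; exact: C_onW.
rewrite deriveV; [|exact: f0|by apply: diff_derivable; exact: fd].
by rewrite scaleNr -exprVn expr2.
Qed.

Lemma C_on_sqrt k U (f : 'rV[R]_m -> R) : open U ->
  (forall p, U p -> 0 < f p) -> C_on k U f -> C_on k U (fun p => Num.sqrt (f p)).
Proof.
move=> Uo f0; elim: k => [|k IH] fC.
  by move=> p Up; apply: continuous_comp; [exact: fC|exact: sqrt_continuous].
have [fd fD] := fC.
have sd p : U p -> differentiable (@Num.sqrt R : R -> R) (f p).
  by move=> Up; apply/derivable1_diffP; have [] := is_derive1_sqrt (f0 p Up).
apply: C_onS => // [p Up|v].
  by apply: differentiable_comp; [exact: fd|exact: sd].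
exists (fun p => (2 * Num.sqrt (f p))^-1 * 'D_v f p) => [|p Up].
  apply: C_onM => //; last exact: fD.
  apply: C_onV => // [p Up|].
    by rewrite mulf_neq0 // gt_eqF // sqrtr_gt0 f0.
  by apply: C_onM => //; [exact: C_on_cst|apply: IH; exact: C_onW].
rewrite deriveE; last by apply: differentiable_comp; [exact: fd|exact: sd].
rewrite (diff_comp (fd p Up) (sd p Up)) /= -(deriveE v (fd p Up)).
rewrite (diff1E (sd p Up)) (derive1E (Num.sqrt : R -> R)) derive_sqrt ?f0 //.
exact: mulrC.
Qed.

Lemma C_on_sum k U I (r : seq I) (P : pred I) (f : I -> 'rV[R]_m -> R) : open U ->
  (forall i, P i -> C_on k U (f i)) ->
  C_on k U (fun p => \sum_(i <- r | P i) f i p).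
Proof.
move=> Uo fC; elim: r => [|i r IH].
  by apply: C_on_ext (C_on_cst k U 0) => // p _; rewrite big_nil.
case Pi : (P i).
  by apply: C_on_ext (C_onD Uo (fC _ Pi) IH) => // p _; rewrite big_cons Pi.
by apply: C_on_ext IH => // p _; rewrite big_cons Pi.
Qed.

(** * Symmetry of second derivatives *)

Lemma is_derive_line {V : normedModType R} (f : V -> R) (x u : V) (s : R) :
  derivable f (x + s *: u) u ->
  is_derive s 1 (fun t => f (x + t *: u)) ('D_u f (x + s *: u)).
Proof.
move=> fd.
have E : (fun h => h^-1 *: (((fun t => f (x + t *: u)) \o shift s) (h *: 1)
            - f (x + s *: u))) =
         (fun h : R => h^-1 *: ((f \o shift (x + s *: u)) (h *: u)
            - f (x + s *: u))).
  apply/funext => h /=; congr (_ *: (f _ - _)).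
  by rewrite scaler1 scalerDl addrCA addrA.
split; first by rewrite /derivable E.
by rewrite /derive E.
Qed.

(** The mean value theorem twice: in the direction u for the difference [phi] of f along two
    parallel segments, then in the direction v for the derivative found. *)
Lemma mixed_difference U (f : 'rV[R]_m -> R) p u v a : C_on 2%N U f -> 0 < a ->
  (forall s t, 0 <= s <= a -> 0 <= t <= a -> U (p + s *: u + t *: v)) ->
  exists s t, [/\ 0 <= s <= a, 0 <= t <= a &
    f (p + a *: u + a *: v) - f (p + a *: u) - f (p + a *: v) + f p =
    a * a * 'D_v (fun q => 'D_u f q) (p + s *: u + t *: v)].
Proof.
move=> [fd fD] a0 Ua.
have Df q w : U q -> derivable f q w by move=> Uq; apply/diff_derivable/fd.
have DDf q w z : U q -> derivable (fun x => 'D_w f x) q z.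
  by move=> Uq; apply/diff_derivable; have [+ _] := fD w; apply.
pose phi s := f (p + a *: v + s *: u) - f (p + s *: u).
have aa : 0 <= a <= a by apply/andP; split=> //; exact: ltW.
have oo : 0 <= (0 : R) <= a by apply/andP; split=> //; exact: ltW.
have Ua1 s : 0 <= s <= a -> U (p + a *: v + s *: u).
  by move=> sa; rewrite addrAC; exact: Ua.
have Ua0 s : 0 <= s <= a -> U (p + s *: u).
  by move=> sa; have := Ua s 0 sa oo; rewrite scale0r addr0.
have dphi s : 0 <= s <= a ->
    is_derive s 1 phi ('D_u f (p + a *: v + s *: u) - 'D_u f (p + s *: u)).
  by move=> sa; apply: is_deriveB; apply: is_derive_line; apply: Df; auto.
have [s sa phis] : exists2 s, 0 <= s <= a & phi a - phi 0 =
    ('D_u f (p + a *: v + s *: u) - 'D_u f (p + s *: u)) * a.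
  have [s||s sa phis] := @MVT _ phi
      (fun s => 'D_u f (p + a *: v + s *: u) - 'D_u f (p + s *: u)) 0 a a0.
  - by rewrite in_itv /= => /andP[s0 sa]; apply: dphi; rewrite !ltW.
  - apply: derivable_within_continuous => s; rewrite in_itv /= => sa.
    by have [] := dphi s sa.
  - exists s; last by rewrite phis subr0.
    by move: sa; rewrite in_itv /= => /andP[s0 sa]; rewrite !ltW.
pose psi t := 'D_u f (p + s *: u + t *: v).
have dpsi t : 0 <= t <= a ->
    is_derive t 1 psi ('D_v (fun q => 'D_u f q) (p + s *: u + t *: v)).
  by move=> ta; apply: is_derive_line; apply: DDf; exact: Ua.
have [t ta psit] : exists2 t, 0 <= t <= a & psi a - psi 0 =
    'D_v (fun q => 'D_u f q) (p + s *: u + t *: v) * a.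
  have [t||t ta psit] := @MVT _ psi
      (fun t => 'D_v (fun q => 'D_u f q) (p + s *: u + t *: v)) 0 a a0.
  - by rewrite in_itv /= => /andP[t0 ta]; apply: dpsi; rewrite !ltW.
  - apply: derivable_within_continuous => t; rewrite in_itv /= => ta.
    by have [] := dpsi t ta.
  - exists t; last by rewrite psit subr0.
    by move: ta; rewrite in_itv /= => /andP[t0 ta]; rewrite !ltW.
exists s, t; split=> //.
move: psit phis; rewrite /phi /psi !scale0r !addr0 (addrAC p (s *: u)) => ->.
rewrite (addrAC p (a *: v) (a *: u)) => ph.
transitivity (f (p + a *: u + a *: v) - f (p + a *: u) - (f (p + a *: v) - f p)).
  by ring.
by rewrite ph; ring.
Qed.

(* Equality of mixed partial derivatives: both are limits of the same second
   difference quotient. *)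
Lemma derive_comm U (f : 'rV[R]_m -> R) p u v : open U -> C_on 2%N U f -> U p ->
  'D_u (fun q => 'D_v f q) p = 'D_v (fun q => 'D_u f q) p.
Proof.
move=> Uo fC Up; apply/eqP; rewrite -subr_eq0 -normr_le0; apply/ler_addgt0Pr => e e0.
rewrite add0r.
have cD w z : {for p, continuous (fun q => 'D_w (fun x => 'D_z f x) q)}.
  have [_ /(_ z) [_ /(_ w)]] := fC; exact.
have e2 : 0 < e / 2 by rewrite divr_gt0.
have : \forall q \near p, U q /\
    `|'D_u (fun q => 'D_v f q) p - 'D_u (fun q => 'D_v f q) q| <= e / 2 /\
    `|'D_v (fun q => 'D_u f q) p - 'D_v (fun q => 'D_u f q) q| <= e / 2.
  apply: filterI; first exact: open_nbhs_nbhs.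
  apply: filterI.
    by have /cvgrPdist_le := cD u v; apply.
  by have /cvgrPdist_le := cD v u; apply.
move=> /nbhs_normP [r /= r0 Br].
(* The parallelogram of side parameter a lies within r / 2 of p; the summand 1 keeps the denominator
   positive when u = v = 0. *)
pose a := r / 2 / (`|u| + `|v| + 1).
have n0 : 0 < `|u| + `|v| + 1 by rewrite ltr_wpDl // addr_ge0.
have a0 : 0 < a by rewrite !divr_gt0.
have near s t : 0 <= s <= a -> 0 <= t <= a ->
    `|p - (p + s *: u + t *: v)| < r.
  move=> /andP[s0 sa] /andP[t0 ta].
  rewrite -addrA opprD addNKr normrN.
  apply: (@le_lt_trans _ _ (a * (`|u| + `|v| + 1))).
    apply: le_trans (ler_normD _ _) _; rewrite !normrZ !ger0_norm //.
    by rewrite !mulrDr mulr1 -[leLHS]addr0 !lerD // ?ler_wpM2r // ltW.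
  by rewrite /a divfK ?gt_eqF // ltr_pdivrMr // ltr_pMr // ltr1n.
have Ua w z : (forall s t, 0 <= s <= a -> 0 <= t <= a -> `|p - (p + s *: w + t *: z)| < r) ->
    forall s t, 0 <= s <= a -> 0 <= t <= a -> U (p + s *: w + t *: z).
  by move=> H s t sa ta; have [] := Br _ (H s t sa ta).
have near' s t : 0 <= s <= a -> 0 <= t <= a -> `|p - (p + s *: v + t *: u)| < r.
  by move=> sa ta; rewrite addrAC; exact: near.
have [s [t [sa ta E1]]] := mixed_difference fC a0 (Ua _ _ near).
have [s' [t' [sa' ta' E2]]] := mixed_difference fC a0 (Ua _ _ near').
have E : 'D_v (fun q => 'D_u f q) (p + s *: u + t *: v) =
         'D_u (fun q => 'D_v f q) (p + s' *: v + t' *: u).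
  have aa : a * a != 0 by rewrite mulf_neq0 // gt_eqF.
  apply: (mulfI aa); apply: (etrans (esym E1) (etrans _ E2)).
  by rewrite (addrAC p (a *: v)); congr (_ + _); exact: addrAC.
have [_ [_ N1]] := Br _ (near s t sa ta).
have [_ [N2 _]] := Br _ (near' s' t' sa' ta').
rewrite -(subrKA ('D_u (fun q => 'D_v f q) (p + s' *: v + t' *: u))) -{2}E.
apply: le_trans (ler_normD _ _) _; rewrite [leRHS]splitr; apply: lerD.
  exact: N2.
by rewrite distrC; exact: N1.
Qed.

(** * Components and the chain rule *)

Lemma derive_coord {n n'} (F : 'rV[R]_m -> 'M[R]_(n, n')) p v i j :
  derivable F p v -> 'D_v (fun q => F q i j) p = 'D_v F p i j.
Proof. by move=> Fd; rewrite (derive_mx Fd) mxE. Qed.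

Lemma C_on_coord {n n'} k U (F : 'rV[R]_m -> 'M[R]_(n, n')) i j : open U ->
  C_on k U F -> C_on k U (fun p => F p i j).
Proof.
move=> Uo; elim: k F => [|k IH] F.
  move=> FC p Up.
  have Cp := differentiable_continuous (differentiable_coord (F p) i j).
  exact: (continuous_comp (FC p Up) Cp).
move=> [Fd FD]; apply: C_onS => // [p Up|v].
  exact: (differentiable_comp (Fd p Up) (differentiable_coord (F p) i j)).
exists (fun p => 'D_v F p i j) => [|p Up]; first by apply: IH; exact: FD.
by rewrite derive_coord //; apply: diff_derivable; exact: Fd.
Qed.

Lemma derive_row {n} {W : normedModType R} (f : 'rV[R]_n -> W) q w :
  differentiable f q -> 'D_w f q = \sum_c w 0 c *: 'D_(delta_mx 0 c) f q.
Proof.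
move=> fd; rewrite deriveE // {1}[w]row_sum_delta raddf_sum /=.
by apply: eq_bigr => c _; rewrite linearZ deriveE.
Qed.

Lemma derive_comp {n} {W : normedModType R} (F : 'rV[R]_m -> 'rV[R]_n)
    (f : 'rV[R]_n -> W) p v : differentiable F p -> differentiable f (F p) ->
  'D_v (fun q => f (F q)) p = \sum_c 'D_v F p 0 c *: 'D_(delta_mx 0 c) f (F p).
Proof.
move=> Fd fd; rewrite -derive_row // deriveE; last exact: differentiable_comp.
by rewrite (diff_comp Fd fd) /= -(deriveE v Fd) -(deriveE _ fd).
Qed.

Lemma C_on_comp {n} k U (V : set 'rV[R]_n) (F : 'rV[R]_m -> 'rV[R]_n)
    (f : 'rV[R]_n -> R) : open U -> (forall p, U p -> V (F p)) ->
  C_on k U F -> C_on k V f -> C_on k U (fun p => f (F p)).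
Proof.
move=> Uo UV; elim: k F f UV => [|k IH] F f UV.
  by move=> FC fC p Up; apply: continuous_comp; [exact: FC|apply: fC; exact: UV].
move=> FC [fd fD]; have [Fd FD] := FC.
apply: C_onS => // [p Up|v].
  exact: (differentiable_comp (Fd p Up) (fd _ (UV p Up))).
exists (fun p => \sum_c 'D_v F p 0 c *: 'D_(delta_mx 0 c) f (F p)) => [|p Up].
  apply: C_on_sum => // c _; apply: C_onM => //.
    by apply: C_on_coord => //; exact: FD.
  by apply: (IH F ('D_(delta_mx 0 c) f)) => //; [exact: C_onW FC|exact: fD].
exact: (derive_comp v (Fd p Up) (fd _ (UV p Up))).
Qed.

End ContinuouslyDifferentiable.

Section Smooth.
Context {R : realType} {m : nat}.
Implicit Types (U : set 'rV[R]_m) (f g : 'rV[R]_m -> R).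

Lemma smooth_sub {W : normedModType R} U U' (f : 'rV[R]_m -> W) :
  U' `<=` U -> smooth_on U f -> smooth_on U' f.
Proof. by move=> sub fC k; apply: C_on_sub (fC k). Qed.

Lemma smooth_ext U f g : open U -> (forall p, U p -> f p = g p) ->
  smooth_on U f -> smooth_on U g.
Proof. by move=> Uo fg fC k; apply: C_on_ext (fC k). Qed.

Lemma smooth_differentiable {W : normedModType R} U (f : 'rV[R]_m -> W) p :
  smooth_on U f -> U p -> differentiable f p.
Proof. by move=> /(_ 1%N) [fd _] Up; exact: fd. Qed.

Lemma smooth_derivable {W : normedModType R} U (f : 'rV[R]_m -> W) p v :
  smooth_on U f -> U p -> derivable f p v.
Proof. by move=> fC Up; apply/diff_derivable/(smooth_differentiable fC). Qed.

Lemma smooth_derive {W : normedModType R} U (f : 'rV[R]_m -> W) v :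
  smooth_on U f -> smooth_on U (fun p => 'D_v f p).
Proof. by move=> fC k; have [_ fD] := fC k.+1; exact: fD. Qed.

End Smooth.

(* Smooth functions on a nonempty open set U, extended by 0 outside U so that
   equality on U is Leibniz equality. *)
Record opens (R : realType) (m : nat) := Opens {
  carrier :> set 'rV[R]_m;
  open_carrier : open carrier;
  base_point : 'rV[R]_m;
  carrier_base_point : carrier base_point }.

Section SmoothFunctions.
Context {R : realType} {m : nat} (U : opens R m).

Record sfun := SFun {
  sval_fun : 'rV[R]_m -> R;
  sfun_smooth : smooth_on U sval_fun;
  sfun_out : forall p, ~ carrier U p -> sval_fun p = 0 }.

Definition ev (p : 'rV[R]_m) (f : sfun) : R := sval_fun f p.

Lemma sfunP (f g : sfun) : (forall p, carrier U p -> ev p f = ev p g) -> f = g.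
Proof.
case: f g => [f fs fo] [g gs go] fg; have E : f = g.
  apply/funext => p; have [Up|nUp] := pselect (carrier U p); first exact: fg.
  by rewrite fo // go.
by subst g; congr SFun; exact: Prop_irrelevance.
Qed.

Definition extend0 (f : 'rV[R]_m -> R) p := if pselect (carrier U p) then f p else 0.

Lemma extend0E f p : carrier U p -> extend0 f p = f p.
Proof. by move=> Up; rewrite /extend0; case: pselect. Qed.

Lemma extend0_smooth f : smooth_on U f -> smooth_on U (extend0 f).
Proof.
by apply: smooth_ext => [|p Up]; [exact: open_carrier|rewrite extend0E].
Qed.

Lemma extend0_out f p : ~ carrier U p -> extend0 f p = 0.
Proof. by rewrite /extend0; case: pselect. Qed.

Definition mksfun f (fs : smooth_on U f) : sfun :=
  SFun (extend0_smooth fs) (@extend0_out f).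

Lemma ev_mk p f (fs : smooth_on U f) : carrier U p -> ev p (mksfun fs) = f p.
Proof. exact: extend0E. Qed.

HB.instance Definition _ := gen_eqMixin sfun.
HB.instance Definition _ := gen_choiceMixin sfun.

Let Uo : open (carrier U) := @open_carrier _ _ U.

Definition scst (a : R) : sfun := mksfun (fun k => C_on_cst k (carrier U) a).
Definition sadd f g := mksfun
  (fun k => C_onD Uo (sfun_smooth f k) (sfun_smooth g k)).
Definition sopp f := mksfun (fun k => C_onN Uo (sfun_smooth f k)).
Definition smul f g := mksfun
  (fun k => C_onM Uo (sfun_smooth f k) (sfun_smooth g k)).

Local Ltac sfun_ring := repeat intro; apply: sfunP => ? ?;
  match goal with H : carrier U _ |- _ =>
    rewrite /ev /= ?(extend0E _ H); try ring end.

Fact saddA : associative sadd. Proof. by sfun_ring. Qed.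
Fact saddC : commutative sadd. Proof. by sfun_ring. Qed.
Fact sadd0 : left_id (scst 0) sadd. Proof. by sfun_ring. Qed.
Fact saddN : left_inverse (scst 0) sopp sadd. Proof. by sfun_ring. Qed.
HB.instance Definition _ := GRing.isZmodule.Build sfun saddA saddC sadd0 saddN.

Fact smulA : associative smul. Proof. by sfun_ring. Qed.
Fact smulC : commutative smul. Proof. by sfun_ring. Qed.
Fact smul1 : left_id (scst 1) smul. Proof. by sfun_ring. Qed.
Fact smulD : left_distributive smul +%R. Proof. by sfun_ring. Qed.
Fact sone_neq0 : scst 1 != 0 :> sfun.
Proof.
apply/eqP => /(congr1 (ev (base_point U))).
have Up := @carrier_base_point _ _ U.
by rewrite /ev /= !extend0E // => /eqP; rewrite oner_eq0.
Qed.
HB.instance Definition _ := GRing.Zmodule_isComNzRing.Build sfun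
  smulA smulC smul1 smulD sone_neq0.

(** Evaluation is a ring morphism only at points of U: elsewhere the unit, extended by 0, evaluates
    to 0. *)
Definition pt := {p : 'rV[R]_m | carrier U p}.
Definition evp (p : pt) (f : sfun) : R := ev (sval p) f.

Fact evp_zmod p : zmod_morphism (evp p).
Proof. by case: p => p Up f g; rewrite /evp /ev /= !extend0E. Qed.
Fact evp_monoid p : monoid_morphism (evp p).
Proof. by case: p => p Up; split=> [|f g]; rewrite /evp /ev /= extend0E. Qed.
HB.instance Definition _ p := GRing.isZmodMorphism.Build sfun R (evp p) (evp_zmod p).
HB.instance Definition _ p := GRing.isMonoidMorphism.Build sfun R (evp p) (evp_monoid p).

Lemma evpD p f g : evp p (f + g) = evp p f + evp p g.
Proof. exact: rmorphD. Qed.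
Lemma evpM p f g : evp p (f * g) = evp p f * evp p g.
Proof. exact: rmorphM. Qed.

Lemma evpB p f g : evp p (f - g) = evp p f - evp p g.
Proof. exact: rmorphB. Qed.
Lemma evp_sum p I (r : seq I) (P : pred I) (F : I -> sfun) :
  evp p (\sum_(i <- r | P i) F i) = \sum_(i <- r | P i) evp p (F i).
Proof. exact: rmorph_sum. Qed.

Lemma evpP (f g : sfun) : (forall p : pt, evp p f = evp p g) -> f = g.
Proof. by move=> fg; apply: sfunP => p Up; exact: (fg (exist _ p Up)). Qed.

Lemma evp_scst p a : evp p (scst a) = a.
Proof. by case: p => p Up; rewrite /evp ev_mk. Qed.

Lemma evp_mk (p : pt) f (fs : smooth_on U f) : evp p (mksfun fs) = f (sval p).
Proof. by case: p => p Up; rewrite /evp ev_mk. Qed.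

Lemma mx_evpP n n' (M M' : 'M[sfun]_(n, n')) :
  (forall p, map_mx (evp p) M = map_mx (evp p) M') -> M = M'.
Proof.
move=> E; apply/matrixP=> i j; apply: evpP => p.
by have /matrixP /(_ i j) := E p; rewrite !mxE.
Qed.

Lemma sfun_reduced (f : sfun) : f * f * f = 0 -> f = 0.
Proof.
move=> f0; apply: evpP => p; rewrite rmorph0; have := congr1 (evp p) f0.
by rewrite !rmorphM rmorph0 => /eqP; rewrite !mulf_eq0 -!orbA !orbb => /eqP.
Qed.

Lemma sfun_natI k (f : sfun) : k.+1%:R * f = 0 -> f = 0.
Proof.
move=> f0; apply: evpP => p; rewrite rmorph0; have := congr1 (evp p) f0.
by rewrite rmorphM rmorph_nat rmorph0 => /eqP; rewrite mulf_eq0 pnatr_eq0 /= => /eqP.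
Qed.

Lemma sfun_reg (f : sfun) : (forall p, evp p f != 0) ->
  forall x, f * x = 0 -> x = 0.
Proof.
move=> f0 x fx; apply: evpP => p; rewrite rmorph0; have := congr1 (evp p) fx.
by rewrite rmorphM rmorph0 => /eqP; rewrite mulf_eq0 (negPf (f0 p)) => /eqP.
Qed.

(** * Partial derivatives as commuting derivations *)

Definition sder i (f : sfun) : sfun :=
  mksfun (smooth_derive (delta_mx 0 i) (sfun_smooth f)).

Lemma evp_sder p i f : evp p (sder i f) = 'D_(delta_mx 0 i) (sval_fun f) (sval p).
Proof. exact: evp_mk. Qed.

Lemma derive_extend0 v (f : 'rV[R]_m -> R) (p : pt) :
  'D_v (extend0 f) (sval p) = 'D_v f (sval p).
Proof.
apply: near_eq_derive; case: p => p Up /=.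
by apply: (open_near_eq Uo Up) => q Uq; rewrite extend0E.
Qed.

Lemma sfun_derivable (f : sfun) (p : pt) v : derivable (sval_fun f) (sval p) v.
Proof. exact: (smooth_derivable (sfun_smooth f) (svalP p)). Qed.

Fact sderD i f g : sder i (f + g) = sder i f + sder i g.
Proof.
apply: evpP => p; rewrite evpD !evp_sder /= derive_extend0.
exact: (deriveD (@sfun_derivable f p _) (@sfun_derivable g p _)).
Qed.

Fact sderM i f g : sder i (f * g) = sder i f * g + f * sder i g.
Proof.
apply: evpP => p; rewrite evpD !evpM !evp_sder /= derive_extend0.
apply: etrans (deriveM (@sfun_derivable f p _) (@sfun_derivable g p _)) _.
by rewrite addrC [X in X + _]mulrC.
Qed.

Definition ds i : der sfun := Der (sderD i) (sderM i).

Lemma evp_ds p i f : evp p (ds i f) = 'D_(delta_mx 0 i) (sval_fun f) (sval p).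
Proof. exact: evp_sder. Qed.

Lemma evp_ds2 p i j f : evp p (ds i (ds j f)) =
  'D_(delta_mx 0 i) (fun q => 'D_(delta_mx 0 j) (sval_fun f) q) (sval p).
Proof.
pose D q := 'D_(delta_mx 0 j) (sval_fun f) q.
rewrite -[RHS](derive_extend0 (delta_mx 0 i) D p).
exact: (evp_ds p i (ds j f)).
Qed.

Lemma dsC i j f : ds i (ds j f) = ds j (ds i f).
Proof.
apply: evpP => p; apply: (etrans (evp_ds2 p i j f)).
apply: (etrans _ (esym (evp_ds2 p j i f))).
exact: (@derive_comm _ _ _ _ _ _ _ Uo (sfun_smooth f 2%N) (svalP p)).
Qed.

Lemma ds_scst i a : ds i (scst a) = 0.
Proof.
apply: evpP => p; apply: (etrans (evp_ds p i _)).
rewrite (derive_extend0 (delta_mx 0 i) (fun=> a) p) derive_cst.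
by rewrite /evp /ev /= extend0E //; exact: svalP p.
Qed.

End SmoothFunctions.
Arguments evp {R m U} p f.
Arguments mksfun {R m U f} fs.
Arguments ds {R m U} i.

(** * The Levi-Civita connection in coordinates *)

Lemma ip_inner (R : realType) n (h : 'M[R]_n) u v : ip h u v = inner h u v.
Proof. by []. Qed.

Lemma pos_unitmx (R : realType) n (h : 'M[R]_n) :
  (forall u, u != 0 -> 0 < inner h u u) -> h \in unitmx.
Proof.
move=> hpos; rewrite -row_free_unit -kermx_eq0; apply/eqP/row_matrixP => i.
rewrite row0; apply/eqP; apply: contraT => /hpos.
by rewrite /inner -row_mul mulmx_ker row0 mul0mx mxE ltxx.
Qed.

Lemma inner_eq0 (R : realType) n (h : 'M[R]_n) u :
  (forall v, v != 0 -> 0 < inner h v v) -> inner h u u = 0 -> u = 0.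
Proof.
by move=> hpos u0; apply/eqP; apply: contraT => /hpos; rewrite u0 ltxx.
Qed.

(** The equality case of the Cauchy-Schwarz inequality: u minus its projection on v has length 0. *)
Lemma gram_eq0 (R : realType) n (h : 'M[R]_n) u v : h^T = h ->
  (forall w, w != 0 -> 0 < inner h w w) ->
  inner h u u * inner h v v - inner h u v ^+ 2 = 0 ->
  v = 0 \/ exists t, u = t *: v.
Proof.
move=> hT hpos; rewrite -!ip_inner => den0.
have [->|v0] := eqVneq v 0; [by left|right].
have vv : ip h v v != 0 by rewrite gt_eqF //; exact: hpos.
exists (ip h u v / ip h v v); apply/eqP; rewrite -subr_eq0; apply/eqP.
apply: (inner_eq0 hpos); rewrite -ip_inner ipBl !ipBr !ipZl !ipZr (ipC hT v u).
apply: (mulfI vv); rewrite mulr0 -den0; field.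
by [].
Qed.

Lemma gram_neq0 (R : realType) n (h : 'M[R]_n) (u v : 'rV[R]_n) : h^T = h ->
  inner h u u * inner h v v - inner h u v ^+ 2 != 0 -> row_free (col_mx u v).
Proof.
move=> hT; rewrite -!ip_inner => den.
apply: inj_row_free => w; rewrite -[w]hsubmxK mul_row_col.
rewrite [lsubmx w]mx11_scalar [rsubmx w]mx11_scalar !mul_scalar_mx.
set a := lsubmx w 0 0; set b := rsubmx w 0 0 => E.
have Eu : a * ip h u u + b * ip h u v = 0.
  by rewrite (ipC hT u v) -!ipZl -ipDl E ip0l.
have Ev : a * ip h u v + b * ip h v v = 0 by rewrite -!ipZl -ipDl E ip0l.
have -> : a = 0.
  apply: (mulIf den); rewrite mul0r.
  transitivity ((a * ip h u u + b * ip h u v) * ip h v v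
    - (a * ip h u v + b * ip h v v) * ip h u v); first by ring.
  by rewrite Eu Ev !mul0r subrr.
have -> : b = 0.
  apply: (mulIf den); rewrite mul0r.
  transitivity ((a * ip h u v + b * ip h v v) * ip h u u
    - (a * ip h u u + b * ip h u v) * ip h u v); first by ring.
  by rewrite Eu Ev !mul0r subrr.
have -> : (0%:M : 'M[R]_1) = 0 by apply/matrixP=> i j; rewrite !mxE mul0rn.
exact: row_mx0.
Qed.

Lemma bilin_eq (R : comNzRingType) n (M N : 'M[R]_n) :
  (forall u v : 'rV_n, u *m M *m v^T = u *m N *m v^T) -> M = N.
Proof.
move=> MN; apply/matrixP=> i j.
have := MN (delta_mx 0 i) (delta_mx 0 j); rewrite trmx_delta -!rowE -!colE.
by move=> /matrixP /(_ 0 0); rewrite !mxE.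
Qed.

(* Horizontal lifting w |-> w h J^T G^-1 is right inverse to u |-> u J. *)
Lemma submersion_lift (R : realType) m n (G : 'M[R]_m) (h : 'M[R]_n)
    (J : 'M[R]_(m, n)) : G^T = G -> h^T = h ->
  (forall u, u != 0 -> 0 < inner G u u) ->
  (forall u, u != 0 -> 0 < inner h u u) ->
  (forall w : 'rV_n, exists u : 'rV_m, u *m J = w) ->
  (forall u v, (forall w, w *m J = 0 -> inner G u w = 0) ->
     (forall w, w *m J = 0 -> inner G v w = 0) ->
     inner h (u *m J) (v *m J) = inner G u v) ->
  h *m J^T *m invmx G *m J = 1%:M.
Proof.
move=> GT hT Gpos hpos surj iso.
have Gu := pos_unitmx Gpos; have hu := pos_unitmx hpos.
have GiT : (invmx G)^T = invmx G by rewrite trmx_inv GT.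
pose N := J^T *m invmx G *m J.
have NT : N^T = N by rewrite /N !trmx_mul trmxK GiT mulmxA.
have hor (w : 'rV_n) z : z *m J = 0 -> inner G (w *m h *m J^T *m invmx G) z = 0.
  move=> zJ; rewrite /inner mulmxKV // -mulmxA -trmx_mul zJ trmx0 mulmx0.
  by rewrite mxE.
(* The isometry condition on the horizontal vectors w h J^T G^-1. *)
have hNh : h *m N *m h *m N *m h = h *m N *m h.
  apply: bilin_eq => u v; have := iso _ _ (hor u) (hor v).
  rewrite /inner !trmx_mul trmxK GiT hT mulmxKV // => E.
  apply/matrixP=> i j; rewrite !ord1; move: E; rewrite /N !mulmxA => E.
  exact: E.
(* If w N = 0, then w J^T G^-1 has length 0, so w J^T = 0, and w = 0 because J is onto. *)
have Nu : N \in unitmx.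
  rewrite -row_free_unit; apply: inj_row_free => w wN.
  have y0 : w *m J^T *m invmx G = 0.
    apply: (inner_eq0 Gpos); rewrite /inner trmx_mul GiT mulmxKV // trmx_mul trmxK.
    have -> : w *m J^T *m (invmx G *m (J *m w^T)) = w *m N *m w^T.
      by rewrite /N !mulmxA.
    by rewrite wN mul0mx mxE.
  have wJ : w *m J^T = 0 by rewrite -(mulmxKV Gu (w *m J^T)) y0 mul0mx.
  apply: trmx_inj; rewrite trmx0; apply/row_matrixP => i; rewrite row0 rowE.
  have [u <-] := surj (delta_mx 0 i).
  by rewrite -mulmxA -[J]trmxK -trmx_mul wJ trmx0 mulmx0.
have NhN : N *m h *m N = N.
  have -> : N *m h *m N = invmx h *m (h *m N *m h *m N *m h) *m invmx h.
    by rewrite !mulmxA mulVmx // mul1mx mulmxK.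
  by rewrite hNh -!mulmxA (mulKmx hu) mulmxV // mulmx1 /N -mulmxA.
have -> : h *m J^T *m invmx G *m J = h *m N by rewrite /N !mulmxA.
by rewrite -[h *m N](mulKmx Nu) (mulmxA N) NhN mulVmx.
Qed.

(** * From functions to matrices over the ring of smooth functions *)

Section Evaluation.
Context {R : realType} {m : nat} (U : opens R m).
Local Notation A := (sfun U).
Local Notation evm p := (map_mx (evp (U := U) p)).

Lemma evmZ n n' p a (M : 'M[A]_(n, n')) : evm p (a *: M) = evp p a *: evm p M.
Proof. by apply/matrixP=> i j; rewrite !mxE; exact: evpM. Qed.

Definition mkmx n n' (f : 'rV[R]_m -> 'M[R]_(n, n')) (fs : smooth_on U f) :
    'M[A]_(n, n') :=
  \matrix_(i, j) mksfun (fun k => C_on_coord i j (@open_carrier _ _ U) (fs k)).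

Lemma evm_mkmx n n' (f : 'rV[R]_m -> 'M[R]_(n, n')) (fs : smooth_on U f) p :
  evm p (mkmx fs) = f (sval p).
Proof. by apply/matrixP=> i j; rewrite !mxE evp_mk. Qed.

(** Links a field of the coordinate definitions, whatever its values outside U, to its components in
    the ring. *)
Definition rep n n' (f : 'rV[R]_m -> 'M[R]_(n, n')) (M : 'M[A]_(n, n')) :=
  forall p, f (sval p) = evm p M.

Lemma rep_derive n n' (f : 'rV[R]_m -> 'M[R]_(n, n')) M X (p : pt U) :
  rep f M -> 'D_(evm p X) f (sval p) = evm p (map_mx (along (ds (U := U)) X) M).
Proof.
move=> fM.
pose F q : 'M[R]_(n, n') := \matrix_(i, j) sval_fun (M i j) q.
have Fd x : derivable F (sval p) x.
  apply/derivable_mxP => i j.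
  rewrite (_ : (fun q => F q i j) = sval_fun (M i j)); first exact: sfun_derivable.
  by apply/funext => q; rewrite mxE.
have -> : 'D_(evm p X) f (sval p) = 'D_(evm p X) F (sval p).
  apply: near_eq_derive; case: p {Fd} => p Up /=.
  apply: (open_near_eq (@open_carrier _ _ U) Up) => q Uq.
  by have := fM (exist _ q Uq) => /= ->; apply/matrixP => i j; rewrite !mxE.
rewrite derive_mx //; apply/matrixP=> i j; rewrite !mxE alongE.
rewrite (_ : (fun q => F q i j) = sval_fun (M i j)); last first.
  by apply/funext => q; rewrite mxE.
rewrite derive_row; last first.
  exact: (smooth_differentiable (sfun_smooth _) (svalP p)).
rewrite evp_sum; apply: eq_bigr => k _.
by rewrite evpM mxE evp_ds.
Qed.

Lemma evp_ip n (h : 'M[A]_n) u v p :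
  evp p (ip h u v) = inner (evm p h) (evm p u) (evm p v).
Proof. by rewrite /inner map_trmx -!map_mxM mxE. Qed.

Lemma evm_conn r (K : 'I_m -> 'M[A]_r) X p :
  evm p (conn K X) = \sum_i evm p X 0 i *: evm p (K i).
Proof.
rewrite /conn map_mx_sum; apply: eq_bigr => i _.
by apply/matrixP=> a b; rewrite !(mxE, scalemxE); exact: evpM.
Qed.

Definition cstmx n n' (M : 'M[R]_(n, n')) : 'M[A]_(n, n') := map_mx (@scst _ _ U) M.

Lemma rep_cst n n' (M : 'M[R]_(n, n')) : rep (fun=> M) (cstmx M).
Proof. by move=> p; apply/matrixP=> i j; rewrite !mxE evp_scst. Qed.

Lemma along_scst X a : along (ds (U := U)) X (scst U a) = 0.
Proof. by rewrite alongE big1 // => i _; rewrite ds_scst mulr0. Qed.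

Lemma along_cstmx n n' X (M : 'M[R]_(n, n')) :
  map_mx (along (ds (U := U)) X) (cstmx M) = 0.
Proof. by apply/matrixP=> i j; rewrite !mxE along_scst. Qed.

End Evaluation.

Section LeviCivita.
Context {R : realType} {r : nat} (W : opens R r).
Variable g : 'rV[R]_r -> 'M[R]_r.
Hypothesis gs : smooth_on W g.
Hypothesis gsym : forall p, carrier W p -> (g p)^T = g p.
Hypothesis gpos : forall p, carrier W p -> forall u, u != 0 -> 0 < inner (g p) u u.
Local Notation A := (sfun W).
Local Notation evm p := (map_mx (evp (U := W) p)).
Local Notation d := (@ds R r W).

(* locked, so that mxE leaves the entries alone *)
Definition gA : 'M[A]_r := locked (mkmx gs).

Lemma evm_gA p : evm p gA = g (sval p).
Proof. by rewrite /gA -lock evm_mkmx. Qed.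

Lemma gA_sym : gA^T = gA.
Proof.
apply: mx_evpP => p; rewrite -map_trmx evm_gA; exact: gsym (svalP p).
Qed.

Lemma g_unit (p : pt W) : g (sval p) \in unitmx.
Proof. by apply: pos_unitmx; apply: gpos (svalP p). Qed.

Lemma det_gA_neq0 p : carrier W p -> sval_fun (\det gA) p != 0.
Proof.
move=> Wp; have -> : sval_fun (\det gA) p = evp (exist _ p Wp) (\det gA) by [].
by rewrite -det_map_mx evm_gA -unitfE; exact: g_unit (exist _ p Wp).
Qed.

(** The inverse metric by Cramer's rule, which keeps the entries smooth. *)
Definition giA : 'M[A]_r := locked (mksfun (fun k =>
  C_onV (@open_carrier _ _ W) det_gA_neq0 (sfun_smooth (\det gA) k)) *: \adj gA).

Lemma gA_giA : gA *m giA = 1%:M.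
Proof.
rewrite /giA -lock -scalemxAr mul_mx_adj -mul_scalar_mx -scalar_mxM.
congr (_%:M); apply: evpP => p; rewrite evpM evp_mk rmorph1 mulVf //.
exact: det_gA_neq0 (svalP p).
Qed.

Lemma giA_gA : giA *m gA = 1%:M. Proof. exact: mulmx1C gA_giA. Qed.

Lemma giA_sym : giA^T = giA.
Proof.
have : giA^T *m gA = 1%:M by rewrite -[gA]gA_sym -trmx_mul gA_giA trmx1.
by move=> E; rewrite -[LHS]mulmx1 -gA_giA mulmxA E mul1mx.
Qed.

Lemma evm_giA p : evm p giA = invmx (g (sval p)).
Proof.
have := congr1 (evm p) gA_giA; rewrite map_mxM map_mx1 evm_gA => E.
by rewrite -[LHS]mul1mx -(mulVmx (g_unit p)) -mulmxA E mulmx1.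
Qed.

Lemma scst_half : scst W 2^-1 + scst W 2^-1 = 1 :> A.
Proof.
apply: evpP => p; transitivity (1 : R); last exact: esym (rmorph1 (evp p)).
by rewrite evpD !evp_scst [RHS]splitr mul1r.
Qed.

Definition GA i : 'M[A]_r := locked (chris d gA giA (scst W 2^-1) i).

Lemma evp_d_gA p i j l :
  evp p (d i (gA j l)) = partial i (fun q => g q j l) (sval p).
Proof. by rewrite /gA -lock mxE evp_ds derive_extend0. Qed.

Lemma evp_GA p i j k : evp p (GA i j k) = christoffel g (sval p) k i j.
Proof.
rewrite /GA -lock mxE evpM evp_scst evp_sum /christoffel; congr (_ * _).
apply: eq_bigr => l _; rewrite evpM evpB evpD !evp_d_gA.
by have -> : invmx (g (sval p)) k l = evp p (giA k l) by rewrite -evm_giA mxE.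
Qed.

Lemma GA_chris i : GA i = chris d gA giA (scst W 2^-1) i.
Proof. by rewrite /GA -lock. Qed.

Lemma GA_sym i j k : GA i j k = GA j i k.
Proof. by rewrite !GA_chris; exact: (chris_sym d giA (scst W 2^-1) gA_sym i j k). Qed.

Lemma GA_metric i : map_mx (d i) gA = GA i *m gA + gA *m (GA i)^T.
Proof.
rewrite GA_chris.
exact: (chris_metric d gA_sym giA_sym giA_gA scst_half i).
Qed.

Lemma GammaE (p : pt W) u v :
  Gamma g (sval p) u v = v *m \sum_i u 0 i *: evm p (GA i).
Proof.
apply/rowP=> k; rewrite !mxE exchange_big; apply: eq_bigr => j _.
rewrite summxE mulr_sumr; apply: eq_bigr => i _.
by rewrite !(scalemxE, mxE) evp_GA; ring.
Qed.

Lemma rep_nabla X Y x y : rep X x -> rep Y y ->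
  rep (nabla g X Y) (cov d GA x y).
Proof.
move=> Xx Yy p; rewrite /nabla covE map_mxD Xx (rep_derive _ _ Yy).
by rewrite GammaE map_mxM evm_conn Yy.
Qed.

Lemma rep_bracket X Y x y : rep X x -> rep Y y ->
  rep (bracket X Y) (br d x y).
Proof.
move=> Xx Yy p; rewrite /bracket /br map_mxB Xx Yy.
by rewrite (rep_derive _ _ Yy) (rep_derive _ _ Xx).
Qed.

Lemma rep_curvature X Y Z x y z : rep X x -> rep Y y -> rep Z z ->
  rep (curvature g X Y Z) (z *m curv d GA x y).
Proof.
move=> Xx Yy Zz p; rewrite -(curvE _ (@dsC _ _ W)) !map_mxB /curvature.
have XYZ := rep_nabla Xx (rep_nabla Yy Zz).
have YXZ := rep_nabla Yy (rep_nabla Xx Zz).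
have BZ := rep_nabla (rep_bracket Xx Yy) Zz.
by rewrite XYZ YXZ BZ.
Qed.

Definition Rm (p : pt W) (u v : 'rV[R]_r) : 'M[R]_r :=
  \sum_i \sum_j (u 0 i * v 0 j) *: evm p (curvm d GA i j).

Lemma evm_curv p x y : evm p (curv d GA x y) = Rm p (evm p x) (evm p y).
Proof.
rewrite /curv map_mx_sum; apply: eq_bigr => i _.
rewrite map_mx_sum; apply: eq_bigr => j _.
by rewrite map_mxZ !mxE; congr (_ *: _); exact: evpM.
Qed.

Lemma curvature_atE (p : pt W) u v w :
  curvature_at g (sval p) u v w = w *m Rm p u v.
Proof.
have c X := @rep_cst _ _ W _ _ X.
rewrite /curvature_at (rep_curvature (c _ _ u) (c _ _ v) (c _ _ w)).
by rewrite map_mxM evm_curv -!c.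
Qed.

Lemma br_cst u v : br d (cstmx W u) (cstmx W v) = 0.
Proof. by rewrite /br !along_cstmx subrr. Qed.

Lemma Rm_antisym (p : pt W) u v : Rm p v u = - Rm p u v.
Proof.
rewrite /Rm exchange_big -sumrN; apply: eq_bigr => i _.
rewrite -sumrN; apply: eq_bigr => j _.
rewrite mulrC -scalerN -map_mxN; congr (_ *: map_mx _ _).
exact: curvm_antisym.
Qed.

Lemma Rm_linl (p : pt W) a u v w : Rm p (a *: u + v) w = a *: Rm p u w + Rm p v w.
Proof.
rewrite scaler_sumr -big_split; apply: eq_bigr => i _.
rewrite scaler_sumr -big_split; apply: eq_bigr => j _ /=.
by rewrite !mxE mulrDl scalerDl scalerA mulrA.
Qed.

Lemma Rm_linr (p : pt W) a u v w : Rm p w (a *: u + v) = a *: Rm p w u + Rm p w v.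
Proof. by rewrite !(Rm_antisym _ _ w) Rm_linl scalerN opprD. Qed.

Lemma Rm_skew (p : pt W) u v w z :
  inner (g (sval p)) (w *m Rm p u v) z = - inner (g (sval p)) w (z *m Rm p u v).
Proof.
have := congr1 (evp p) (curv_skew GA_metric (@dsC _ _ W)
  (cstmx W u) (cstmx W v) (cstmx W w) (cstmx W z)).
by rewrite (rmorphN (evp p)) /= !evp_ip !map_mxM evm_curv evm_gA -!rep_cst.
Qed.

Lemma Rm_bianchi (p : pt W) u v w :
  w *m Rm p u v + u *m Rm p v w + v *m Rm p w u = 0.
Proof.
have E a b e : a *m Rm p b e =
    evm p (cstmx W a *m curv d GA (cstmx W b) (cstmx W e)).
  by rewrite map_mxM evm_curv -!rep_cst.
rewrite !E -(map_mxD (evp p)) -(map_mxD (evp p)).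
rewrite (curv_bianchi GA_sym (@dsC _ _ W) (br_cst u v) (br_cst v w) (br_cst w u)).
exact: (map_mx0 (evp p)).
Qed.

(** The difference [T] from the constant curvature model has the symmetries of a curvature tensor
    and zero sectional curvature. *)
Lemma Rm_const (p : pt W) c :
  (forall u v, row_free (col_mx u v) -> sectional g (sval p) u v = c) ->
  forall u v w, w *m Rm p u v =
    c *: (inner (g (sval p)) v w *: u - inner (g (sval p)) u w *: v).
Proof.
move=> sec; set G := g (sval p).
have GT : G^T = G := gsym (svalP p).
have Gpos : forall u, u != 0 -> 0 < inner G u u := gpos (svalP p).
pose T u v w z := ip G (w *m Rm p u v) z
  - c * (ip G v w * ip G u z - ip G u w * ip G v z).
have D1 u v w : Rm p (u + v) w = Rm p u w + Rm p v w.
  by rewrite -[u]scale1r Rm_linl !scale1r.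
have D2 u v w : Rm p w (u + v) = Rm p w u + Rm p w v.
  by rewrite -[u]scale1r Rm_linr !scale1r.
have T0 : forall u v w z, T u v w z = 0.
  apply: curvature_like_eq0; rewrite /T.
  - by move=> a b v w z; rewrite D1 // mulmxDr !ipDl; ring.
  - by move=> u a b w z; rewrite D2 // mulmxDr !ipDl; ring.
  - by move=> u v a b z; rewrite mulmxDl !ipDl !ipDr; ring.
  - by move=> u v w a b; rewrite !ipDr; ring.
  - by move=> u v w z; rewrite (Rm_antisym _ u v) mulmxN ipNl; ring.
  - move=> u v w z; have := Rm_skew p u v w z; rewrite -!ip_inner -/G => E.
    by rewrite (ipC GT (z *m _)) -[ip G w (z *m _)]opprK -E; ring.
  - move=> u v w z; have E := congr1 (fun x => ip G x z) (Rm_bianchi p u v w).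
    move: E; rewrite /= !ipDl ip0l => E.
    rewrite -[RHS]E (ipC GT u v) (ipC GT v w) (ipC GT u w); ring.
  - move=> u v.
    (* The hypothesis speaks of independent vectors only; for dependent ones both terms of [T]
       vanish. *)
    have [den0|den] := eqVneq (inner G u u * inner G v v - inner G u v ^+ 2) 0.
      have [->|[t ->]] := gram_eq0 GT Gpos den0.
        by rewrite mul0mx !ip0l !ip0r; ring.
      have Rvv : Rm p v v = 0.
        apply/matrixP=> i j; rewrite mxE.
        have /matrixP /(_ i j) := Rm_antisym p v v; rewrite [RHS]mxE => E.
        by apply/eqP; rewrite -[_ == _](mulrn_eq0 _ 2) mulr2n {1}E addNr.
      have R0 : Rm p 0 v = 0.
        by rewrite /Rm big1 // => i _; rewrite big1 // => j _; rewrite mxE mul0r scale0r.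
      have -> : Rm p (t *: v) v = 0.
        by rewrite -[t *: v]addr0 Rm_linl Rvv R0 scaler0 addr0.
      by rewrite mulmx0 ip0l !(ipZl, ipZr); ring.
    have := sec u v (gram_neq0 GT den).
    rewrite /sectional curvature_atE -/G => E.
    have -> : ip G (v *m Rm p u v) u =
        c * (inner G u u * inner G v v - inner G u v ^+ 2).
      by rewrite -E divfK.
    by rewrite -!ip_inner (ipC GT v u); ring.
move=> u v w; apply/eqP; rewrite -subr_eq0; apply/eqP.
apply: (ip_inj (mulmxV (g_unit p))) => z.
rewrite -/G -(T0 u v w z) /T ipBl ipZl ipBl !ipZl -!ip_inner; ring.
Qed.

End LeviCivita.

(** * Submersions in coordinates *)

(* Squared length of the vertical part of the constant field [u0]; unlike [vert]
   below, it does not depend on the open set. *)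
Definition vert_norm (R : realType) m n (g : 'rV[R]_m -> 'M[R]_m)
    (h : 'rV[R]_n -> 'M[R]_n) (F : 'rV[R]_m -> 'rV[R]_n) u0 p :=
  let jacobian := lin1_mx (fun x => 'D_x F p) in
  let v := u0 - u0 *m jacobian *m (h (F p) *m jacobian^T *m invmx (g p)) in inner (g p) v v.

Section LocalSubmersion.
Context {R : realType} {m n : nat} (U : opens R m) (V : opens R n).
Variables (g : 'rV[R]_m -> 'M[R]_m) (h : 'rV[R]_n -> 'M[R]_n).
Variable F : 'rV[R]_m -> 'rV[R]_n.
Hypothesis gs : smooth_on U g.
Hypothesis gsym : forall p, carrier U p -> (g p)^T = g p.
Hypothesis gpos : forall p, carrier U p -> forall u, u != 0 -> 0 < inner (g p) u u.
Hypothesis hs : smooth_on V h.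
Hypothesis hsym : forall p, carrier V p -> (h p)^T = h p.
Hypothesis hpos : forall p, carrier V p -> forall u, u != 0 -> 0 < inner (h p) u u.
Hypothesis Fs : smooth_on U F.
Hypothesis FV : forall p, carrier U p -> carrier V (F p).

Local Notation A := (sfun U).
Local Notation evm p := (map_mx (evp (U := U) p)).
Local Notation d := (@ds R m U).

Definition Fpt (p : pt U) : pt V := exist _ (F (sval p)) (FV (svalP p)).

(** Pullback along F, a ring morphism that carries the metric and Christoffel symbols of the target
    to the source. *)
Definition pb (f : sfun V) : A :=
  mksfun (fun k => C_on_comp (@open_carrier _ _ U) FV (Fs k) (sfun_smooth f k)).

Lemma evp_pb p f : evp p (pb f) = evp (Fpt p) f.
Proof. exact: (evp_mk p (f := fun q => sval_fun f (F q))). Qed.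

Fact pb_zmod : zmod_morphism pb.
Proof. by move=> x y; apply: evpP => p; rewrite evp_pb !evpB !evp_pb. Qed.
Fact pb_monoid : monoid_morphism pb.
Proof.
split=> [|x y]; apply: evpP => p; last by rewrite evp_pb !evpM !evp_pb.
by rewrite evp_pb; transitivity (1 : R);
  [exact: (rmorph1 (evp (Fpt p)))|exact: (esym (rmorph1 (evp p)))].
Qed.
HB.instance Definition _ := GRing.isZmodMorphism.Build (sfun V) A pb pb_zmod.
HB.instance Definition _ := GRing.isMonoidMorphism.Build (sfun V) A pb pb_monoid.

Lemma evm_pb p r r' (M : 'M[sfun V]_(r, r')) :
  evm p (map_mx pb M) = map_mx (evp (Fpt p)) M.
Proof. by apply/matrixP=> i j; rewrite !mxE evp_pb. Qed.

Definition FA : 'rV[A]_n := mkmx Fs.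
Definition jacobian : 'M[A]_(m, n) := locked (\matrix_(i, c) d i (FA 0 c)).

Lemma JE i c : jacobian i c = d i (FA 0 c).
Proof. by rewrite /jacobian -lock mxE. Qed.

Lemma rep_F : rep F FA.
Proof. by move=> p; rewrite evm_mkmx. Qed.

Lemma along_F X : map_mx (along d X) FA = X *m jacobian.
Proof.
apply/matrixP=> i c; rewrite !ord1 [LHS]mxE alongE [RHS]mxE.
by apply: eq_bigr => k _; rewrite JE.
Qed.

Lemma derive_F (p : pt U) X : 'D_(evm p X) F (sval p) = evm p X *m evm p jacobian.
Proof. by rewrite (rep_derive X p rep_F) along_F map_mxM. Qed.

Lemma derive_F_cst (p : pt U) x : 'D_x F (sval p) = x *m evm p jacobian.
Proof. by have := derive_F p (cstmx U x); rewrite -rep_cst. Qed.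

Lemma d_pb i f : d i (pb f) = \sum_c jacobian i c * pb (ds c f).
Proof.
apply: evpP => p; rewrite evp_sum; apply: (etrans (evp_ds p i (pb f))).
apply: (etrans (@derive_extend0 _ _ U _ (fun q => sval_fun f (F q)) p)).
rewrite (derive_comp _ (smooth_differentiable Fs (svalP p))
  (smooth_differentiable (sfun_smooth f) (FV (svalP p)))).
apply: eq_bigr => c _; rewrite evpM evp_pb evp_ds; congr (_ * _).
by rewrite derive_F_cst -rowE mxE mxE.
Qed.

Lemma md_pb i r r' (M : 'M[sfun V]_(r, r')) :
  map_mx (d i) (map_mx pb M) = \sum_c jacobian i c *: map_mx pb (map_mx (ds c) M).
Proof.
apply/matrixP=> a b; rewrite !mxE d_pb summxE.
by apply: eq_bigr => c _; rewrite !mxE.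
Qed.

Lemma along_pb X f : along d X (pb f) = \sum_c (X *m jacobian) 0 c * pb (ds c f).
Proof.
rewrite alongE; under eq_bigr => i _ do rewrite d_pb mulr_sumr.
rewrite exchange_big; apply: eq_bigr => c _; rewrite mxE mulr_suml.
by apply: eq_bigr => i _; rewrite mulrA.
Qed.

Lemma malong_pb X r r' (M : 'M[sfun V]_(r, r')) : X *m jacobian = 0 ->
  map_mx (along d X) (map_mx pb M) = 0.
Proof.
move=> XJ; apply/matrixP=> a b; rewrite !mxE along_pb big1 // => c _.
by rewrite XJ mxE mul0r.
Qed.

Definition hF : 'M[A]_n := map_mx pb (gA hs).
Definition hFi : 'M[A]_n := map_mx pb (giA hs hpos).
Definition pb_chris a : 'M[A]_n := map_mx pb (GA hs hpos a).
Definition pb_dchris b a : 'M[A]_n := map_mx pb (map_mx (ds b) (GA hs hpos a)).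
Local Notation K := (pull jacobian pb_chris).
Local Notation Q := (pull_curvm pb_chris pb_dchris).
Local Notation G := (GA gs gpos).
Local Notation gU := (gA gs).
Local Notation gUi := (giA gs gpos).

Lemma hF_sym : hF^T = hF.
Proof. by rewrite /hF map_trmx gA_sym. Qed.

Lemma hF_hFi : hF *m hFi = 1%:M.
Proof. by rewrite /hF /hFi -map_mxM gA_giA map_mx1. Qed.

Lemma evm_hF p : evm p hF = h (F (sval p)).
Proof. by rewrite /hF evm_pb evm_gA. Qed.

Lemma hF_metric i : map_mx (d i) hF = K i *m hF + hF *m (K i)^T.
Proof.
rewrite /hF md_pb /pull linear_sum mulmx_suml mulmx_sumr -big_split.
apply: eq_bigr => c _; rewrite (GA_metric hs hsym hpos) map_mxD !map_mxM.
by rewrite linearZ /= -scalemxAl -scalemxAr -scalerDr /pb_chris map_trmx.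
Qed.

Lemma d_J i j a : d i (jacobian j a) = d j (jacobian i a).
Proof. by rewrite !JE dsC. Qed.

Lemma d_P i a : map_mx (d i) (pb_chris a) = \sum_b jacobian i b *: pb_dchris b a.
Proof. exact: md_pb. Qed.

Lemma J_torsion i j k : (map_mx (d i) jacobian + jacobian *m K i) j k =
  (map_mx (d j) jacobian + jacobian *m K j) i k.
Proof.
have djac a b : map_mx (d a) jacobian b k = d a (jacobian b k) by rewrite mxE.
have Psym a b c : pb_chris a b c = pb_chris b a c.
  rewrite /pb_chris [LHS]mxE [RHS]mxE; congr (pb _); exact: GA_sym.
apply: (etrans (addmxE _ _ _ _)); apply: (etrans _ (esym (addmxE _ _ _ _))).
by rewrite (djac i j) (djac j i) (d_J i j k) (pull_sym jacobian Psym i j k).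
Qed.

Lemma curv_K X Y : curv d K X Y = RN Q (X *m jacobian) (Y *m jacobian).
Proof. by rewrite (curv_pull d_J d_P). Qed.

Lemma conn_vert X : X *m jacobian = 0 -> conn K X = 0.
Proof.
by move=> XJ; rewrite conn_pull XJ big1 // => a _; rewrite mxE scale0r.
Qed.

Lemma Q_pb a b : Q a b = map_mx pb (curvm ds (GA hs hpos) a b).
Proof.
rewrite /pull_curvm /pb_chris /pb_dchris /curvm; move: (GA hs hpos) => M.
by rewrite (map_mxD pb) (map_mxB pb) (map_mxB pb) (map_mxM pb) (map_mxM pb).
Qed.

Lemma evm_RN p u v : evm p (RN Q u v) = Rm hs hpos (Fpt p) (evm p u) (evm p v).
Proof.
rewrite /RN map_mx_sum; apply: eq_bigr => i _.
rewrite map_mx_sum; apply: eq_bigr => j _.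
by rewrite map_mxZ Q_pb evm_pb !mxE; congr (_ *: _); exact: evpM.
Qed.

Lemma rep_push X x : rep X x -> rep (push F X) (x *m jacobian).
Proof. by move=> Xx p; rewrite /push Xx derive_F map_mxM. Qed.

Lemma rep_nabla_along X Y x y : rep X x -> rep Y y ->
  rep (nabla_along h F X Y) (cov d K x y).
Proof.
move=> Xx Yy p; rewrite /nabla_along covE map_mxD Xx (rep_derive _ _ Yy).
congr (_ + _); rewrite (GammaE hs hpos (Fpt p)) map_mxM Yy (rep_push Xx).
congr (_ *m _); rewrite conn_pull map_mx_sum; apply: eq_bigr => a _.
by rewrite map_mxZ evm_pb mxE.
Qed.

(** * The orthonormal frame and the two fields in it *)

Variable e : 'I_m -> 'rV[R]_m -> 'rV[R]_m.
Hypothesis es : forall i, smooth_on U (e i).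
Hypothesis eon : forall p, carrier U p ->
  forall i j, inner (g p) (e i p) (e j p) = (i == j)%:R.

Definition frame_mx : 'M[A]_m := locked (\matrix_(i, j) mkmx (es i) 0 j).

Lemma row_E i : row i frame_mx = mkmx (es i).
Proof. by apply/rowP=> j; rewrite /frame_mx -lock !mxE. Qed.

Lemma rep_e i : rep (e i) (row i frame_mx).
Proof. by move=> p; rewrite row_E evm_mkmx. Qed.

(** From E g E^T = 1, a left inverse being a right inverse, g E^T E = 1. *)
Lemma E_orthonormal : frame_mx^T *m frame_mx = gUi.
Proof.
have EgE : frame_mx *m gU *m frame_mx^T = 1%:M.
  apply: mx_evpP => p; apply/matrixP=> i j; rewrite map_mx1.
  have -> : evm p (frame_mx *m gU *m frame_mx^T) i j
      = inner (g (sval p)) (e i (sval p)) (e j (sval p)).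
    rewrite (rep_e i) (rep_e j) -evm_gA -evp_ip -ip_row.
    by rewrite [LHS]mxE.
  by rewrite eon ?mxE //; exact: svalP p.
have gEE : gU *m frame_mx^T *m frame_mx = 1%:M by apply: mulmx1C; rewrite mulmxA.
by rewrite -[RHS]mulmx1 -gEE !mulmxA (giA_gA gs gpos) mul1mx.
Qed.

Lemma rep_tension : rep (tension g h F e) (tens d G K jacobian frame_mx).
Proof.
move=> p; rewrite /tension /tens map_mx_sum; apply: eq_bigr => i _.
rewrite /BB map_mxB (rep_nabla_along (rep_e i) (rep_push (rep_e i))).
by rewrite (rep_push (rep_nabla gs gpos (rep_e i) (rep_e i))).
Qed.

Lemma rep_bitension : rep (bitension g h F e) (bitens d G K jacobian Q frame_mx).
Proof.
move=> p; rewrite /bitension /bitens map_mx_sum; apply: eq_bigr => i _.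
rewrite 2!map_mxB.
rewrite (rep_nabla_along (rep_e i) (rep_nabla_along (rep_e i) rep_tension)).
rewrite (rep_nabla_along (rep_nabla gs gpos (rep_e i) (rep_e i)) rep_tension).
rewrite (curvature_atE hs hpos (Fpt p)) (rep_push (rep_e i)) (rep_tension p).
by rewrite (map_mxM _ (row i frame_mx *m jacobian)) evm_RN.
Qed.

(** * The horizontal lift and the unit vertical field *)

Hypothesis hsurj : forall p, carrier U p -> forall w, exists u, 'D_u F p = w.
Hypothesis hiso : forall p, carrier U p -> forall u v,
  horizontal (g p) F p u -> horizontal (g p) F p v ->
  inner (h (F p)) ('D_u F p) ('D_v F p) = inner (g p) u v.

Definition hlift : 'M[A]_(n, m) := hF *m jacobian^T *m gUi.

Lemma LJ : hlift *m jacobian = 1%:M.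
Proof.
apply: mx_evpP => p.
rewrite /hlift !map_mxM map_mx1 -map_trmx evm_hF evm_giA.
have Up := svalP p.
apply: submersion_lift.
- exact: gsym.
- exact: hsym (FV Up).
- exact: gpos.
- exact: hpos (FV Up).
- by move=> w; have [u <-] := hsurj Up w; exists u; rewrite derive_F_cst.
- move=> u v uh vh; rewrite -!derive_F_cst; apply: (hiso Up) => w.
    by rewrite derive_F_cst; exact: uh.
  by rewrite derive_F_cst; exact: vh.
Qed.

Lemma gL : gU *m hlift^T = jacobian *m hF.
Proof.
rewrite /hlift !trmx_mul trmxK hF_sym (giA_sym gs gsym gpos) !mulmxA.
by rewrite (gA_giA gs gpos) mul1mx.
Qed.


Hypothesis mn : m = n.+1.
Variable u0 : 'rV[R]_m.

(* Normalized, it spans the vertical distribution where it does not vanish. *)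
Definition vert : 'rV[A]_m := cstmx U u0 - cstmx U u0 *m jacobian *m hlift.
Local Notation rho := (ip gU vert vert).

Lemma evm_J p : evm p jacobian = lin1_mx (fun x => 'D_x F (sval p)).
Proof. by apply/matrixP=> i j; rewrite [RHS]mxE derive_F_cst -rowE [RHS]mxE. Qed.

Lemma evp_rho p : evp p rho = vert_norm g h F u0 (sval p).
Proof.
rewrite evp_ip evm_gA /vert_norm -(evm_J p).
have -> : evm p vert = u0 - u0 *m evm p jacobian *m
    (h (F (sval p)) *m (evm p jacobian)^T *m invmx (g (sval p))).
  rewrite /vert /hlift map_mxB !map_mxM -map_trmx evm_hF evm_giA.
  by rewrite -(@rep_cst _ _ U _ _ u0 p).
by [].
Qed.

Hypothesis rho_gt0 : forall p, 0 < evp p rho.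

Let rho_pos p : carrier U p -> 0 < sval_fun rho p.
Proof. by move=> Up; exact: (rho_gt0 (exist _ p Up)). Qed.

Let sqrt_rho_neq0 p : carrier U p -> Num.sqrt (sval_fun rho p) != 0.
Proof. by move=> Up; rewrite gt_eqF // sqrtr_gt0 rho_pos. Qed.

Definition rsqrt : A := mksfun (fun k =>
  C_onV (@open_carrier _ _ U) sqrt_rho_neq0
    (C_on_sqrt (@open_carrier _ _ U) rho_pos (sfun_smooth rho k))).

Definition e0 : 'rV[A]_m := rsqrt *: vert.

Lemma e0J : e0 *m jacobian = 0.
Proof.
by rewrite /e0 -scalemxAl /vert mulmxBl -(mulmxA _ hlift) LJ mulmx1 subrr scaler0.
Qed.

Lemma e0_unit : ip gU e0 e0 = 1.
Proof.
rewrite /e0 ipZl ipZr mulrA; apply: evpP => p.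
transitivity (1 : R); last exact: (esym (rmorph1 (evp p))).
rewrite evpM evpM evp_mk -invfM -expr2 sqr_sqrtr; last exact: ltW (rho_gt0 p).
by rewrite mulVf // gt_eqF //; exact: rho_gt0 p.
Qed.

Lemma e0_dec : jacobian *m hlift + gU *m e0^T *m e0 = 1%:M.
Proof.
apply: (orthogonal_decomposition mn LJ e0J).
  have -> : hlift *m gU = hF *m jacobian^T.
    by rewrite /hlift -mulmxA (giA_gA gs gpos) mulmx1.
  by rewrite -mulmxA -trmx_mul e0J trmx0 mulmx0.
by rewrite [LHS]mx11_scalar -[X in X%:M]/(ip gU e0 e0) e0_unit.
Qed.

(** Both sides are the inverse metric: the left by orthonormality, the right by the splitting
    [e0_dec]. *)
Lemma frame_E : frame_mx^T *m frame_mx = hlift^T *m hFi *m hlift + e0^T *m e0.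
Proof.
have LT : hlift^T *m hFi = gUi *m jacobian.
  have -> : hlift^T = gUi *m (jacobian *m hF).
    by rewrite -gL mulmxA (giA_gA gs gpos) mul1mx.
  by rewrite -!mulmxA hF_hFi mulmx1.
rewrite E_orthonormal LT -[LHS]mulmx1 -e0_dec mulmxDr !mulmxA.
by rewrite (giA_gA gs gpos) mul1mx.
Qed.

(** * Constant curvature and the two cases for S *)

Variables c lam : R.
Hypothesis sec : forall p, carrier U p -> forall u v : 'rV[R]_m,
  row_free (col_mx u v) -> sectional g p u v = c.

Lemma curv_const X Y Z : Z *m curv d G X Y =
  scst U c *: (ip gU Y Z *: X - ip gU X Z *: Y).
Proof.
apply: mx_evpP => p; rewrite (map_mxM _ Z) evm_curv.
rewrite (Rm_const gs gsym gpos (sec (svalP p))).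
rewrite evmZ evp_scst map_mxB 2!evmZ !evp_ip.
by rewrite evm_gA.
Qed.

(** On the lift of a basis vector the connection matrix is a pulled back matrix of Christoffel
    symbols. *)
Lemma dK_lift a : map_mx (along d e0) (conn K (delta_mx 0 a *m hlift)) = 0.
Proof.
have -> : conn K (delta_mx 0 a *m hlift) = pb_chris a.
  rewrite conn_pull -mulmxA LJ mulmx1 (bigD1 a) //= big1 ?addr0 => [|b /negPf ba].
    by rewrite mxE !eqxx scale1r.
  by rewrite mxE ba andbF scale0r.
exact: malong_pb e0J.
Qed.

Definition local_summary := submersion_summary (@dsC R m U) (@sfun_natI R m U)
  (gA_sym gs gsym) (GA_metric gs gsym gpos) (GA_sym gs gsym gpos)
  hF_sym hF_hFi hF_metric J_torsion LJ gL e0J e0_unit e0_dec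
  (fun X => along_scst X c) curv_const curv_K (conn_vert e0J) dK_lift
  (fun a b => etrans (congr1 _ (Q_pb a b)) (malong_pb _ e0J))
  (@sfun_reduced R m U) frame_E.

(* The curvature of N at F p is that of a space form of curvature c. By O'Neill's
   formula this is where the integrability tensor of the horizontal distribution
   vanishes, so that the vanishing locus does not depend on the choice of e0. *)
Definition form_like p := forall w u,
  inner (h (F p)) (curvature_at h (F p) w u u) w =
  c * (inner (h (F p)) u u * inner (h (F p)) w w - inner (h (F p)) w u ^+ 2).

Hypothesis n2 : (1 < n)%N.
Hypothesis hc : 0 <= c \/ (c < 0 /\ lam <> 2 * (n%:R - 1) * c).
Hypothesis bih : forall p, carrier U p -> lambda_bitension lam g h F e p = 0.
Hypothesis tension_neq0 : forall p, carrier U p -> tension g h F e p != 0.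

Lemma rmorph_form (B B' : comNzRingType) (f : {rmorphism B -> B'}) k x y z t :
  f (k * (x * y - z ^+ 2) + 3 * t ^+ 2)
  = f k * (f x * f y - f z ^+ 2) + 3 * f t ^+ 2.
Proof.
by rewrite rmorphD !rmorphM rmorphB rmorphM /= !rmorphXn rmorph_nat.
Qed.

Lemma evp_form p (k x y z t : A) :
  evp p (k * (x * y - z ^+ 2) + 3 * t ^+ 2)
  = evp p k * (evp p x * evp p y - evp p z ^+ 2) + 3 * evp p t ^+ 2.
Proof. exact: (rmorph_form (evp p)). Qed.

(** The tensors S of two open sets have the same zeros where both are defined. The last two clauses
    exclude that S vanishes identically on U and that it has no zero there. *)
Lemma local_contradiction : exists S : 'M[A]_n,
  [/\ forall p, form_like (sval p) <-> evm p S = 0, S <> 0 &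
      ~ forall p, evm p S <> 0].
Proof.
have [S [H [H' [[tH NS Sskew qS cubic] main]]]] := local_summary.
exists S.
have hp (p : pt U) : forall u, u != 0 -> 0 < inner (evm p hF) u u.
  by rewrite evm_hF; exact: hpos (FV (svalP p)).
have biA : bitens d G K jacobian Q frame_mx - scst U lam *: tens d G K jacobian frame_mx = 0.
  apply: mx_evpP => p; rewrite map_mxB evmZ evp_scst -rep_bitension -rep_tension.
  by rewrite [RHS]map_mx0; exact: bih (svalP p).
have Hneq p : evm p H != 0.
  have := tension_neq0 (svalP p); rewrite rep_tension tH map_mxN.
  by rewrite oppr_eq0.
have kpos p : 0 < evp p (ip hF H H) by rewrite evp_ip; exact: hp.
have kreg : forall x, ip hF H H * x = 0 -> x = 0.
  by apply: sfun_reg => p; rewrite gt_eqF.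
have [nonint int flat] := main (scst U lam) (fun X => along_scst X lam) biA kreg.
have evlam (p : pt U) : scst U lam = 2 * (n%:R - 1) * scst U c -> lam = 2 * (n%:R - 1) * c.
  move=> /(congr1 (evp p)); rewrite evp_scst => ->; rewrite !evpM evpB evp_scst.
  by rewrite !(rmorph_nat (evp p)) (rmorph1 (evp p)).
pose bp : pt U := exist _ (base_point U) (@carrier_base_point _ _ U).
have key p w u :
    inner (h (F (sval p))) (curvature_at h (F (sval p)) w u u) w =
    c * (inner (h (F (sval p))) u u * inner (h (F (sval p))) w w
         - inner (h (F (sval p))) w u ^+ 2)
    + 3 * inner (h (F (sval p))) (w *m evm p S) u ^+ 2.
  pose W := cstmx U w; pose X := cstmx U u.
  have eWX Y Z : evp p (ip hF (cstmx U Y) (cstmx U Z)) = inner (h (F (sval p))) Y Z.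
    by rewrite (evp_ip hF _ _ p) evm_hF -!rep_cst.
  have eL : evp p (ip hF (X *m RN Q W X) W)
      = inner (h (F (sval p))) (curvature_at h (F (sval p)) w u u) w.
    rewrite (evp_ip hF _ _ p) (map_mxM (evp p) X (RN Q W X)) evm_RN evm_hF.
    by rewrite -!rep_cst (curvature_atE hs hpos (Fpt p)).
  have eS : evp p (ip hF (W *m S) X) = inner (h (F (sval p))) (w *m evm p S) u.
    by rewrite (evp_ip hF _ _ p) (map_mxM (evp p) W S) evm_hF -!rep_cst.
  apply: (etrans (esym eL)); apply: (etrans (congr1 (evp p) (NS W X))).
  apply: (etrans (evp_form _ _ _ _ _ _)).
  congr (_ * (_ * _ - _ ^+ 2) + 3 * _ ^+ 2); first exact: evp_scst;
    by [exact: eWX | exact: eS].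
split.
- move=> p; split=> [fl|S0 w u]; last first.
    by rewrite key S0 mulmx0 [X in 3 * X ^+ 2](ip0l (h (F (sval p))) u); ring.
  apply/row_matrixP => i; rewrite row0 rowE.
  apply: (ip_inj (mulmxV (pos_unitmx (hpos (FV (svalP p)))))) => u.
  have := key p (delta_mx 0 i) u; rewrite fl => /eqP.
  rewrite eq_sym -subr_eq0 addrAC subrr add0r mulf_eq0 pnatr_eq0 /= sqrf_eq0.
  by move=> /eqP.
(* For c <> 0 the algebra gives c = - |H|^2 < 0 and lambda = 2 (n - 1) c, against [hc]. *)
- move=> S0; have [c0|c0] := eqVneq c 0.
    apply: (flat S0); rewrite c0; apply: evpP => p.
    transitivity (0 : R); first exact: evp_scst.
    exact: (esym (rmorph0 (evp p))).
  have creg : forall x, scst U c * x = 0 -> x = 0.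
    by apply: sfun_reg => p; rewrite evp_scst.
  have [lamE ck] := int S0 n2 creg.
  have := congr1 (evp bp) ck; rewrite evpD evp_scst (rmorph0 (evp bp)) => ck0.
  have kp := kpos bp.
  case: hc => [c_ge0|[_]].
    by have := ltr_wpDl c_ge0 kp; rewrite ck0 ltxx.
  by apply; exact: (evlam bp lamE).
(* Where S does not vanish, |H'|^4 S = 0 forces H' = 0. *)
- move=> Sn; have H'0 : H' = 0.
    apply: mx_evpP => p; rewrite map_mx0; apply: (inner_eq0 (hp p)).
    rewrite -evp_ip; have := congr1 (map_mx (evp p)) qS.
    rewrite evmZ map_mx0 expr2 evpM => /eqP; rewrite scaler_eq0 mulf_eq0 orbb.
    by have /eqP/negPf -> := Sn p; rewrite orbF => /eqP.
  have [lamE ck HSS] := nonint H'0.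
  (* By skewness, |H S|^2 = - [<H, H S^2>] = 0. *)
  have HS : H *m S = 0.
    apply: mx_evpP => p; rewrite [RHS]map_mx0; apply: (inner_eq0 (hp p)).
    by rewrite -evp_ip Sskew HSS ip0r oppr0 rmorph0.
  have cub := congr1 (map_mx (evp bp)) (cubic HS).
  have trS := congr1 (evp bp) ck.
  have kp := kpos bp.
  apply: (@cubic_trace_contradiction R n (evm bp S) (evp bp (scst U c + ip hF H H))).
  + rewrite evpD evp_scst; case: hc => [c_ge0|[_]]; first exact: ltr_wpDl.
    by case; exact: (evlam bp lamE).
  + by move: cub; rewrite map_mxD evmZ !map_mxM map_mx0.
  + apply: etrans (etrans trS (rmorph0 (evp bp))); apply: esym.
    apply: (etrans (evpD _ _ _)); congr (_ + _).
    apply: (etrans (evpM _ _ _)); congr (_ * _); first exact: (rmorph_nat (evp bp)).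
    by rewrite -(map_mxM (evp bp)) (trace_map_mx (evp bp)).
Qed.

End LocalSubmersion.

(** * The local theorem *)

Lemma open_support (R : realType) m (U : opens R m) (f : sfun U) :
  open [set p | sval_fun f p != 0].
Proof.
have sub p : sval_fun f p != 0 -> carrier U p.
  by move=> fp; apply: contrapT => nUp; move: fp; rewrite sfun_out ?eqxx.
rewrite openE => p fp; have Up := sub _ fp.
have fc : {for p, continuous (sval_fun f)} := sfun_smooth f 0%N p Up.
exact: (fc [set x | x != 0] (open_nbhs_nbhs (conj (@open_neq R 0) fp))).
Qed.

Definition support_opens (R : realType) m (U : opens R m) (f : sfun U) p
  (fp : sval_fun f p != 0) : opens R m := @Opens R m _ (@open_support R m U f) p fp.

Lemma support_sub (R : realType) m (U : opens R m) (f : sfun U) p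
  (fp : sval_fun f p != 0) : carrier (support_opens fp) `<=` carrier U.
Proof.
by move=> q fq; apply: contrapT => nUq; move: fq; rewrite /= sfun_out ?eqxx.
Qed.

Section LocalTheorem.
Context {R : realType} {n : nat} (V : opens R n).
Local Notation m := n.+1.
Variables (g : 'rV[R]_m -> 'M[R]_m) (h : 'rV[R]_n -> 'M[R]_n).
Variables (F : 'rV[R]_m -> 'rV[R]_n) (e : 'I_m -> 'rV[R]_m -> 'rV[R]_m).
Variable c : R.

Record target_metric : Prop := TargetMetric {
  ls_hs : smooth_on V h;
  ls_hsym : forall p, carrier V p -> (h p)^T = h p;
  ls_hpos : forall p, carrier V p -> forall u, u != 0 -> 0 < inner (h p) u u }.

(** Stated relative to a set, so that the hypotheses restrict to smaller open sets. *)
Record local_submersion (O : set 'rV[R]_m) : Prop := LocalSubmersion {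
  ls_gs : smooth_on O g;
  ls_gsym : forall p, O p -> (g p)^T = g p;
  ls_gpos : forall p, O p -> forall u, u != 0 -> 0 < inner (g p) u u;
  ls_Fs : smooth_on O F;
  ls_FV : forall p, O p -> carrier V (F p);
  ls_es : forall i, smooth_on O (e i);
  ls_eon : forall p, O p ->
    forall i j, inner (g p) (e i p) (e j p) = (i == j)%:R;
  ls_surj : forall p, O p -> forall w, exists u, 'D_u F p = w;
  ls_iso : forall p, O p -> forall u v,
    horizontal (g p) F p u -> horizontal (g p) F p v ->
    inner (h (F p)) ('D_u F p) ('D_v F p) = inner (g p) u v;
  ls_sec : forall p, O p -> forall u v : 'rV[R]_m,
    row_free (col_mx u v) -> sectional g p u v = c }.

Lemma local_submersion_sub O O' :
  O' `<=` O -> local_submersion O -> local_submersion O'.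
Proof.
move=> sub [gs gsym gpos Fs FV es eon surj iso sec]; split.
- exact: smooth_sub gs.
- by move=> p /sub; exact: gsym.
- by move=> p /sub; exact: gpos.
- exact: smooth_sub Fs.
- by move=> p /sub; exact: FV.
- by move=> i; exact: smooth_sub (es i).
- by move=> p /sub; exact: eon.
- by move=> p /sub; exact: surj.
- by move=> p /sub; exact: iso.
- by move=> p /sub; exact: sec.
Qed.

Hypothesis hV : target_metric.
Variable lam : R.

(** Vanishing on all of U makes tau the zero of the ring, so its derivatives vanish as well. *)
Lemma lambda_bitension_eq0 (U : opens R m) : local_submersion U ->
  (forall p, carrier U p -> tension g h F e p = 0) ->
  forall p, carrier U p -> lambda_bitension lam g h F e p = 0.
Proof.
case: hV => hs hsym hpos [gs gsym gpos Fs FV es eon surj iso sec] t0 p Up.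
pose q : pt U := exist _ p Up.
have T := rep_tension gs gpos hs hpos Fs FV es.
have B := rep_bitension gs gpos hs hpos Fs FV es.
rewrite /lambda_bitension t0 // scaler0 subr0 (B q) /bitens.
have -> : tens (@ds R m U) (GA gs gpos) (pull (jacobian Fs) (pb_chris hs hpos Fs FV))
    (jacobian Fs) (frame_mx es) = 0.
  apply: mx_evpP => s; rewrite -T map_mx0; exact: t0 (svalP s).
rewrite big1 ?map_mx0 // => i _.
rewrite !cov0r subrr sub0r /RN big1 ?mulmx0 ?oppr0 // => a _.
by rewrite big1 // => b _; rewrite [_ 0 b]mxE mulr0 scale0r.
Qed.

Hypothesis n2 : (1 < n)%N.
Hypothesis hc : 0 <= c \/ (c < 0 /\ lam <> 2 * (n%:R - 1) * c).

Lemma inner_ge0 r (G : 'M[R]_r) v :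
  (forall u, u != 0 -> 0 < inner G u u) -> 0 <= inner G v v.
Proof.
move=> Gpos; have [->|/Gpos /ltW //] := eqVneq v 0.
by rewrite -ip_inner ip0l.
Qed.

Lemma local_form (U : opens R m) u0 : local_submersion U ->
  (forall p, carrier U p -> lambda_bitension lam g h F e p = 0) ->
  (forall p, carrier U p -> tension g h F e p != 0) ->
  (forall p, carrier U p -> vert_norm g h F u0 p != 0) ->
  exists S : 'M[sfun U]_n,
  [/\ forall p : pt U, form_like h F c (sval p) <-> map_mx (evp p) S = 0, S <> 0 &
      ~ forall p : pt U, map_mx (evp p) S <> 0].
Proof.
case: hV => hs hsym hpos [gs gsym gpos Fs FV es eon surj iso sec] bih tn v0.
pose v := vert gs gpos hs Fs FV u0.
have v_gt0 (p : pt U) : 0 < evp p (ip (gA gs) v v).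
  rewrite evp_rho lt_neqAle eq_sym v0 /=; last exact: svalP p.
  by apply: inner_ge0; exact: gpos (svalP p).
exact: (@local_contradiction R m n U V g h F gs gsym gpos hs hsym hpos Fs FV
  e es eon surj iso erefl u0 v_gt0 c lam sec n2 hc bih tn).
Qed.

(** Where tau <> 0, shrink twice: to [U0], on which tau and the vertical field have no zero, then to
    [U1], on which the S of [U0] has none. The S of [U1] has the same zeros there, so it has none,
    against [local_form]. *)
Lemma tension_eq0 (U : opens R m) : local_submersion U ->
  (forall p, carrier U p -> lambda_bitension lam g h F e p = 0) ->
  forall p, carrier U p -> tension g h F e p = 0.
Proof.
move=> sU bih p0 Up0; apply/eqP; apply: contrapT => /negP t0.
case: (hV) (sU) => hs hsym hpos [gs gsym gpos Fs FV es eon surj iso sec].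
pose q0 : pt U := exist _ p0 Up0.
have T := rep_tension gs gpos hs hpos Fs FV es.
(* The differential maps dimension n + 1 to dimension n, so it has a kernel at [p0]. *)
have ker : exists2 u0 : 'rV[R]_m, u0 != 0 & u0 *m map_mx (evp q0) (jacobian Fs) = 0.
  have : kermx (map_mx (evp q0) (jacobian Fs)) != 0.
    rewrite kermx_eq0 /row_free neq_ltn ltnS.
    by rewrite rank_leq_col.
  by move=> /rowV0Pn [u /sub_kermxP uJ u0]; exists u.
have [u0 u0n u0J] := ker; have [k tk] := rV0Pn _ t0.
set t := tens _ _ _ _ _ in T.
pose rho := ip (gA gs) (vert gs gpos hs Fs FV u0) (vert gs gpos hs Fs FV u0).
(* The support of this product is [U0]; one component of tau, nonzero at [p0], is enough. *)
pose f := rho * t 0 k.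
have fE p (Up : carrier U p) : sval_fun f p
    = vert_norm g h F u0 p * tension g h F e p 0 k.
  rewrite (T (exist _ p Up)) mxE -(evp_rho gs gpos hs Fs FV u0 (exist _ p Up)).
  exact: (evpM (exist _ p Up) rho (t 0 k)).
have f0 : sval_fun f p0 != 0.
  rewrite (fE p0 Up0) mulf_neq0 //.
  rewrite /vert_norm -(evm_J Fs q0) u0J !mul0mx subr0.
  by rewrite gt_eqF // gpos.
pose U0 := support_opens f0.
have sub0 : carrier U0 `<=` carrier U := @support_sub _ _ _ _ _ f0.
have U0n p : carrier U0 p ->
    vert_norm g h F u0 p != 0 /\ tension g h F e p != 0.
  move=> U0p; have fp := fE p (sub0 _ U0p); have /eqP fn : sval_fun f p != 0 := U0p.
  split; apply/eqP => z; apply: fn; rewrite fp z; first exact: mul0r.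
  by rewrite mxE mulr0.
have [S [SF Sn _]] : _ := local_form (local_submersion_sub sub0 sU)
  (fun p U0p => bih p (sub0 p U0p)) (fun p U0p => (U0n p U0p).2)
  (fun p U0p => (U0n p U0p).1).
have [p1 [i [j Sp1]]] : exists (p1 : pt U0) i j, sval_fun (S i j) (sval p1) != 0.
  apply: contrapT => nS; apply: Sn; apply: mx_evpP => p; rewrite map_mx0.
  apply/matrixP => i j; rewrite [LHS]mxE [RHS]mxE.
  by apply/eqP; apply: contrapT => /negP Sp; apply: nS; exists p, i, j.
pose U1 := support_opens Sp1.
have sub1 : carrier U1 `<=` carrier U0 := @support_sub _ _ _ _ _ Sp1.
have sub01 := subset_trans sub1 sub0.
have [S1 [SF1 _ Sn1]] : _ := local_form (local_submersion_sub sub01 sU)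
  (fun p U1p => bih p (sub01 p U1p)) (fun p U1p => (U0n p (sub1 p U1p)).2)
  (fun p U1p => (U0n p (sub1 p U1p)).1).
(* A zero of [S1] is a zero of [S] through [form_like], yet the entry (i, j) of [S] does not vanish
   on [U1]. *)
apply: Sn1 => p S1p; have U1p := svalP p.
have /(SF1 p)/(SF (exist _ _ (sub1 _ U1p))) /matrixP /(_ i j) := S1p.
rewrite [LHS]mxE [RHS]mxE => Sij; have := U1p.
by rewrite /= => /eqP; apply; exact: Sij.
Qed.

End LocalTheorem.

(** * Charts *)

Section Charts.
Context {R : realType} {n : nat} (M : riemannian_manifold R n.+1)
  (N : riemannian_manifold R n) (phi : M -> N).

Lemma local_dom_source (x : chart R n.+1 M) (y : chart R n N) p :
  local_dom phi x y p -> (coord x @` dom x) p.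
Proof. by move=> [q [xq _] <-]; exists q. Qed.

Lemma local_dom_target (x : chart R n.+1 M) (y : chart R n N) p : atlas x ->
  local_dom phi x y p -> (coord y @` dom y) (local_rep phi x y p).
Proof.
move=> ax [q [xq yq] <-]; exists (phi q); first exact: yq.
by rewrite /local_rep /= (coordK (atlas_chart ax) xq).
Qed.

Lemma target_metric_chart (y : chart R n N) (V : opens R n) : atlas y ->
  carrier V = coord y @` dom y -> target_metric V (metric y).
Proof.
move=> ay VE; split; rewrite VE; first exact: metric_smooth.
  by move=> p; exact: metric_sym.
by move=> p; exact: metric_pos.
Qed.

Lemma local_submersion_chart c (x : chart R n.+1 M) (y : chart R n N)
    (V : opens R n) (O : set 'rV[R]_n.+1) e :
  constant_curvature M c -> riemannian_submersion phi -> atlas x -> atlas y ->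
  carrier V = coord y @` dom y -> O `<=` local_dom phi x y ->
  orthonormal_frame (metric x) O e ->
  local_submersion V (metric x) (metric y) (local_rep phi x y) e c O.
Proof.
move=> hM [[_ phis] hphi] ax ay VE sub [es eon].
have src p : O p -> (coord x @` dom x) p by move=> /sub; exact: local_dom_source.
split=> //.
- exact: smooth_sub src (metric_smooth ax).
- by move=> p /src; exact: metric_sym.
- by move=> p /src; exact: metric_pos.
- exact: smooth_sub sub (phis x y ax ay).
- by move=> p /sub; rewrite VE; exact: local_dom_target.
- by move=> p /sub /(hphi x y ax ay) [].
- by move=> p /sub /(hphi x y ax ay) [].
- by move=> p /src; exact: hM.
Qed.

End Charts.

Theorem theorem1p4 (R : realType) (n : nat) (hn : (2 <= n)%N) (c lambda : R)
    (M : riemannian_manifold R n.+1) (N : riemannian_manifold R n)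
    (phi : M -> N)
    (hM : constant_curvature M c)
    (hphi : riemannian_submersion phi)
    (hc : 0 <= c \/ (c < 0 /\ lambda <> 2 * (n%:R - 1) * c)) :
  lambda_biharmonic lambda phi <-> harmonic_map phi.
Proof.
split=> van x y ax ay O e Oo sub eon p Op;
  (* The point p and its image serve as the base points of U and of the chart image V. *)
  pose U := Opens Oo Op;
  pose V := Opens (open_image (atlas_chart ay)) (local_dom_target ax (sub _ Op));
  have tgt := target_metric_chart (V := V) ay erefl;
  have ls := local_submersion_chart (V := V) hM hphi ax ay erefl sub eon.
- exact: (tension_eq0 (U := U) tgt hn hc ls (van x y ax ay O e Oo sub eon) Op).
- exact: (lambda_bitension_eq0 (U := U) tgt lambda ls (van x y ax ay O e Oo sub eon) Op).
Qed.
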